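(* Let $(M,\langle\,,\rangle)$ be a connected Riemannian manifold of dimension $m\ge2$, and let $A$, $T$, $X$ satisfy assumptions (A1), (A2), (A3), (T1), (T2) of the context, with $L=L_{A,T,X}$, that is (weakly) $$Lu=\operatorname{div}\big(A(|\nabla u|)\,T(\nabla u,\cdot)^\sharp\big)-\langle X,\nabla u\rangle,\qquad u\in\mathcal C^1(M).$$ Let $q\in\mathcal C^0(M)$, $q\ge0$, and suppose that $q(x)>0$ outside some compact set $K\subset M$ and $1/q\in L^1_{loc}(M)$. Assume that the (q-SK) condition of the context holds. If $u\in\mathcal C^1(M)$ and $u^*=\sup_Mu<+\infty$, then for each $\eta>0$ $$\inf_{A_\eta}\{q(x)Lu(x)\}\le0$$ holds in the weak sense (defined in the context), where $A_\eta=\{x\in M:\ u(x)>u^*-\eta\}$.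
   Context: Notation: $\mathbb R^+=(0,+\infty)$; $A:\mathbb R^+\to\mathbb R$ and $\varphi(t)=tA(t)$. Standing assumptions: (A1) $A\in\mathcal C^1(\mathbb R^+)$. (A2) $\varphi'(t)>0$ on $\mathbb R^+$, and $\varphi(t)\to0$ as $t\to0^+$. (A3) $\varphi(t)\le Ct^\delta$ on $(0,\omega)$ for some $\omega,C,\delta>0$. (T1) $T$ is a positive definite, symmetric, 2-covariant tensor field on $M$. (T2) For every $x\in M$ and every $\xi\in T_xM$, $\xi\ne0$, the bilinear form $\frac{A'(|\xi|)}{|\xi|}\langle\xi,\cdot\rangle\odot T(\xi,\cdot)+A(|\xi|)T(\cdot,\cdot)$ is symmetric and positive definite, where $\odot$ is the symmetric tensor product; i.e. for every $v\in T_xM$, $v\neq0$, $\frac1{|\xi|^2}\big(\varphi'(|\xi|)-\frac{\varphi(|\xi|)}{|\xi|}\big)\langle\xi,v\rangle T(\xi,v)+\frac{\varphi(|\xi|)}{|\xi|}T(v,v)>0$. $X$ is a fixed vector field on $M$, and $\sharp:T^*M\to TM$ is the musical isomorphism. $L$ is understood in the weak sense (with $A(|\nabla u|)T(\nabla u,\cdot)$ read as $0$ where $\nabla u=0$). (q-SK) condition: there exists a telescoping exhaustion of $M$ by relatively compact open sets $\{\Sigma_j\}_{j\in\mathbb N}$ such that $K\subset\Sigma_1$, $\overline\Sigma_j\subset\Sigma_{j+1}$ for every $j$ and, for any pair $\Omega_1=\Sigma_{j_1}$, $\Omega_2=\Sigma_{j_2}$ with $j_1<j_2$, and for each $\varepsilon>0$,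 there exists $\gamma\in\mathcal C^0(M\setminus\Omega_1)\cap\mathcal C^1(M\setminus\overline\Omega_1)$ such that: i) $\gamma\equiv0$ on $\partial\Omega_1$; ii) $\gamma>0$ on $M\setminus\overline{\Omega}_1$; iii) $\gamma\le\varepsilon$ on $\Omega_2\setminus\Omega_1$; iv) $\gamma(x)\to+\infty$ as $x\to\infty$ (as $x$ leaves every compact set); v) $q(x)L\gamma\le\varepsilon$ weakly on $M\setminus\overline\Omega_1$, that is, for all $\psi\in\mathcal C_0^\infty(M\setminus\overline\Omega_1)$, $\psi\ge0$, $$\int_{M\setminus\overline\Omega_1}\Big(A(|\nabla\gamma|)T(\nabla\gamma,\nabla\psi)+\langle X,\nabla\gamma\rangle\psi+\frac\varepsilon q\psi\Big)\ge0 .$$ Weak sense of the infimum inequality: for an open set $\Omega\subset M$ and $u\in\mathcal C^1(\Omega)$, ''$\inf_\Omega\{q(x)Lu(x)\}\le0$ holds in the weak sense'' means that for no $\varepsilon>0$ does $Lu\ge\varepsilon/q$ hold weakly on $\Omega$; that is, for each $\varepsilon>0$ there exists $\psi\in\mathcal C_0^\infty(\Omega)$, $\psi\ge0$, with $$-\int_\Omega\big(A(|\nabla u|)T(\nabla u,\nabla\psi)+\langle X,\nabla u\rangle\psi\big)<\int_\Omega\frac\varepsilon q\psi .$$ *)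

(* Defs.v *)
From mathcomp Require Import all_boot all_order all_algebra.
From mathcomp Require Import all_classical all_reals all_analysis.

Set Implicit Arguments.
Unset Strict Implicit.
Unset Printing Implicit Defensive.

Import Order.TTheory GRing.Theory Num.Theory.
Import numFieldNormedType.Exports.

Local Open Scope classical_set_scope.
Local Open Scope ring_scope.

(* C^k regularity of f on the open subset U of R^m. *)
Fixpoint Ck (R : realType) (m : nat) (V : normedModType R) (k : nat)
    (U : set 'rV[R]_m) (f : 'rV[R]_m -> V) : Prop :=
  match k with
  | 0%N => forall y, U y -> {for y, continuous f}
  | k'.+1 => (forall y, U y -> differentiable f y) /\
             (forall v, Ck k' U (fun y => 'D_v f y))
  end.

(* Integral over R^m of a nonnegative Borel function, with respect to the
   Lebesgue measure, as an iterated integral (Tonelli). *)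
Fixpoint rV_integral (R : realType) (m : nat) :
    ('rV[R]_m -> \bar R) -> \bar R :=
  match m with
  | 0%N => fun f => f 0
  | m'.+1 => fun f =>
      (\int[lebesgue_measure]_(t in [set: R])
          rV_integral (fun y : 'rV[R]_m' => f (row_mx (t%:M : 'rV[R]_1) y)))%E
  end.

(* A smooth manifold without boundary.  The values of [coord i] outside
   [dom i], and of [param i] outside the range of the chart, are irrelevant.
   [chart_at x] is a preferred chart around x: it serves to identify the tangent
   space T_x M with 'rV[R]_m. *)
Record manifold (R : realType) (m : nat) (M : ptopologicalType) := Manifold {
  chart : Type;
  dom : chart -> set M;
  coord : chart -> M -> 'rV[R]_m;
  param : chart -> 'rV[R]_m -> M;
  chart_at : M -> chart;
  manifold_hausdorff : hausdorff_space M;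
  manifold_second_countable : @second_countable M;
  dom_open : forall i, open (dom i);
  dom_chart_at : forall x, dom (chart_at x) x;
  codom_open : forall i, open (coord i @` dom i);
  coordK : forall i x, dom i x -> param i (coord i x) = x;
  coord_continuous : forall i x, dom i x -> {for x, continuous (coord i)};
  param_continuous : forall i y, (coord i @` dom i) y ->
    {for y, continuous (param i)};
  transition_smooth : forall i j k,
    Ck k (coord i @` (dom i `&` dom j)) (coord j \o param i)
}.

Section Manifold.
Context {R : realType} {m : nat} {M : ptopologicalType} (S : manifold R m M).

Definition CkM (k : nat) (U : set M) (f : M -> R) : Prop :=
  forall i : chart S, Ck k (coord i @` (dom i `&` U)) (f \o param i).

(* C_0^\infty(U) *)
Definition test_function (U : set M) (f : M -> R) : Prop :=
  [/\ forall k, CkM k [set: M] f,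
      compact (closure [set x | f x != 0]) &
      closure [set x | f x != 0] `<=` U].

(* Change of components, from chart i to chart j, of tangent vectors at x. *)
Definition tangent_change (i j : chart S) (x : M) (v : 'rV[R]_m) : 'rV[R]_m :=
  'd (coord j \o param i) (coord i x) v.

Definition bil (B : 'M[R]_m) (v w : 'rV[R]_m) : R := (v *m B *m w^T) 0 0.

Definition pos_def (B : 'M[R]_m) : Prop :=
  B^T = B /\ forall v, v != 0 -> 0 < bil B v v.

(* A vector field X : M -> 'rV_m and a 2-covariant tensor field B : M -> 'M_m
   are given at each x by their components in the chart [chart_at x]; the next
   two definitions give their components in an arbitrary chart around x. *)
Definition vector_in (i : chart S) (X : M -> 'rV[R]_m) (x : M) : 'rV[R]_m :=
  tangent_change (chart_at S x) i x (X x).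

Definition tensor_in (i : chart S) (B : M -> 'M[R]_m) (x : M) : 'M[R]_m :=
  \matrix_(a, b) bil (B x) (tangent_change i (chart_at S x) x (delta_mx 0 a))
                           (tangent_change i (chart_at S x) x (delta_mx 0 b)).

Definition Ck_vector_field (k : nat) (X : M -> 'rV[R]_m) : Prop :=
  forall i : chart S,
    Ck k (coord i @` dom i) (fun y => vector_in i X (param i y)).

Definition Ck_tensor_field (k : nat) (B : M -> 'M[R]_m) : Prop :=
  forall (i : chart S) a b,
    Ck k (coord i @` dom i) (fun y => tensor_in i B (param i y) a b).

Definition riemannian_metric (g : M -> 'M[R]_m) : Prop :=
  (forall x, pos_def (g x)) /\ forall k, Ck_tensor_field k g.

Definition borel := g_sigma_algebraType (@open M).

(* These equations determine the measure vol on the Borel sets of M, since M is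
   covered by countably many charts. *)
Definition riemannian_volume (g : M -> 'M[R]_m)
    (vol : {measure set borel -> \bar R}) : Prop :=
  forall (i : chart S) (B : set borel), measurable B -> B `<=` dom i ->
    vol B = rV_integral
      ((fun y => (Num.sqrt (\det (tensor_in i g (param i y))))%:E)
         \_ (coord i @` B)).

Definition differential (f : M -> R) (x : M) : 'rV[R]_m :=
  \row_j 'D_(delta_mx 0 j) (f \o param (chart_at S x)) (coord (chart_at S x) x).

(* From <grad f, v> = df(v) for all v. *)
Definition gradient (g : M -> 'M[R]_m) (f : M -> R) (x : M) : 'rV[R]_m :=
  differential f x *m invmx (g x).

Definition gnorm (g : M -> 'M[R]_m) (x : M) (v : 'rV[R]_m) : R :=
  Num.sqrt (bil (g x) v v).

Definition phi (A : R -> R) (t : R) : R := t * A t.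

Definition assumption_A1 (A : R -> R) : Prop :=
  forall t, 0 < t -> derivable A t 1 /\ {for t, continuous (derive1 A)}.

Definition assumption_A2 (A : R -> R) : Prop :=
  (forall t, 0 < t -> 0 < derive1 (phi A) t) /\ phi A t @[t --> 0^'+] --> (0 : R).

Definition assumption_A3 (A : R -> R) : Prop :=
  exists omega C delta : R, [/\ 0 < omega, 0 < C, 0 < delta &
    forall t, 0 < t < omega -> phi A t <= C * t `^ delta].

Definition assumption_T1 (T : M -> 'M[R]_m) : Prop :=
  Ck_tensor_field 0 T /\ forall x, pos_def (T x).

(* a \odot b = (a \otimes b + b \otimes a) / 2 *)
Definition sym_prod (a b : 'rV[R]_m -> R) (v w : 'rV[R]_m) : R :=
  (a v * b w + a w * b v) / 2.

Definition T2_form (g : M -> 'M[R]_m) (A : R -> R) (T : M -> 'M[R]_m) (x : M)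
    (xi v w : 'rV[R]_m) : R :=
  derive1 A (gnorm g x xi) / gnorm g x xi *
    sym_prod (bil (g x) xi) (bil (T x) xi) v w
  + A (gnorm g x xi) * bil (T x) v w.

Definition assumption_T2 (g : M -> 'M[R]_m) (A : R -> R) (T : M -> 'M[R]_m) :
    Prop :=
  forall x xi, xi != 0 ->
    (forall v w, T2_form g A T x xi v w = T2_form g A T x xi w v) /\
    (forall v, v != 0 -> 0 < T2_form g A T x xi v v).

(* A(|\nabla u|) T(\nabla u, \nabla psi) + <X, \nabla u> psi, whose integral is
   the weak form of - \int psi L u.  Where \nabla u = 0 the first summand is 0
   whatever the value of A at 0. *)
Definition weak_L (g : M -> 'M[R]_m) (A : R -> R) (T : M -> 'M[R]_m)
    (X : M -> 'rV[R]_m) (u psi : M -> R) (x : M) : R :=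
  A (gnorm g x (gradient g u x)) *
    bil (T x) (gradient g u x) (gradient g psi x)
  + bil (g x) (X x) (gradient g u x) * psi x.

(* Here the inverse is that of \bar R: 1 / q is +oo where q vanishes. *)
Definition locally_integrable_inv (vol : {measure set borel -> \bar R})
    (q : M -> R) : Prop :=
  forall C : set M, compact C ->
    vol.-integrable C (fun x => ((q x)%:E)^-1)%E.

(* q L gamma <= eps weakly on U *)
Definition qL_le (g : M -> 'M[R]_m) (vol : {measure set borel -> \bar R})
    (A : R -> R) (T : M -> 'M[R]_m) (X : M -> 'rV[R]_m) (q : M -> R)
    (U : set M) (gamma : M -> R) (eps : R) : Prop :=
  forall psi, test_function U psi -> (forall x, 0 <= psi x) ->
    (0 <= \int[vol]_(x in U) ((weak_L g A T X gamma psi x)%:E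
                              + eps%:E / (q x)%:E * (psi x)%:E))%E.

(* inf_U {q L u} <= 0 in the weak sense *)
Definition inf_qL_le0 (g : M -> 'M[R]_m) (vol : {measure set borel -> \bar R})
    (A : R -> R) (T : M -> 'M[R]_m) (X : M -> 'rV[R]_m) (q : M -> R)
    (U : set M) (u : M -> R) : Prop :=
  forall eps : R, 0 < eps ->
    exists psi, [/\ test_function U psi, forall x, 0 <= psi x &
      (- (\int[vol]_(x in U) (weak_L g A T X u psi x)%:E)
       < \int[vol]_(x in U) (eps%:E / (q x)%:E * (psi x)%:E))%E].

(* The exhaustion is indexed from 0: [Sigma 0] is its first set. *)
Definition qSK (g : M -> 'M[R]_m) (vol : {measure set borel -> \bar R})
    (A : R -> R) (T : M -> 'M[R]_m) (X : M -> 'rV[R]_m) (q : M -> R)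
    (K : set M) : Prop :=
  exists Sigma : nat -> set M,
  [/\ forall j, open (Sigma j) /\ compact (closure (Sigma j)),
      \bigcup_j Sigma j = [set: M],
      K `<=` Sigma 0%N,
      forall j, closure (Sigma j) `<=` Sigma j.+1 &
      forall j1 j2 : nat, (j1 < j2)%N -> forall eps : R, 0 < eps ->
        let Omega1 := Sigma j1 in
        let Omega2 := Sigma j2 in
        exists gamma : M -> R,
          ({within ~` Omega1, continuous gamma} /\
           CkM 1 (~` closure Omega1) gamma) /\
          [/\ forall x, (closure Omega1 `\` Omega1°) x -> gamma x = 0,
              forall x, (~` closure Omega1) x -> 0 < gamma x,
              forall x, (Omega2 `\` Omega1) x -> gamma x <= eps,
              forall c : R, exists2 C : set M, compact C &
                forall x, ~ Omega1 x -> ~ C x -> c < gamma x &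
              qL_le g vol A T X q (~` closure Omega1) gamma eps]].

End Manifold.

(* Main.v *)
(** Suppose that L u >= eps0 / q weakly on A_eta.

    If u attains its supremum at some x0, then L u >= c > 0 near x0.  This is
    impossible at an interior maximum; (A3) enters here, to absorb the gradient of
    a cutoff function without any strong maximum principle.

    Otherwise, let u1 be the maximum of u over the closure of some Sigma_j1 meeting
    A_eta, and choose x2 with u(x2) > u1, j2 with x2 in Sigma_j2, and the
    (q-SK) function gamma for an eps < eps0 smaller than (u(x2) - u1) / 2.  Then
    f = u - gamma exceeds u1 at x2, is at most u1 on the boundary of Sigma_j1 and
    tends to -oo at infinity, so that {f >= tau} is a compact subset of A_eta
    outside the closure of Sigma_j1, for every tau in an interval (tau0, max f).
    There L u - L gamma >= (eps0 - eps) / q weakly.  At the maximum points of f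
    the gradient of f vanishes, so that for tau close to max f the drift term
    <X, grad f> is smaller than (eps0 - eps) / q on {f >= tau}.  Testing with an
    increasing function of f vanishing for f <= tau contradicts the monotonicity
    of xi |-> A(|xi|) T(xi, .), which (T2) gives by integration along segments.

    The test functions used are of the form xi^2 with xi only of class C^1; they
    are reached by approximating xi by smooth functions in the charts. *)

Require Import Defs.
From mathcomp Require Import all_boot all_order all_algebra.
From mathcomp Require Import all_classical all_reals all_analysis.
From mathcomp Require Import ring lra.

Import Order.TTheory GRing.Theory Num.Theory.
Import numFieldNormedType.Exports.

Set Implicit Arguments.
Unset Strict Implicit.
Unset Printing Implicit Defensive.

Local Open Scope classical_set_scope.
Local Open Scope ring_scope.

(** * C^k calculus in R^m *)

(** Tangent components at x are given in the chart [chart_at S x], which may jump with x; every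
    continuity statement is therefore transported to a fixed chart. There the weak form reads a . d
    psi + b psi with continuous a and b ([first_order]): (A2) makes the nonlinear flux tend to 0 at
    critical points, whatever A is at 0. Locality, integrability and the passage to C^1 test
    functions rest on this linear form in psi alone. Squares occur because a smooth approximation of
    a nonnegative function may become negative, while the square of a smooth approximation of xi
    does not. The split on whether the supremum is attained reflects two obstacles. An attained
    maximum leaves perhaps no value of u above u1, and it may lie in K, where q can vanish and 1 / q
    can be infinite; only a constant lower bound of eps0 / q is then kept. In the other case the
    comparison takes place outside K, where (eps0 - eps) / q is continuous and positive. *)

Section NearDifferentiable.
Context {R : numFieldType} {V W : normedModType R}.

Lemma near_eq_differentiable (f g : V -> W) (x : V) :
  (\near x, f x = g x) -> differentiable f x -> differentiable g x.
Proof.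
move=> fg df; have fgx := nbhs_singleton fg.
have key : g \o shift x = cst (g x) + 'd f x +o_ 0 id.
  apply/eqaddoP => e e0.
  have := diff_locally df => /eqaddoP/(_ e e0).
  have : \forall h \near (0 : V), f (h + x) = g (h + x).
    by move/nbhs0P: fg; apply: filterS => h; rewrite addrC.
  apply: filterS2 => h /= fgh.
  by rewrite /= !fctE /= fgh fgx.
have dE : 'd g x = 'd f x :> (V -> W).
  by apply: diff_unique => //; exact: diff_continuous.
by apply/diff_locallyP; rewrite dE; split => //; exact: diff_continuous.
Qed.

End NearDifferentiable.

Lemma near_eq_continuous (T U : topologicalType) (f g : T -> U) (x : T) :
  (\near x, f x = g x) -> {for x, continuous f} -> {for x, continuous g}.
Proof.
move=> fg cf; rewrite /prop_for /continuous_at -(nbhs_singleton fg).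
by apply: cvg_trans cf; apply: near_eq_cvg; apply: filterS fg.
Qed.

Section CkCalculus.
Context {R : realType} {m : nat}.
Implicit Types (U W : set 'rV[R]_m) (f g : 'rV[R]_m -> R).

Lemma open_near (T : topologicalType) (U : set T) x : open U -> U x -> \near x, U x.
Proof. by move=> oU Ux; exact: open_nbhs_nbhs. Qed.

Lemma Ck_eq (V : normedModType R) k U (f g : 'rV[R]_m -> V) :
  open U -> (forall y, U y -> f y = g y) -> Ck k U f -> Ck k U g.
Proof.
move=> oU; elim: k f g => [|k IH] f g fg /=.
  move=> cf y Uy; apply: near_eq_continuous (cf _ Uy).
  by apply: (filterS _ (open_near oU Uy)) => z /fg ->.
have nfg y : U y -> \near y, f y = g y.
  by move=> Uy; apply: (filterS _ (open_near oU Uy)) => z /fg ->.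
move=> [df Df]; split => [y Uy|v].
  exact: near_eq_differentiable (nfg _ Uy) (df _ Uy).
apply: IH (Df v) => y Uy; exact: near_eq_derive (nfg _ Uy).
Qed.

Lemma Ck_sub (V : normedModType R) k U W (f : 'rV[R]_m -> V) :
  W `<=` U -> Ck k U f -> Ck k W f.
Proof.
move=> WU; elim: k f => [|k IH] f /= => [cf y /WU /cf //|[df Df]].
by split=> [y /WU /df //|v]; exact: IH.
Qed.

(** The clauses of [Ck] are pointwise statements about full neighbourhoods in R^m, so regularity can
    be glued from arbitrary sets [W]. *)
Lemma Ck_loc (V : normedModType R) k U (f : 'rV[R]_m -> V) :
  (forall y, U y -> exists2 W, W y & Ck k W f) -> Ck k U f.
Proof.
elim: k f => [|k IH] f /= H; first by move=> y /H [W Wy]; exact.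
split => [y /H [W Wy [df _]]|v]; first exact: df.
by apply: IH => y /H [W Wy [_ Df]]; exists W.
Qed.

Lemma CkS (V : normedModType R) k U (f : 'rV[R]_m -> V) : Ck k.+1 U f -> Ck k U f.
Proof.
elim: k f => [|k IH] f [df Df] /=; last by split => // v; exact: IH.
by move=> y Uy; apply: differentiable_continuous; exact: df.
Qed.

Lemma Ck_le (V : normedModType R) k l U (f : 'rV[R]_m -> V) :
  (l <= k)%N -> Ck k U f -> Ck l U f.
Proof.
elim: k => [|k IH]; first by rewrite leqn0 => /eqP->.
by rewrite leq_eqVlt => /predU1P[-> //|lk /CkS]; exact: IH.
Qed.

Lemma Ck_cst (V : normedModType R) k U (c : V) : Ck k U (fun=> c).
Proof.
elim: k c => [|k IH] c /=; first by move=> y _; exact: (@cst_continuous _ _ c y).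
split=> [y _|v]; first exact: differentiable_cst.
have -> : 'D_v (fun=> c : V) = (fun=> 0 : V) :> ('rV[R]_m -> V).
  by apply/funext => y; rewrite derive_cst.
exact: IH.
Qed.

Lemma Ck_component k U n (f : 'rV[R]_m -> 'rV[R]_n) b :
  open U -> Ck k U f -> Ck k U (fun y => f y 0 b).
Proof.
move=> oU; elim: k f => [|k IH] f /=.
  move=> cf y /cf cy; exact: (continuous_comp cy (@coord_continuous _ _ _ 0 b (f y))).
move=> [df Df]; split=> [y Uy|v].
  exact: (differentiable_comp (df _ Uy) (@differentiable_coord _ _ _ (f y) 0 b)).
apply: Ck_eq (IH _ (Df v)) => // y Uy.
by rewrite derive_mx ?mxE//; apply: diff_derivable; exact: df.
Qed.

Lemma Ck_coord k U b : Ck k U (fun y => y 0 b).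
Proof.
apply: (@Ck_sub _ _ setT) => //; apply: Ck_component; first exact: openT.
case: k => [|k]; first by move=> y _; exact: cvg_id.
split=> [y _|v]; first exact: ex_diff.
have -> : 'D_v (fun y : 'rV[R]_m => y) = (fun=> v).
  by apply/funext => y; rewrite derive_id.
exact: Ck_cst.
Qed.

Lemma Ck_add k U f g : open U -> Ck k U f -> Ck k U g -> Ck k U (fun y => f y + g y).
Proof.
move=> oU; elim: k f g => [|k IH] f g /=; first by move=> cf cg y Uy; exact: (continuousD (cf _ Uy) (cg _ Uy)).
move=> [df Df] [dg Dg]; split=> [y Uy|v]; first by exact: (differentiableD (df _ Uy) (dg _ Uy)).
apply: Ck_eq (IH _ _ (Df v) (Dg v)) => // y Uy.
by rewrite deriveD//; apply: diff_derivable; [exact: df|exact: dg].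
Qed.

Lemma Ck_mul k U f g : open U -> Ck k U f -> Ck k U g -> Ck k U (fun y => f y * g y).
Proof.
move=> oU; elim: k f g => [|k IH] f g; first by move=> cf cg y Uy; exact: (continuousM (cf _ Uy) (cg _ Uy)).
move=> Cf Cg; have [df Df] := Cf; have [dg Dg] := Cg.
split=> [y Uy|v]; first by exact: (differentiableM (df _ Uy) (dg _ Uy)).
apply: Ck_eq (Ck_add oU (IH _ _ (CkS Cf) (Dg v)) (IH _ _ (CkS Cg) (Df v))) => // y Uy.
by rewrite deriveM//; apply: diff_derivable; [exact: df|exact: dg].
Qed.

Lemma Ck_opp k U f : open U -> Ck k U f -> Ck k U (fun y => - f y).
Proof.
move=> oU Cf; apply: Ck_eq (Ck_mul oU (Ck_cst k U (-1 : R)) Cf) => // y Uy; by rewrite mulN1r.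
Qed.

Lemma Ck_diff k U f g : open U -> Ck k U f -> Ck k U g -> Ck k U (fun y => f y - g y).
Proof. by move=> oU Cf Cg; apply: Ck_add => //; exact: Ck_opp. Qed.

Lemma Ck_exp k U f n : open U -> Ck k U f -> Ck k U (fun y => f y ^+ n).
Proof.
move=> oU Cf; elim: n => [|n IH]; first exact: Ck_cst.
by apply: Ck_eq (Ck_mul oU Cf IH) => // y _; rewrite exprS.
Qed.

Lemma Ck_sum k U (I : Type) (r : seq I) (P : pred I) (F : I -> 'rV[R]_m -> R) :
  open U -> (forall i, Ck k U (F i)) -> Ck k U (fun y => \sum_(i <- r | P i) F i y).
Proof.
move=> oU CF; elim: r => [|i r IH].
  by apply: Ck_eq (Ck_cst k U (0 : R)) => // y _; rewrite big_nil.
case: (boolP (P i)) => Pi.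
  by apply: Ck_eq (Ck_add oU (CF i) IH) => // y _; rewrite big_cons Pi.
by apply: Ck_eq IH => // y _; rewrite big_cons (negbTE Pi).
Qed.

Lemma Ck_prod k U (I : Type) (r : seq I) (P : pred I) (F : I -> 'rV[R]_m -> R) :
  open U -> (forall i, Ck k U (F i)) -> Ck k U (fun y => \prod_(i <- r | P i) F i y).
Proof.
move=> oU CF; elim: r => [|i r IH].
  by apply: Ck_eq (Ck_cst k U (1 : R)) => // y _; rewrite big_nil.
case: (boolP (P i)) => Pi.
  by apply: Ck_eq (Ck_mul oU (CF i) IH) => // y _; rewrite big_cons Pi.
by apply: Ck_eq IH => // y _; rewrite big_cons (negbTE Pi).
Qed.

Lemma derive_comp1 (h : R -> R) (d : R) f (y v : 'rV[R]_m) :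
  is_derive (f y) (1 : R) h d -> differentiable f y ->
  'D_v (h \o f) y = d * 'D_v f y.
Proof.
move=> dh df.
have dhf : differentiable h (f y) by apply/derivable1_diffP; exact: (@ex_derive _ _ _ _ _ _ _ dh).
rewrite deriveE; last exact: differentiable_comp.
rewrite diff_comp//= diff1E// deriveE// derive1E (@derive_val _ _ _ _ _ _ _ dh).
exact: mulrC.
Qed.

Lemma C1_comp1 (h h' : R -> R) U f : open U ->
  (forall y, U y -> is_derive (f y) (1 : R) h (h' (f y))) ->
  (forall y, U y -> {for f y, continuous h'}) ->
  Ck 1 U f -> Ck 1 U (h \o f).
Proof.
move=> oU dh ch' [df Df].
have dhf y : U y -> differentiable h (f y).
  by move=> Uy; apply/derivable1_diffP; exact: (@ex_derive _ _ _ _ _ _ _ (dh _ Uy)).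
split=> [y Uy|v]; first exact: (differentiable_comp (df _ Uy) (dhf _ Uy)).
apply: (@Ck_eq _ _ _ (fun y => h' (f y) * 'D_v f y)) => // [y Uy|].
  by rewrite (derive_comp1 _ (dh _ Uy))//; exact: df.
apply: Ck_mul => //; last exact: Df.
move=> y Uy; apply: continuous_comp; last exact: ch'.
by apply: differentiable_continuous; exact: df.
Qed.

Lemma row_sum_coord (v : 'rV[R]_m) : v = \sum_b v 0 b *: delta_mx 0 b.
Proof. exact: row_sum_delta. Qed.

Lemma derive_sum_coord (f : 'rV[R]_m -> R) y v : differentiable f y ->
  'D_v f y = \sum_b v 0 b * 'D_(delta_mx 0 b) f y.
Proof.
move=> df; rewrite deriveE// {1}(row_sum_coord v) linear_sum.
by apply: eq_bigr => b _; rewrite linearZ deriveE.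
Qed.

End CkCalculus.

(** By the chain rule the derivative along v is a sum of components of ['D_v T] times partials of
    [f] composed with [T]; the partials lose one order, and the induction on k applies to them. *)
Lemma Ck_comp {R : realType} {m n : nat} k (U : set 'rV[R]_m) (W : set 'rV[R]_n)
    (T : 'rV[R]_m -> 'rV[R]_n) (f : 'rV[R]_n -> R) :
  open U -> open W -> (forall y, U y -> W (T y)) ->
  Ck k U T -> Ck k W f -> Ck k U (f \o T).
Proof.
move=> oU oW UW; elim: k f => [|k IH] f.
  by move=> cT cf y Uy; exact: (continuous_comp (cT _ Uy) (cf _ (UW _ Uy))).
move=> CT Cf; have [dT DT] := CT; have [df Df] := Cf.
split=> [y Uy|v]; first by exact: (differentiable_comp (dT _ Uy) (df _ (UW _ Uy))).
apply: (@Ck_eq _ _ _ _ _ (fun y => \sum_b ('D_v T y) 0 b * 'D_(delta_mx 0 b) f (T y))) => // [y Uy|].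
  rewrite [RHS]deriveE; last by exact: (differentiable_comp (dT _ Uy) (df _ (UW _ Uy))).
  have dfT := df _ (UW _ Uy).
  rewrite (diff_comp (dT _ Uy) dfT) /= -(deriveE _ dfT).
  rewrite (derive_sum_coord _ dfT).
  by rewrite deriveE//; exact: dT.
apply: Ck_sum => // b; apply: Ck_mul => //; first exact: (Ck_component b oU (DT v)).
by apply: IH (Df _); exact: CkS.
Qed.

(** * Smooth cutoffs *)

Section RowNorm.
Context {R : realType} {m : nat}.
Implicit Types v : 'rV[R]_m.

Lemma row_norm_le v (e : R) : 0 <= e -> (forall b, `|v 0 b| <= e) -> `|v| <= e.
Proof.
move=> e0 H; rewrite [leLHS]/Num.norm /= mx_normrE; apply: bigmax_le => // -[i b] _ /=.
by rewrite (ord1 i).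
Qed.

Lemma row_norm_ge v b : `|v 0 b| <= `|v|.
Proof. by rewrite [leRHS]/Num.norm /= mx_normrE; exact: (le_bigmax _ _ (0, b)). Qed.

Lemma row_norm_lt v (e : R) : 0 < e -> (forall b, `|v 0 b| < e) -> `|v| < e.
Proof.
move=> e0 H; rewrite [ltLHS]/Num.norm /= mx_normrE; apply: bigmax_lt => // -[i b] _ /=.
by rewrite (ord1 i).
Qed.

End RowNorm.

Section SmoothStep.
Context {R : realType}.
Implicit Types t : R.

(* The family [flat n] is closed, up to linear combinations, under
   differentiation, which makes all its members smooth. *)
Definition flat (n : nat) t : R := if 0 < t then t^-1 ^+ n * expR (- t^-1) else 0.

Lemma flat_le0 n t : t <= 0 -> flat n t = 0.
Proof. by rewrite /flat ltNge => ->. Qed.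

Lemma flat_gt0 n t : 0 < t -> 0 < flat n t.
Proof. by move=> t0; rewrite /flat t0 mulr_gt0 ?expR_gt0// exprn_gt0// invr_gt0. Qed.

Lemma flat_ge0 n t : 0 <= flat n t.
Proof. by case: (leP t 0) => [/flat_le0->//|/(flat_gt0 n)/ltW]. Qed.

(** The exponential of x is the (n+1)-st power of that of x / (n+1), which is at least x / (n+1). *)
Lemma exprX_expRN_le (n : nat) (x : R) : 0 < x -> x ^+ n.+1 * expR (- x) <= n.+1%:R ^+ n.+1.
Proof.
move=> x0; rewrite expRN ler_pdivrMr ?expR_gt0//.
have -> : expR x = expR (x / n.+1%:R) ^+ n.+1 by rewrite -expRM_natl mulrC divfK.
rewrite -exprMn lerXn2r ?nnegrE ?mulr_ge0 ?expR_ge0 ?(ltW x0)//.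
rewrite mulrC -ler_pdivrMr// (le_trans _ (expR_ge1Dx _))//.
by rewrite lerDr.
Qed.

(** Quadratic decay at 0, obtained by borrowing two powers of 1/t; through [is_derive_sqr_bound] it
    gives the derivative 0 at the junction t = 0. *)
Lemma flat_le n t : flat n t <= n.+2%:R ^+ n.+2 * t ^+ 2.
Proof.
case: (leP t 0) => t0; first by rewrite flat_le0// mulr_ge0 ?sqr_ge0.
have ti0 : 0 < t^-1 by rewrite invr_gt0.
have -> : flat n t = t^-1 ^+ n.+2 * expR (- t^-1) * t ^+ 2.
  by rewrite /flat t0 [t^-1 ^+ n.+2]exprS [t^-1 ^+ n.+1]exprS; field; rewrite gt_eqF.
exact: ler_wpM2r (sqr_ge0 t) _ _ (exprX_expRN_le n.+1 ti0).
Qed.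

Lemma is_derive_sqr_bound (f : R -> R) (C : R) :
  (forall t, `|f t| <= C * t ^+ 2) -> is_derive (0 : R) (1 : R) f 0.
Proof.
move=> fC; have f0 : f 0 = 0.
  by apply/normr0_eq0/eqP; rewrite eq_le normr_ge0 (le_trans (fC 0))// expr0n mulr0.
have C0 : 0 <= C.
  by have := le_trans (normr_ge0 _) (fC 1); rewrite expr1n mulr1.
suff H : h^-1 *: (f (h *: 1 + 0) - f 0) @[h --> 0^'] --> (0 : R).
  split; first by apply/cvg_ex; exists 0.
  by apply: cvg_lim => //.
apply/cvgr0Pnorm_le => e e0.
near=> h.
have h0 : h != 0 by near: h; exact: nbhs_dnbhs_neq.
rewrite f0 subr0 addr0 normrZ normfV ler_pdivrMl ?normr_gt0//.
rewrite [h *: 1]mulr1 (le_trans (fC _))// -[h ^+ 2]ger0_norm ?sqr_ge0// normrX.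
rewrite expr2 mulrA mulrC ler_wpM2l// ?normr_ge0//.
have /ltW : `|h| < e / (C + 1) by near: h; apply: dnbhs0_lt; rewrite divr_gt0// ltr_wpDl.
rewrite ler_pdivlMr ?ltr_wpDl// => h1; rewrite (le_trans _ h1)//.
by rewrite mulrC ler_wpM2l// lerDl.
Unshelve. all: by end_near. Qed.

Lemma is_derive_flat n t :
  is_derive t (1 : R) (flat n) (flat n.+2 t - n%:R * flat n.+1 t).
Proof.
have [t0|t0|->] := ltrgtP t 0.
- rewrite !flat_le0 ?(ltW t0)// mulr0 subr0.
  suff nf : \near t, cst 0 t = flat n t.
    exact: near_eq_is_derive nf (is_derive_cst (0 : R) t (1 : R)).
  near=> s; rewrite flat_le0//= ltW//; near: s; exact: lt_nbhsl t0.
- have nf : \forall s \near t, s^-1 ^+ n * expR (- s^-1) = flat n s.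
    near=> s; rewrite /flat; suff -> : 0 < s by [].
    by near: s; exact: (lt_nbhsr t0).
  apply: (near_eq_is_derive nf).
  have tn0 : t != 0 by rewrite gt_eqF.
  rewrite /flat t0.
  have dV : is_derive t (1 : R) (fun s : R => s^-1) (- t^-1 ^+ 2).
    by apply: is_derive_eq; [exact: is_deriveV|rewrite -exprVn [LHS]mulr1].
  have dE : is_derive t (1 : R) (fun s : R => expR (- s^-1)) (t^-1 ^+ 2 * expR (- t^-1)).
    have dc := @is_derive1_comp _ expR (fun s => - s^-1) _ _ _
      (is_derive_expR (- t^-1)) (is_deriveN dV).
    by rewrite opprK mulrC in dc.
  have dX : is_derive t (1 : R) (fun s : R => s^-1 ^+ n) (- n%:R * t^-1 ^+ n.+1).
    case: n {nf} => [|n]; first by rewrite oppr0 mul0r; exact: is_derive_cst.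
    have := is_deriveX n.+1 dV; rewrite exprfctE => dX; apply: is_derive_eq.
    by rewrite scalerN /GRing.scale /= -mulrA -exprD addn2 mulNr.
  have dM := is_deriveM dX dE; apply: (is_derive_eq dM).
  by rewrite /GRing.scale /= !exprS; ring.
- rewrite !flat_le0 ?lexx// mulr0 subr0.
  apply: (@is_derive_sqr_bound _ (n.+2%:R ^+ n.+2)) => s.
  by rewrite ger0_norm ?flat_ge0// flat_le.
Unshelve. all: by end_near. Qed.

Lemma continuous_flat n : continuous (flat n).
Proof.
move=> t; apply: differentiable_continuous; apply/derivable1_diffP.
exact: (@ex_derive _ _ _ _ _ _ _ (is_derive_flat n t)).
Qed.

Lemma flatD_gt0 t : 0 < flat 0 t + flat 0 (1 - t).
Proof.
case: (leP t 0) => t0; last by rewrite ltr_pwDl ?flat_gt0 ?flat_ge0.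
by rewrite ltr_wpDl ?flat_ge0// flat_gt0// subr_gt0 (le_lt_trans t0).
Qed.

Definition step t : R := flat 0 t / (flat 0 t + flat 0 (1 - t)).

(** The quotient rule for [step], simplified with the fact that [flat 2] is the derivative of
    [flat 0]. *)
Definition dstep t : R :=
  (flat 2 t * flat 0 (1 - t) + flat 0 t * flat 2 (1 - t))
  / (flat 0 t + flat 0 (1 - t)) ^+ 2.

Lemma step_le0 t : t <= 0 -> step t = 0.
Proof. by move=> t0; rewrite /step (flat_le0 0 t0) mul0r. Qed.

Lemma step_ge1 t : 1 <= t -> step t = 1.
Proof.
move=> t1; rewrite /step [X in _ + X]flat_le0 ?subr_le0// addr0 divff// gt_eqF//.
by rewrite flat_gt0// (lt_le_trans _ t1).
Qed.

Lemma step_ge0 t : 0 <= step t.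
Proof. by rewrite divr_ge0 ?flat_ge0// ltW// flatD_gt0. Qed.

Lemma step_le1 t : step t <= 1.
Proof. by rewrite ler_pdivrMr ?flatD_gt0// mul1r lerDl flat_ge0. Qed.

Lemma dstep_le0 t : t <= 0 -> dstep t = 0.
Proof. by move=> t0; rewrite /dstep !(flat_le0 _ t0) !mul0r addr0 mul0r. Qed.

Lemma dstep_ge1 t : 1 <= t -> dstep t = 0.
Proof.
by move=> t1; rewrite /dstep !(@flat_le0 _ (1 - t)) ?subr_le0// !mulr0 addr0 mul0r.
Qed.

Lemma is_derive_flat_onem n t :
  is_derive t (1 : R) (fun t => flat n (1 - t)) (- (flat n.+2 (1 - t) - n%:R * flat n.+1 (1 - t))).
Proof.
have d1 : is_derive t (1 : R) (fun t : R => 1 - t) (- 1).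
  have d1 := is_deriveB (is_derive_cst (1 : R) t (1 : R)) (is_derive_id t (1 : R)).
  by apply: (is_derive_eq d1); rewrite sub0r.
have dc := @is_derive1_comp _ (flat n) (fun t => 1 - t) _ _ _ (is_derive_flat n _) d1.
by apply: (is_derive_eq dc); rewrite mulrN1.
Qed.

Lemma is_derive_step t : is_derive t (1 : R) step (dstep t).
Proof.
have D0 : flat 0 t + flat 0 (1 - t) != 0 by rewrite gt_eqF// flatD_gt0.
have dD := is_deriveD (is_derive_flat 0 t) (is_derive_flat_onem 0 t).
have dV := @is_deriveV _ (fun t => flat 0 t + flat 0 (1 - t)) _ _ _ D0 dD.
have dM := is_deriveM (is_derive_flat 0 t) dV.
apply: (is_derive_eq dM).
rewrite /dstep /GRing.scale /= !mul0r !subr0.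
by field.
Qed.

Lemma continuous_dstep : continuous dstep.
Proof.
have c1 n : continuous (fun t : R => flat n (1 - t)).
  move=> t; apply: (@continuous_comp _ _ _ (fun t => 1 - t) (flat n)); last exact: continuous_flat.
  by apply: continuousB; [exact: cst_continuous|exact: cvg_id].
have cD : continuous (fun t => flat 0 t + flat 0 (1 - t)).
  by move=> t; exact: (continuousD (@continuous_flat 0 t) (c1 0 t)).
have cN : continuous (fun t => flat 2 t * flat 0 (1 - t) + flat 0 t * flat 2 (1 - t)).
  move=> t; apply: (continuousD (continuousM (@continuous_flat 2 t) (c1 0 t))).
  exact: (continuousM (@continuous_flat 0 t) (c1 2 t)).
move=> t; apply: (continuousM (cN t)); apply: continuousV.
  by rewrite expf_neq0// gt_eqF// flatD_gt0.
exact: (continuous_comp (cD t) (@exprn_continuous _ 2 _)).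
Qed.

Lemma dstep_bounded : exists2 B : R, 0 <= B & forall t, `|dstep t| <= B.
Proof.
have [c _ cM] : exists2 c, c \in `[(0 : R), 1] & forall t, t \in `[(0 : R), 1] -> `|dstep t| <= `|dstep c|.
  apply: (@EVT_max R (fun t => `|dstep t|) 0 1) => //.
  apply: continuous_subspaceT => t; apply: continuous_comp; first exact: continuous_dstep.
  exact: norm_continuous.
exists `|dstep c| => // t.
case: (ltP t 0) => [/ltW/dstep_le0->|t0]; first by rewrite normr0.
case: (ltP 1 t) => [/ltW/dstep_ge1->|t1]; first by rewrite normr0.
by apply: cM; rewrite in_itv /= t0.
Qed.

Lemma Ck_flat m k n (U : set 'rV[R]_m) (f : 'rV[R]_m -> R) :
  open U -> Ck k U f -> Ck k U (flat n \o f).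
Proof.
move=> oU; elim: k n => [|k IH] n Cf.
  by move=> y Uy; exact: (continuous_comp (Cf _ Uy) (@continuous_flat n (f y))).
have [df Df] := Cf; have dF t : differentiable (flat n) t.
  apply/derivable1_diffP; exact: (@ex_derive _ _ _ _ _ _ _ (is_derive_flat n t)).
split=> [y Uy|v]; first exact: (differentiable_comp (df _ Uy) (dF (f y))).
have Cf' := CkS Cf.
apply: (@Ck_eq _ _ _ _ _ (fun y => (flat n.+2 (f y) - n%:R * flat n.+1 (f y)) * 'D_v f y)) => //.
  by move=> y Uy; rewrite (derive_comp1 _ (is_derive_flat n _))//; exact: df.
apply: Ck_mul (Df v) => //; apply: Ck_diff => //; first exact: IH.
by apply: Ck_mul => //; [exact: Ck_cst|exact: IH].
Qed.

Lemma Ck_inv m k (U : set 'rV[R]_m) (f : 'rV[R]_m -> R) :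
  open U -> (forall y, U y -> f y != 0) -> Ck k U f -> Ck k U (fun y => (f y)^-1).
Proof.
move=> oU f0; elim: k => [|k IH] Cf.
  by move=> y Uy; exact: (continuousV (f0 _ Uy) (Cf _ Uy)).
have [df Df] := Cf.
split=> [y Uy|v]; first exact: (differentiableV (df _ Uy) (f0 _ Uy)).
have Cf' := IH (CkS Cf).
apply: (@Ck_eq _ _ _ _ _ (fun y => - ((f y)^-1 ^+ 2 * 'D_v f y))) => //.
  move=> y Uy; rewrite deriveV; [|exact: f0|exact/diff_derivable/df].
  by rewrite -exprVn scaleNr.
by apply: Ck_opp => //; apply: Ck_mul (Df v) => //; exact: Ck_exp.
Qed.

Lemma Ck_step m k (U : set 'rV[R]_m) (f : 'rV[R]_m -> R) :
  open U -> Ck k U f -> Ck k U (step \o f).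
Proof.
move=> oU Cf.
have C1f : Ck k U (fun y => 1 - f y) by apply: Ck_diff => //; exact: Ck_cst.
apply: Ck_mul => //; first exact: Ck_flat.
apply: Ck_inv => // [y _|]; first by rewrite gt_eqF// flatD_gt0.
by apply: Ck_add => //; exact: Ck_flat.
Qed.

End SmoothStep.

(** * C^1 approximation by smooth functions *)

Section Lattice.
Context {R : realType}.
Implicit Types t : R.

(** Written as a difference of shifted steps so that its integer translates telescope to 1: a smooth
    partition of unity on the line. *)
Definition bump t : R := step (t + 1) - step t.
Definition dbump t : R := dstep (t + 1) - dstep t.

Lemma bump_ge0 t : 0 <= bump t.
Proof.
rewrite /bump subr_ge0; case: (leP t 0) => t0; first by rewrite step_le0// step_ge0.
by rewrite (@step_ge1 _ (t + 1)) ?step_le1// lerDr ltW.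
Qed.

Lemma bump_le1 t : bump t <= 1.
Proof. by rewrite /bump lerBlDr (le_trans (step_le1 _))// lerDl step_ge0. Qed.

Lemma bump0 : bump 0 = 1.
Proof. by rewrite /bump add0r step_ge1// step_le0// subr0. Qed.

Lemma bump_out t : 1 <= `|t| -> bump t = 0.
Proof.
rewrite /bump ler_normr => /orP[t1|t1].
  by rewrite !step_ge1 ?subrr//; lra.
by rewrite !step_le0 ?subrr//; lra.
Qed.

Lemma dbump_out t : 1 <= `|t| -> dbump t = 0.
Proof.
rewrite /dbump ler_normr => /orP[t1|t1].
  by rewrite !dstep_ge1 ?subrr//; lra.
by rewrite !dstep_le0 ?subrr//; lra.
Qed.

Lemma is_derive_bump t : is_derive t (1 : R) bump (dbump t).
Proof.
have d1 : is_derive t (1 : R) (fun t : R => t + 1) 1.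
  have d1 := is_deriveD (is_derive_id t (1 : R)) (is_derive_cst (1 : R) t (1 : R)).
  by apply: (is_derive_eq d1); rewrite addr0.
have dc := @is_derive1_comp _ step (fun t => t + 1) _ _ _ (is_derive_step _) d1.
have dB := is_deriveB dc (is_derive_step t).
by apply: (is_derive_eq dB); rewrite mulr1.
Qed.

Lemma Ck_bump m k (U : set 'rV[R]_m) (f : 'rV[R]_m -> R) :
  open U -> Ck k U f -> Ck k U (bump \o f).
Proof.
move=> oU Cf; apply: Ck_diff => //; last exact: Ck_step.
have C1 : Ck k U (fun y => f y + 1) by apply: Ck_add => //; exact: Ck_cst.
exact: (Ck_step oU C1).
Qed.

Lemma sum_shift_diff (F : R -> R) t n :
  \sum_(j < n.+1) (F (t - j%:R + 1) - F (t - j%:R)) = F (t + 1) - F (t - n%:R).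
Proof.
elim: n => [|n IH]; first by rewrite big_ord_recl big_ord0 addr0 subr0.
rewrite big_ord_recr /= IH -[in t - n.+1%:R + 1]natr1.
have -> : t - (n%:R + 1) + 1 = t - n%:R by ring.
ring.
Qed.

Lemma sum_bump t n : 0 <= t -> t <= n%:R -> \sum_(j < n.+1) bump (t - j%:R) = 1.
Proof.
move=> t0 tn; rewrite /bump sum_shift_diff step_ge1 ?lerDr// step_le0 ?subr0//.
by rewrite subr_le0.
Qed.

Lemma sum_dbump t n : 0 <= t -> t <= n%:R -> \sum_(j < n.+1) dbump (t - j%:R) = 0.
Proof.
move=> t0 tn; rewrite /dbump sum_shift_diff dstep_ge1 ?lerDr// dstep_le0 ?subr0//.
by rewrite subr_le0.
Qed.

(** [dstep] vanishes off the open interval (0, 1), so at most one term of the sum survives. In the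
    induction, either the last term is 0 or all the earlier ones are. *)
Lemma sum_dstep_le (B : R) t n : 0 <= B -> (forall t, `|dstep t| <= B) ->
  \sum_(j < n) `|dstep (t - j%:R)| <= B.
Proof.
move=> B0 dB; elim: n => [|n IH]; first by rewrite big_ord0.
rewrite big_ord_recr /=; case: (leP t n%:R) => tn.
  by rewrite (@dstep_le0 _ (t - n%:R)) ?subr_le0// normr0 addr0.
rewrite big1 ?add0r// => j _; rewrite dstep_ge1 ?normr0//.
have : j%:R + 1 <= n%:R :> R by rewrite natr1 ler_nat.
by move: tn; lra.
Qed.

(** The point is that B depends neither on t nor on n: it stays fixed while the lattice is
    refined. *)
Lemma sum_dbump_le : exists2 B : R, 0 <= B &
  forall t n, \sum_(j < n) `|dbump (t - j%:R)| <= B.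
Proof.
have [B B0 dB] := @dstep_bounded R; exists (B + B); first exact: addr_ge0.
move=> t n; apply: le_trans (lerD (sum_dstep_le (t + 1) n B0 dB) (sum_dstep_le t n B0 dB)).
rewrite -big_split /=; apply: ler_sum => j _.
rewrite (le_trans (ler_normB _ _))// lerD2r.
by have -> : t - j%:R + 1 = t + 1 - j%:R by ring.
Qed.

End Lattice.

(** Only y is confined to the compact set: z may leave it, as the lattice nodes near the edge of a
    box do. *)
Lemma uniform_continuous_on_compact {R : realType} {m : nat}
    (A : set 'rV[R]_m) (D : 'rV[R]_m -> R) (e : R) :
  compact A -> continuous D -> 0 < e ->
  \forall d \near (0 : R)^'+, forall y z, A y -> `|y - z| <= d -> `|D y - D z| < e.
Proof.
move=> cA cD e0.
have /compact_near_coveringP nA := cA.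
have := nA _ _ (fun d y => forall z, `|y - z| <= d -> `|D y - D z| < e).
move=> /(_ (0 : R)^'+ _) H; apply: filterS (H _) => [d Ad y z Ay|x Ax]; first exact: Ad.
have e2 : 0 < e / 2 by rewrite divr_gt0.
have /cvgrPdist_lt/(_ _ e2) := cD x.
move=> /nbhs_normP[d /= d0 dD].
have d2 : 0 < d / 2 by rewrite divr_gt0.
exists (ball x (d / 2), [set t | t < d / 2]) => /=.
  by split; [exact: nbhsx_ballx|exact: nbhs_right_lt].
move=> [y t] /= [xy td] z yz.
rewrite -ball_normE /= in xy.
have xz : `|x - z| < d.
  rewrite -(subrKA y) (le_lt_trans (ler_normD _ _))//.
  by rewrite [ltRHS]splitr ltrD// (le_lt_trans yz).
have xyd : `|x - y| < d by rewrite (lt_trans xy)// ltr_pdivrMr// ltr_pMr// ltr1n.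
rewrite -(subrKA (D x)) (le_lt_trans (ler_normD _ _))// [ltRHS]splitr ltrD//.
  by rewrite distrC; exact: dD.
exact: dD.
Qed.

(** The mean value theorem on the segment from p to y, which lies in the ball around y where the
    oscillation of the partials is at most e. The factor m counts the coordinates, the norm being
    the sup norm. *)
Lemma taylor1_le {R : realType} {m : nat} (f : 'rV[R]_m -> R) (p y : 'rV[R]_m) (e : R) :
  (forall z, differentiable f z) ->
  (forall b z, `|z - y| <= `|p - y| -> `|'D_(delta_mx 0 b) f z - 'D_(delta_mx 0 b) f p| <= e) ->
  `|f p + \sum_b 'D_(delta_mx 0 b) f p * (y 0 b - p 0 b) - f y| <= m%:R * (e * `|p - y|).
Proof.
move=> df De.
pose F (t : R) := f (t *: (y - p) + p).
have dF (t : R) : is_derive t (1 : R) F ('D_(y - p) f (t *: (y - p) + p)).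
  have E : (fun h : R => h^-1 *: (F (h *: 1 + t) - F t)) =
      (fun h : R => h^-1 *: (f (h *: (y - p) + (t *: (y - p) + p)) - f (t *: (y - p) + p))).
    by apply/funext => h; rewrite /F [h *: 1]mulr1 scalerDl addrA.
  split; last by rewrite /derive E.
  by rewrite /derivable E; exact: (@diff_derivable _ _ _ f (t *: (y - p) + p) (y - p) (df _)).
have cF : {within `[0 : R, 1], continuous F}.
  apply: continuous_subspaceT => t; apply: differentiable_continuous.
  by apply/derivable1_diffP; exact: (@ex_derive _ _ _ _ _ _ _ (dF t)).
have [t t01] := MVT_segment ler01 (fun t _ => dF t) cF.
rewrite /F scale1r subrK scale0r add0r subr0 mulr1 => fE.
have -> : f y = f p + 'D_(y - p) f (t *: (y - p) + p) by rewrite -fE addrC subrK.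
rewrite opprD addrACA subrr add0r derive_sum_coord// -sumrB.
rewrite (le_trans (ler_norm_sum _ _ _))//.
have -> : m%:R * (e * `|p - y|) = \sum_(b < m) e * `|p - y|.
  by rewrite sumr_const card_ord mulr_natl.
apply: ler_sum => b _; rewrite !mxE mulrC -mulrBr normrM mulrC.
rewrite ler_pM//; last first.
  by have := row_norm_ge (p - y) b; rewrite !mxE distrC.
rewrite distrC; apply: De.
have -> : t *: (y - p) + p - y = (1 - t) *: (p - y).
  by apply/rowP => c; rewrite !mxE; ring.
move: t01; rewrite in_itv /= => /andP[t0 t1].
rewrite normrZ ger0_norm ?subr_ge0// ler_piMl//; lra.
Qed.

Section LatticeApproximation.
Context {R : realType} {m : nat}.
Variables (a : 'rV[R]_m) (rho : R) (n : nat) (rho0 : 0 < rho).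
Implicit Types (y : 'rV[R]_m) (k : {ffun 'I_m -> 'I_n.+1}) (c b : 'I_m).

Definition node k : 'rV[R]_m := \row_b (a 0 b + rho * (k b)%:R).

Definition cell_coord (b : 'I_m) (j : 'I_n.+1) y : R := rho^-1 * (y 0 b - a 0 b) - j%:R.

Definition cell_bump k y : R := \prod_b bump (cell_coord b (k b) y).

(** The b-th factor of the c-th partial of a cell bump, without the scaling 1 / rho: the derivative
    falls on the factor b = c. *)
Definition cell_factor (c b : 'I_m) (j : 'I_n.+1) y : R :=
  if b == c then dbump (cell_coord b j y) else bump (cell_coord b j y).

Lemma Ck_cell_coord l b j : Ck l setT (cell_coord b j).
Proof.
have oT := @openT 'rV[R]_m.
apply: Ck_diff => //; last exact: Ck_cst.
apply: Ck_mul => //; first exact: Ck_cst.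
by apply: Ck_diff => //; [exact: Ck_coord|exact: Ck_cst].
Qed.

Lemma Ck_cell_bump l k : Ck l setT (cell_bump k).
Proof.
have oT := @openT 'rV[R]_m.
by apply: Ck_prod => // b; exact: (Ck_bump oT (Ck_cell_coord _ _ _)).
Qed.

Lemma differentiable_cell_coord b j y : differentiable (cell_coord b j) y.
Proof. by have [+ _] := Ck_cell_coord 1 b j; exact. Qed.

Lemma derive_cell_coord c b j y :
  'D_(delta_mx 0 c) (cell_coord b j) y = rho^-1 * (b == c)%:R.
Proof.
rewrite /derive.
have E : (fun h : R => h^-1 *: (cell_coord b j (h *: delta_mx 0 c + y) - cell_coord b j y))
    = (fun h : R => h^-1 * h * (rho^-1 * (b == c)%:R)).
  apply/funext => h; rewrite /cell_coord !mxE eqxx /= /GRing.scale /=; ring.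
rewrite E; apply: cvg_lim => //.
have : (fun=> rho^-1 * (b == c)%:R : R) @ (0 : R)^' --> rho^-1 * (b == c)%:R.
  exact: cvg_cst.
apply: cvg_trans; apply: near_eq_cvg; near=> h.
by rewrite mulVf ?mul1r//; near: h; exact: nbhs_dnbhs_neq.
Unshelve. all: by end_near. Qed.

Lemma derive_bump_cell c b j y :
  'D_(delta_mx 0 c) (bump \o cell_coord b j) y =
  (b == c)%:R * (rho^-1 * dbump (cell_coord b j y)).
Proof.
rewrite (derive_comp1 _ (is_derive_bump _) (differentiable_cell_coord b j y)).
by rewrite derive_cell_coord mulrC -mulrA mulrCA.
Qed.

Lemma derive_prod0 (I : Type) (r : seq I) (P : pred I) (F : I -> 'rV[R]_m -> R) v y :
  (forall i, Ck 1 setT (F i)) -> (forall i, P i -> 'D_v (F i) y = 0) ->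
  'D_v (fun y => \prod_(i <- r | P i) F i y) y = 0.
Proof.
move=> CF DF; have oT := @openT 'rV[R]_m.
elim: r => [|i r IH].
  have -> : (fun y => \prod_(i <- [::] | P i) F i y) = cst 1.
    by apply/funext => z; rewrite big_nil.
  by rewrite derive_cst.
case: (boolP (P i)) => Pi; last first.
  by under eq_fun do rewrite big_cons (negbTE Pi).
have -> : (fun y => \prod_(i <- i :: r | P i) F i y) =
    F i * (fun y => \prod_(i <- r | P i) F i y).
  by apply/funext => z; rewrite big_cons Pi.
rewrite deriveM.
- by rewrite IH DF// !scaler0 addr0.
- by apply: diff_derivable; apply (CF i).1.
- by apply: diff_derivable; apply (Ck_prod r P oT CF).1.
Qed.

Lemma derive_big_sum (I : Type) (r : seq I) (F : I -> 'rV[R]_m -> R) v y :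
  (forall i, Ck 1 setT (F i)) ->
  'D_v (fun y => \sum_(i <- r) F i y) y = \sum_(i <- r) 'D_v (F i) y.
Proof.
move=> CF; have oT := @openT 'rV[R]_m.
elim: r => [|i r IH].
  rewrite big_nil; have -> : (fun y => \sum_(i <- [::]) F i y) = cst 0.
    by apply/funext => z; rewrite big_nil.
  by rewrite derive_cst.
have -> : (fun y => \sum_(i <- i :: r) F i y) =
    F i + (fun y => \sum_(i <- r) F i y).
  by apply/funext => z; rewrite big_cons.
rewrite big_cons deriveD ?IH//.
- by apply: diff_derivable; apply (CF i).1.
- by apply: diff_derivable; apply (Ck_sum r xpredT oT CF).1.
Qed.

Lemma derive_cell_bump (c : 'I_m) k y :
  'D_(delta_mx 0 c) (cell_bump k) y = rho^-1 * \prod_b cell_factor c b (k b) y.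
Proof.
have oT := @openT 'rV[R]_m.
have CF b : Ck 1 setT (bump \o cell_coord b (k b)).
  exact: (Ck_bump oT (Ck_cell_coord _ _ _)).
have -> : cell_bump k = (bump \o cell_coord c (k c)) *
    (fun y => \prod_(b | b != c) (bump \o cell_coord b (k b)) y).
  by apply/funext => z; rewrite /cell_bump (bigD1 c).
rewrite deriveM.
- rewrite derive_prod0//; last by move=> b bc; rewrite derive_bump_cell (negbTE bc) mul0r.
  rewrite scaler0 add0r derive_bump_cell eqxx mul1r.
  rewrite [in RHS](bigD1 c)//= /cell_factor eqxx.
  rewrite /GRing.scale /= mulrC -mulrA; congr (_ * (_ * _)).
  by apply: eq_bigr => b /negbTE ->.
- by apply: diff_derivable; apply (CF c).1.
- by apply: diff_derivable; apply (Ck_prod _ (fun b => b != c) oT CF).1.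
Qed.

Definition in_grid y := forall b, a 0 b <= y 0 b <= a 0 b + rho * n%:R.

Lemma in_grid_coord y b : in_grid y ->
  0 <= rho^-1 * (y 0 b - a 0 b) /\ rho^-1 * (y 0 b - a 0 b) <= n%:R.
Proof.
move=> /(_ b)/andP[ay ya]; rewrite mulr_ge0 ?invr_ge0 ?(ltW rho0) ?subr_ge0//.
by split=> //; rewrite ler_pdivrMl// lerBlDl.
Qed.

(** Distributivity turns the sum over multi-indices of products into a product of one-dimensional
    sums, each equal to 1. The same exchange serves for the derivatives below. *)
Lemma sum_cell_bump y : in_grid y -> \sum_k cell_bump k y = 1.
Proof.
move=> gy; rewrite /cell_bump -(bigA_distr_bigA (fun b j => bump (cell_coord b j y))).
apply: big1 => b _; have [t0 tn] := in_grid_coord b gy.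
exact: sum_bump.
Qed.

Lemma sum_derive_cell_bump c y : in_grid y ->
  \sum_k 'D_(delta_mx 0 c) (cell_bump k) y = 0.
Proof.
move=> gy; under eq_bigr do rewrite derive_cell_bump.
rewrite -mulr_sumr -(bigA_distr_bigA (fun b j => cell_factor c b j y)) (bigD1 c)//=.
have [t0 tn] := in_grid_coord c gy.
by rewrite /cell_factor eqxx sum_dbump// mul0r mulr0.
Qed.

(** The loss of a factor 1 / rho is compensated later by the Taylor remainders, which are of size e
    * rho. *)
Lemma sum_norm_derive_cell_bump (B : R) c y : 0 <= B ->
  (forall t n, \sum_(j < n) `|dbump (t - j%:R)| <= B :> R) ->
  in_grid y ->
  \sum_k `|'D_(delta_mx 0 c) (cell_bump k) y| <= rho^-1 * B.
Proof.
move=> B0 dB gy; under eq_bigr do rewrite derive_cell_bump normrM normr_prod.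
rewrite -mulr_sumr -(bigA_distr_bigA (fun b j => `|cell_factor c b j y|)) (bigD1 c)//=.
rewrite gtr0_norm ?invr_gt0// ler_wpM2l ?invr_ge0 ?(ltW rho0)//.
rewrite [X in _ * X <= _]big1 => [|b bc]; last first.
  have [t0 tn] := in_grid_coord b gy; rewrite -[RHS](sum_bump t0 tn).
  by apply: eq_bigr => j _; rewrite /cell_factor (negbTE bc) ger0_norm// bump_ge0.
by rewrite mulr1 /cell_factor eqxx dB.
Qed.

Lemma cell_bump_ge0 k y : 0 <= cell_bump k y.
Proof. by apply: prodr_ge0 => b _; exact: bump_ge0. Qed.

Lemma cell_coordE k b y : cell_coord b (k b) y = rho^-1 * (y 0 b - node k 0 b).
Proof. by rewrite /cell_coord mxE; field; rewrite gt_eqF. Qed.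

Lemma cell_far k y : rho < `|y - node k| ->
  exists b, 1 < `|cell_coord b (k b) y|.
Proof.
move=> ny; apply: contrapT => /forallNP H; move: ny; apply/negP; rewrite -leNgt.
apply: row_norm_le => [|b]; first exact: ltW.
have := H b => /negP; rewrite -leNgt cell_coordE normrM gtr0_norm ?invr_gt0//.
by rewrite ler_pdivrMl// mulr1 !mxE.
Qed.

Lemma cell_bump_far k y : rho < `|y - node k| -> cell_bump k y = 0.
Proof.
move=> /cell_far[b /ltW b1]; rewrite /cell_bump (bigD1 b)//=.
by rewrite bump_out// mul0r.
Qed.

Lemma derive_cell_bump_far c k y : rho < `|y - node k| ->
  'D_(delta_mx 0 c) (cell_bump k) y = 0.
Proof.
move=> /cell_far[b /ltW b1]; rewrite derive_cell_bump (bigD1 b)//= /cell_factor.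
by case: ifP => _; rewrite ?dbump_out ?bump_out// mul0r mulr0.
Qed.

Variable f : 'rV[R]_m -> R.

Definition jet k y : R :=
  f (node k) + \sum_b 'D_(delta_mx 0 b) f (node k) * (y 0 b - node k 0 b).

Definition lattice_approx y : R := \sum_k jet k y * cell_bump k y.

Lemma Ck_jet l k : Ck l setT (jet k).
Proof.
have oT := @openT 'rV[R]_m.
apply: Ck_add => //; first exact: Ck_cst.
apply: Ck_sum => // b; apply: Ck_mul => //; first exact: Ck_cst.
by apply: Ck_diff => //; [exact: Ck_coord|exact: Ck_cst].
Qed.

Lemma derive_jet c k y :
  'D_(delta_mx 0 c) (jet k) y = 'D_(delta_mx 0 c) f (node k).
Proof.
rewrite /derive.
have E : (fun h : R => h^-1 *: (jet k (h *: delta_mx 0 c + y) - jet k y))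
    = (fun h : R => h^-1 * h * 'D_(delta_mx 0 c) f (node k)).
  apply/funext => h; rewrite /jet opprD addrACA subrr add0r -sumrB (bigD1 c)//=.
  rewrite big1 => [|b bc]; rewrite !mxE /= ?eqxx ?(negbTE bc) /=; last by ring.
  rewrite addr0 /GRing.scale /=; ring.
rewrite E -/(derive f (node k) (delta_mx 0 c)); apply: cvg_lim => //.
have : (fun=> 'D_(delta_mx 0 c) f (node k) : R) @ (0 : R)^' --> 'D_(delta_mx 0 c) f (node k).
  exact: cvg_cst.
apply: cvg_trans; apply: near_eq_cvg; near=> h.
by rewrite mulVf ?mul1r//; near: h; exact: nbhs_dnbhs_neq.
Unshelve. all: by end_near. Qed.

Lemma Ck_lattice_approx l : Ck l setT lattice_approx.
Proof.
have oT := @openT 'rV[R]_m.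
by apply: Ck_sum => // k; apply: Ck_mul => //; [exact: Ck_jet|exact: Ck_cell_bump].
Qed.

Lemma lattice_approx_out y :
  (forall p, `|y - p| <= rho -> f p = 0 /\ forall b, 'D_(delta_mx 0 b) f p = 0) ->
  lattice_approx y = 0.
Proof.
move=> fp; rewrite /lattice_approx big1// => k _.
case: (leP `|y - node k| rho) => [/fp[f0 Df0]|/cell_bump_far->]; last by rewrite mulr0.
by rewrite /jet f0 big1 ?addr0 ?mul0r// => b _; rewrite Df0 mul0r.
Qed.

Variables (e : R) (y : 'rV[R]_m).
Hypotheses (gy : in_grid y) (df : forall z, differentiable f z).
Hypothesis De : forall c p z, `|p - y| <= rho -> `|z - y| <= rho ->
  `|'D_(delta_mx 0 c) f z - 'D_(delta_mx 0 c) f p| <= e.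

Lemma jet_error k : `|y - node k| <= rho -> `|jet k y - f y| <= m%:R * (e * rho).
Proof.
(* The sign of e is read off [De] for some coordinate; if m = 0 there is none, but then the product
   vanishes. *)
move=> yk; have e0 : m%:R * e >= 0.
  have [->|m0] := posnP m; first by rewrite mul0r.
  rewrite mulr_ge0//; have := @De (Ordinal m0) y y.
  by rewrite !subrr !normr0; apply; exact: ltW.
rewrite (le_trans (@taylor1_le _ _ f (node k) y e df _))//.
  move=> b z zy; apply: De; first by rewrite distrC.
  by rewrite (le_trans zy)// distrC.
by rewrite !mulrA ler_wpM2l// distrC.
Qed.

Lemma lattice_approx_error : `|lattice_approx y - f y| <= m%:R * (e * rho).
Proof.
have -> : f y = \sum_k f y * cell_bump k y by rewrite -mulr_sumr sum_cell_bump// mulr1.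
rewrite /lattice_approx -sumrB.
rewrite (le_trans (ler_norm_sum _ _ _))// -[leRHS]mulr1 -[X in _ <= _ * X](sum_cell_bump gy) mulr_sumr.
apply: ler_sum => k _; rewrite -mulrBl normrM (ger0_norm (cell_bump_ge0 _ _)).
case: (leP `|y - node k| rho) => [yk|/cell_bump_far->]; last by rewrite !mulr0.
by apply: ler_wpM2r; [exact: cell_bump_ge0|exact: jet_error].
Qed.

Lemma derive_lattice_approx_error (B : R) c : 0 <= B ->
  (forall t n, \sum_(j < n) `|dbump (t - j%:R)| <= B :> R) ->
  `|'D_(delta_mx 0 c) lattice_approx y - 'D_(delta_mx 0 c) f y| <= e + m%:R * e * B.
Proof.
move=> B0 dB.
have derT F z : Ck 1 [set: 'rV[R]_m] F -> derivable F z (delta_mx 0 c).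
  by move=> [dF _]; apply: diff_derivable; exact: dF.
have -> : 'D_(delta_mx 0 c) lattice_approx y = \sum_k
    ('D_(delta_mx 0 c) f (node k) * cell_bump k y + jet k y * 'D_(delta_mx 0 c) (cell_bump k) y).
  rewrite /lattice_approx derive_big_sum => [|k]; last first.
    by apply: Ck_mul => //; [exact: openT|exact: Ck_jet|exact: Ck_cell_bump].
  apply: eq_bigr => k _; rewrite deriveM; last 2 first.
  - exact/derT/Ck_jet.
  - exact/derT/Ck_cell_bump.
  by rewrite derive_jet addrC; congr (_ + _); exact: mulrC.
rewrite big_split /=.
have -> : \sum_k jet k y * 'D_(delta_mx 0 c) (cell_bump k) y =
    \sum_k (jet k y - f y) * 'D_(delta_mx 0 c) (cell_bump k) y.
  under [RHS]eq_bigr do rewrite mulrBl.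
  by rewrite sumrB -mulr_sumr sum_derive_cell_bump// mulr0 subr0.
have -> : 'D_(delta_mx 0 c) f y = \sum_k 'D_(delta_mx 0 c) f y * cell_bump k y.
  by rewrite -mulr_sumr sum_cell_bump// mulr1.
rewrite addrAC -sumrB (le_trans (ler_normD _ _))// lerD//.
  rewrite (le_trans (ler_norm_sum _ _ _))// -[leRHS]mulr1 -[X in _ <= _ * X](sum_cell_bump gy) mulr_sumr.
  apply: ler_sum => k _; rewrite -mulrBl normrM (ger0_norm (cell_bump_ge0 _ _)).
  case: (leP `|y - node k| rho) => [yk|/cell_bump_far->]; last by rewrite !mulr0.
  rewrite ler_wpM2r ?cell_bump_ge0// De//; first by rewrite subrr normr0 ltW.
  by rewrite distrC.
have -> : m%:R * e * B = m%:R * (e * rho) * (rho^-1 * B).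
  by field; rewrite gt_eqF.
have e0 : 0 <= m%:R * (e * rho) by rewrite (le_trans _ lattice_approx_error).
rewrite (le_trans _ (ler_wpM2l e0 (sum_norm_derive_cell_bump c B0 dB gy)))//.
rewrite (le_trans (ler_norm_sum _ _ _))// mulr_sumr.
apply: ler_sum => k _; rewrite normrM.
case: (leP `|y - node k| rho) => [yk|/derive_cell_bump_far->]; last by rewrite normr0 !mulr0.
by apply: ler_wpM2r; [exact: normr_ge0|exact: jet_error].
Qed.

End LatticeApproximation.

Lemma continuous_row_dist {R : realType} {m : nat} (y0 : 'rV[R]_m) :
  continuous (fun y : 'rV[R]_m => `|y - y0|).
Proof.
move=> y; apply: (@continuous_comp _ _ _ (fun y : 'rV[R]_m => y - y0) (fun y => `|y|)).
  by apply: continuousB; [exact: cvg_id|exact: cst_continuous].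
exact: norm_continuous.
Qed.

Lemma compact_row_ball {R : realType} {m : nat} (y0 : 'rV[R]_m) (r : R) :
  compact [set y | `|y - y0| <= r].
Proof.
apply: bounded_closed_compact.
  exists (r + `|y0|); split; first exact: num_real.
  move=> x xr y /= yr; rewrite (le_trans _ (ltW xr))// -[y in leLHS](subrK y0).
  by rewrite (le_trans (ler_normD _ _))// lerD2r.
have -> : [set y | `|y - y0| <= r] = (fun y => `|y - y0|) @^-1` [set t | t <= r] by [].
apply: preimage_closed; last exact: closed_le.
by move=> y _; exact: continuous_row_dist.
Qed.

Lemma derive_locally0 {R : realType} {m : nat} (f : 'rV[R]_m -> R) (U : set 'rV[R]_m) y v :
  open U -> U y -> (forall z, U z -> f z = 0) -> 'D_v f y = 0.
Proof.
move=> oU Uy f0; rewrite -(@derive_cst _ _ _ (0 : R) y v); apply: near_eq_derive.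
exact: filterS f0 (open_near oU Uy).
Qed.

Lemma open_row_far {R : realType} {m : nat} (y0 : 'rV[R]_m) (r : R) :
  open [set y | r < `|y - y0|].
Proof.
have -> : [set y | r < `|y - y0|] = (fun y => `|y - y0|) @^-1` [set t | r < t] by [].
apply: open_comp; last exact: open_gt.
by move=> y _; exact: continuous_row_dist.
Qed.

(* Multiplying the first order Taylor polynomials at the nodes of a fine lattice
   by a partition of unity adapted to the cells approximates [f] in the C^1
   sense: the gradients of the partition sum to 0, so that only the Taylor
   remainders, which are small compared with the mesh, meet them. *)
Lemma smooth_approx {R : realType} {m : nat} (f : 'rV[R]_m -> R)
    (y0 : 'rV[R]_m) (r r' e : R) :
  0 < r -> r < r' -> 0 < e -> Ck 1 setT f ->
  (forall y, r < `|y - y0| -> f y = 0) ->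
  exists g : 'rV[R]_m -> R, [/\ forall k, Ck k setT g,
    forall y, r' < `|y - y0| -> g y = 0 &
    forall y, `|y - y0| <= r' -> `|g y - f y| <= e /\
      forall c, `|'D_(delta_mx 0 c) g y - 'D_(delta_mx 0 c) f y| <= e].
Proof.
move=> r0 rr' e0 Cf f0; have [df Df] := Cf.
have r'0 : 0 < r' by exact: lt_trans rr'.
have [B B0 dB] := @sum_dbump_le R.
pose C : R := 1 + m%:R + m%:R * B.
have mB0 : 0 <= m%:R * B by rewrite mulr_ge0.
(* C dominates the two errors in units of e1: m for the values, as soon as the mesh is at most 1,
   and 1 + m B for the partials. *)
have C0 : 0 < C by rewrite /C -addrA ltr_pwDl// addr_ge0.
pose e1 := e / C.
have e10 : 0 < e1 by rewrite divr_gt0.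
have e12 : 0 < e1 / 2 by rewrite divr_gt0.
pose A := [set y | `|y - y0| <= r'].
have cA : compact A by exact: compact_row_ball.
have cD c : continuous (fun y => 'D_(delta_mx 0 c) f y).
  by move=> y; apply: (Df (delta_mx 0 c) y).
have nd : \forall d \near (0 : R)^'+, forall c y z, A y -> `|y - z| <= d ->
    `|'D_(delta_mx 0 c) f y - 'D_(delta_mx 0 c) f z| < e1 / 2.
  apply: filter_forall => c.
  exact: (uniform_continuous_on_compact cA (cD c) e12).
(* The bound d on the mesh is below 1 for the error of the values, below r' - r so that the
   approximation vanishes beyond r', and fine enough for the partials to vary by less than e1 /
   2. *)
near (0 : R)^'+ => d.
have d0 : 0 < d by near: d; exact: nbhs_right_gt.
have d1 : d < 1 by near: d; exact: nbhs_right_lt.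
have drr : d < r' - r by near: d; apply: nbhs_right_lt; rewrite subr_gt0.
have Dd : forall c y z, A y -> `|y - z| <= d ->
    `|'D_(delta_mx 0 c) f y - 'D_(delta_mx 0 c) f z| < e1 / 2 by near: d.
(* The grid is to fill the cube of side 2 r' around y0 exactly, with a mesh 2 r' / n not exceeding
   d. *)
pose n := (Num.truncn (2 * r' / d)).+1.
have n0 : 0 < n%:R :> R by rewrite ltr0n.
pose rho := 2 * r' / n%:R.
have rho0 : 0 < rho by rewrite !divr_gt0// mulr_gt0.
have rhod : rho <= d.
  rewrite ler_pdivrMr// [d * _]mulrC -ler_pdivrMr// ltW//.
  by rewrite /n; apply: truncnS_gt.
pose a : 'rV[R]_m := \row_b (y0 0 b - r').
have gA y : A y -> in_grid a rho n y.
  move=> Ay b; have := le_trans (row_norm_ge (y - y0) b) Ay.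
  rewrite !mxE ler_distl => /andP[y1 y2]; rewrite y1 /= /rho divfK ?gt_eqF//.
  by rewrite (le_trans y2)//; lra.
have Dp c p z y : A y -> `|p - y| <= rho -> `|z - y| <= rho ->
    `|'D_(delta_mx 0 c) f z - 'D_(delta_mx 0 c) f p| <= e1.
  move=> Ay py zy; rewrite -(subrKA ('D_(delta_mx 0 c) f y)).
  rewrite (le_trans (ler_normD _ _))// [leRHS]splitr lerD// ltW//.
    by rewrite distrC Dd// distrC (le_trans zy).
  by rewrite Dd// distrC (le_trans py).
have C1 : m%:R <= C by rewrite /C addrAC lerDr addr_ge0.
have C2 : 1 + m%:R * B <= C by rewrite /C addrAC lerDl.
exists (lattice_approx a rho n f); split.
- exact: Ck_lattice_approx.
- move=> y yr'; apply: lattice_approx_out => // p yp.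
  have rp : r < `|p - y0|.
    have : `|y - y0| <= `|y - p| + `|p - y0| by rewrite -(subrKA p) ler_normD.
    lra.
  split=> [|b]; first exact: f0.
  exact: (derive_locally0 _ (@open_row_far _ _ y0 r) rp f0).
- move=> y Ay; have gy := gA _ Ay; have dfT z := df z I.
  split=> [|c].
    rewrite (le_trans (lattice_approx_error rho0 gy dfT (fun c p z => Dp c p z y Ay)))//.
    rewrite (@le_trans _ _ (m%:R * (e1 * 1)))//; last first.
      by rewrite mulr1 mulrC /e1 mulrAC ler_pdivrMr// ler_wpM2l// ltW.
    by rewrite ler_wpM2l// ler_wpM2l// ?ltW//; lra.
  rewrite (le_trans (derive_lattice_approx_error rho0 gy dfT (fun c p z => Dp c p z y Ay) _ B0 dB))//.
  have -> : e1 + m%:R * e1 * B = e * (1 + m%:R * B) / C by rewrite /e1; ring.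
  by rewrite ler_pdivrMr// ler_wpM2l// ltW.
Unshelve. all: by end_near. Qed.

(* [coord] denotes the charts again, instead of the coordinates of vector.v. *)
Import Defs.

(** * Charts *)

Section Charts.
Context {R : realType} {m : nat} {M : ptopologicalType} (S : manifold R m M).
Implicit Types (i j : chart S) (U V W : set M) (x : M) (y : 'rV[R]_m) (f : M -> R).

Definition codomain i : set 'rV[R]_m := coord i @` dom i.

Lemma codomain_coord i x : dom i x -> codomain i (coord i x).
Proof. by exists x. Qed.

Lemma dom_param i y : codomain i y -> dom i (param i y).
Proof. by move=> [x ix <-]; rewrite coordK. Qed.

Lemma paramK i y : codomain i y -> coord i (param i y) = y.
Proof. by move=> [x ix <-]; rewrite coordK. Qed.

Lemma image_coordE i W : coord i @` (dom i `&` W) = [set y | codomain i y /\ W (param i y)].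
Proof.
apply/seteqP; split=> [_ [x [ix Wx] <-]|y [iy Wy]].
  by split; [exact: codomain_coord|rewrite coordK].
by exists (param i y); [split=> //; exact: dom_param|exact: paramK].
Qed.

Lemma open_image_coord i W : open W -> open (coord i @` (dom i `&` W)).
Proof.
move=> oW; rewrite image_coordE openE => y [iy Wy].
have cp : {for y, continuous (param i)} by exact: param_continuous.
exact: (filterI (open_near (@codom_open _ _ _ S i) iy) (cp _ (open_near oW Wy))).
Qed.

Lemma open_codomain i : open (codomain i).
Proof. exact: codom_open. Qed.

Lemma continuous_param_comp (T : topologicalType) i (f : M -> T) x :
  dom i x -> {for coord i x, continuous (f \o param i)} -> {for x, continuous f}.
Proof.
move=> ix cf; apply: (@near_eq_continuous _ _ ((f \o param i) \o coord i)).
  by apply: filterS (open_near (dom_open i) ix) => z iz /=; rewrite coordK.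
exact: (continuous_comp (coord_continuous ix) cf).
Qed.

Lemma CkM_chart k U f :
  (forall x, U x -> exists i W, [/\ dom i x, open W, W x &
     Ck k (coord i @` (dom i `&` W)) (f \o param i)]) ->
  CkM S k U f.
Proof.
move=> H j; apply: Ck_loc => y; rewrite image_coordE => -[jy Uy].
have [i [W [ix oW Wx CW]]] := H _ Uy.
pose N := coord j @` (dom j `&` (dom i `&` W)).
have oN : open N by apply: open_image_coord; apply: openI => //; exact: dom_open.
exists N; first by rewrite /N image_coordE.
apply: (@Ck_eq _ _ _ _ _ ((f \o param i) \o (coord i \o param j))) => //.
  by move=> z; rewrite /N image_coordE => -[jz [iz Wz]]; rewrite /= coordK.
apply: (Ck_comp oN _ _ _ CW).
- exact: open_image_coord.
- move=> z; rewrite /N !image_coordE => -[jz [iz Wz]] /=.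
  by split; [exact: codomain_coord|rewrite coordK].
- apply: Ck_sub (@transition_smooth _ _ _ S j i k).
  by move=> z; rewrite /N !image_coordE => -[jz [iz Wz]].
Qed.

Lemma CkM_sub k U V f : V `<=` U -> CkM S k U f -> CkM S k V f.
Proof.
move=> VU Cf i; apply: Ck_sub (Cf i).
by move=> y; rewrite !image_coordE => -[iy /VU].
Qed.

Lemma CkM_eq k U f g : open U -> (forall x, U x -> f x = g x) -> CkM S k U f -> CkM S k U g.
Proof.
move=> oU fg Cf i; apply: Ck_eq (Cf i); first exact: open_image_coord.
by move=> y; rewrite image_coordE => -[_ /fg].
Qed.

Lemma CkM_loc k U f : (forall x, U x -> exists2 W, open W /\ W x & CkM S k W f) -> CkM S k U f.
Proof.
move=> H; apply: CkM_chart => x /H [W [oW Wx] CW].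
exists (chart_at S x), W; split => //; first exact: dom_chart_at.
Qed.

Lemma CkM_cst k U (c : R) : CkM S k U (fun=> c).
Proof. move=> i; exact: (Ck_cst k _ c). Qed.

Lemma CkMM k U f g : open U -> CkM S k U f -> CkM S k U g -> CkM S k U (fun x => f x * g x).
Proof. by move=> oU Cf Cg i; exact: (Ck_mul (open_image_coord oU) (Cf i) (Cg i)). Qed.

Lemma CkMB k U f g : open U -> CkM S k U f -> CkM S k U g -> CkM S k U (fun x => f x - g x).
Proof. by move=> oU Cf Cg i; exact: (Ck_diff (open_image_coord oU) (Cf i) (Cg i)). Qed.

Lemma CkMX k U f n : open U -> CkM S k U f -> CkM S k U (fun x => f x ^+ n).
Proof. by move=> oU Cf i; exact: (Ck_exp n (open_image_coord oU) (Cf i)). Qed.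

Lemma CkM_sum k U (I : Type) (r : seq I) (F : I -> M -> R) :
  open U -> (forall l, CkM S k U (F l)) -> CkM S k U (fun x => \sum_(l <- r) F l x).
Proof.
move=> oU CF i.
exact: (Ck_sum r xpredT (open_image_coord oU) (fun l => CF l i)).
Qed.

Lemma C1M_comp1 (h h' : R -> R) U f : open U ->
  (forall x, U x -> is_derive (f x) (1 : R) h (h' (f x))) ->
  (forall x, U x -> {for f x, continuous h'}) ->
  CkM S 1 U f -> CkM S 1 U (h \o f).
Proof.
move=> oU dh ch' Cf i.
apply: (C1_comp1 (open_image_coord oU) _ _ (Cf i)) => y; rewrite image_coordE => -[_ Uy].
  exact: dh.
exact: ch'.
Qed.

Lemma CkM_continuous k U f x : U x -> CkM S k U f -> {for x, continuous f}.
Proof.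
move=> Ux Cf; have ix := dom_chart_at S x; apply: (continuous_param_comp ix).
apply: (Ck_le (leq0n k) (Cf _)).
by rewrite image_coordE; split; [exact: codomain_coord|rewrite coordK].
Qed.

Definition chart_box i (y0 : 'rV[R]_m) (r : R) : set M :=
  param i @` [set y | `|y - y0| <= r].

(** The whole closed ball has to lie in the range of the chart, since [param] is arbitrary
    elsewhere. *)
Definition box_in i V (y0 : 'rV[R]_m) (r : R) : Prop :=
  forall y, `|y - y0| <= r -> codomain i y /\ V (param i y).

Lemma chart_boxP i V y0 r x : box_in i V y0 r ->
  chart_box i y0 r x <-> dom i x /\ `|coord i x - y0| <= r.
Proof.
move=> bV; split=> [[y yr <-]|[ix xr]]; last by exists (coord i x); rewrite ?coordK.
by have [iy Vy] := bV _ yr; split; [exact: dom_param|rewrite paramK].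
Qed.

Lemma chart_box_sub i V y0 r : box_in i V y0 r -> chart_box i y0 r `<=` V.
Proof. by move=> bV _ [y /bV[_ ?] <-]. Qed.

Lemma box_in_le i V y0 r r' : r <= r' -> box_in i V y0 r' -> box_in i V y0 r.
Proof. by move=> rr' bV y yr; apply: bV; exact: le_trans rr'. Qed.

Lemma compact_chart_box i V y0 r : box_in i V y0 r -> compact (chart_box i y0 r).
Proof.
move=> bV; apply: continuous_compact; last exact: compact_row_ball.
apply: continuous_in_subspaceT => z; rewrite inE => zr; have [iz _] := bV _ zr.
exact: param_continuous.
Qed.

Lemma closed_compact (C : set M) : compact C -> closed C.
Proof. by move=> cC; apply: compact_closed => //; exact: (manifold_hausdorff S). Qed.

Lemma box_in_exists i V x : open V -> V x -> dom i x ->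
  exists2 r, 0 < r & box_in i V (coord i x) r.
Proof.
move=> oV Vx ix.
have : nbhs (coord i x) (coord i @` (dom i `&` V)).
  apply: (open_near (open_image_coord oV)).
  by rewrite image_coordE; split; [exact: codomain_coord|rewrite coordK].
move=> /nbhs_normP[r /= r0 rV]; exists (r / 2); first by rewrite divr_gt0.
move=> y yr; suff : (coord i @` (dom i `&` V)) y by rewrite image_coordE.
apply: rV => /=; rewrite distrC (le_lt_trans yr)//.
by rewrite ltr_pdivrMr// ltr_pMr// ltr1n.
Qed.

Definition chart_lift i (g : 'rV[R]_m -> R) : M -> R :=
  fun x => if pselect (dom i x) then g (coord i x) else 0.

Lemma chart_liftE i g x : dom i x -> chart_lift i g x = g (coord i x).
Proof. by rewrite /chart_lift; case: pselect. Qed.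

Lemma chart_lift_out i V y0 r g x : box_in i V y0 r -> (forall y, r < `|y - y0| -> g y = 0) ->
  ~ chart_box i y0 r x -> chart_lift i g x = 0.
Proof.
move=> bV g0 nx; rewrite /chart_lift; case: pselect => // ix; apply: g0.
rewrite ltNge; apply/negP => xr; apply: nx.
by apply/(chart_boxP x bV); split.
Qed.

(** Points outside the chart domain have the complement of the box as a neighbourhood, the box being
    compact and hence closed in a Hausdorff space; the lift vanishes there. *)
Lemma CkM_lift k i V y0 r g : box_in i V y0 r -> (forall y, r < `|y - y0| -> g y = 0) ->
  Ck k setT g -> CkM S k setT (chart_lift i g).
Proof.
move=> bV g0 Cg; apply: CkM_chart => x _.
case: (pselect (dom i x)) => ix.
  exists i, (dom i); split => //; first exact: dom_open.
  apply: (@Ck_eq _ _ _ _ _ g); first by apply: open_image_coord; exact: dom_open.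
    move=> y; rewrite image_coordE => -[iy _] /=.
    by rewrite chart_liftE; [rewrite paramK|exact: dom_param].
  exact: Ck_sub Cg.
exists (chart_at S x), (~` chart_box i y0 r); split => //.
- exact: dom_chart_at.
- by apply: closed_openC; apply: closed_compact; exact: compact_chart_box bV.
- by move=> /(chart_boxP x bV)[].
- apply: (@Ck_eq _ _ _ _ _ (fun=> 0 : R)); last exact: Ck_cst.
    apply: open_image_coord; apply: closed_openC; apply: closed_compact.
    exact: compact_chart_box bV.
  by move=> y; rewrite image_coordE => -[_ yn]; rewrite /= (chart_lift_out bV).
Qed.

Definition chart_pullback i f : 'rV[R]_m -> R :=
  fun y => if pselect (codomain i y) then f (param i y) else 0.
Arguments chart_pullback : clear implicits.

Lemma chart_pullbackE i f y : codomain i y -> chart_pullback i f y = f (param i y).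
Proof. by rewrite /chart_pullback; case: pselect. Qed.

Lemma chart_pullback_out i V y0 r f y : box_in i V y0 r ->
  (forall x, ~ chart_box i y0 r x -> f x = 0) -> r < `|y - y0| -> chart_pullback i f y = 0.
Proof.
move=> bV f0 yr; rewrite /chart_pullback; case: pselect => // iy; apply: f0.
by move=> /(chart_boxP _ bV)[_]; rewrite paramK// leNgt yr.
Qed.

Lemma Ck_pullback k i V y0 r f : box_in i V y0 r ->
  (forall x, ~ chart_box i y0 r x -> f x = 0) ->
  CkM S k setT f -> Ck k setT (chart_pullback i f).
Proof.
move=> bV f0 Cf; apply: Ck_loc => y _.
case: (pselect (codomain i y)) => iy.
  exists (codomain i) => //; apply: Ck_eq (Ck_sub _ (Cf i)); first exact: open_codomain.
    by move=> z iz; rewrite chart_pullbackE.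
  by move=> z iz; rewrite image_coordE.
exists [set z | r < `|z - y0|].
  by rewrite /= ltNge; apply/negP => yr; have [] := bV _ yr.
apply: (@Ck_eq _ _ _ _ _ (fun=> 0 : R)); last exact: Ck_cst.
  exact: open_row_far.
by move=> z zr; rewrite (chart_pullback_out bV).
Qed.

Lemma test_function_lift i V y0 r g : box_in i V y0 r -> (forall y, r < `|y - y0| -> g y = 0) ->
  (forall k, Ck k setT g) -> test_function S V (chart_lift i g).
Proof.
move=> bV g0 Cg.
have cB := compact_chart_box bV.
have sB : closure [set x | chart_lift i g x != 0] `<=` chart_box i y0 r.
  have /closure_id -> := closed_compact cB.
  apply: closureS => x /= gx; apply: contrapT => nx.
  by move: gx; rewrite (chart_lift_out bV g0 nx) eqxx.
split=> [k||]; first exact: (CkM_lift bV g0).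
- exact: (subclosed_compact (@closed_closure _ _) cB sB).
- exact: subset_trans sB (chart_box_sub bV).
Qed.

End Charts.

(** * Continuity of matrix-valued functions *)

Section MatrixContinuity.
Context {R : realType} {T : topologicalType}.
Implicit Types x : T.

Definition mx_continuous_at p q (N : T -> 'M[R]_(p, q)) x : Prop :=
  forall a b, {for x, continuous (fun z => N z a b)}.

Lemma eq_continuous_at (f g : T -> R) x :
  f =1 g -> {for x, continuous f} -> {for x, continuous g}.
Proof. by move=> /funext ->. Qed.

Lemma continuous_at_sum (I : Type) (r : seq I) (P : pred I) (F : I -> T -> R) x :
  (forall i, {for x, continuous (F i)}) ->
  {for x, continuous (fun z => \sum_(i <- r | P i) F i z)}.
Proof.
move=> cF; elim: r => [|i r IH].
  apply: (@eq_continuous_at (fun=> 0)) => [z|]; first by rewrite big_nil.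
  exact: cst_continuous.
case: (boolP (P i)) => Pi.
  apply: eq_continuous_at (continuousD (cF i) IH) => z.
  by rewrite big_cons Pi.
by apply: eq_continuous_at IH => z; rewrite big_cons (negbTE Pi).
Qed.

Lemma continuous_at_prod (I : Type) (r : seq I) (P : pred I) (F : I -> T -> R) x :
  (forall i, {for x, continuous (F i)}) ->
  {for x, continuous (fun z => \prod_(i <- r | P i) F i z)}.
Proof.
move=> cF; elim: r => [|i r IH].
  apply: (@eq_continuous_at (fun=> 1)) => [z|]; first by rewrite big_nil.
  exact: cst_continuous.
case: (boolP (P i)) => Pi.
  apply: eq_continuous_at (continuousM (cF i) IH) => z.
  by rewrite big_cons Pi.
by apply: eq_continuous_at IH => z; rewrite big_cons (negbTE Pi).
Qed.

Lemma mx_continuous_mul p q s (N : T -> 'M[R]_(p, q)) (N' : T -> 'M[R]_(q, s)) x :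
  mx_continuous_at N x -> mx_continuous_at N' x ->
  mx_continuous_at (fun z => N z *m N' z) x.
Proof.
move=> cN cN' a b.
apply: (@eq_continuous_at (fun z => \sum_c N z a c * N' z c b)) => [z|]; first by rewrite mxE.
by apply: continuous_at_sum => c; exact: (continuousM (cN _ _) (cN' _ _)).
Qed.

Lemma mx_continuous_tr p q (N : T -> 'M[R]_(p, q)) x :
  mx_continuous_at N x -> mx_continuous_at (fun z => (N z)^T) x.
Proof. by move=> cN a b; apply: eq_continuous_at (cN b a) => z; rewrite mxE. Qed.

Lemma continuous_at_det p (N : T -> 'M[R]_p) x :
  mx_continuous_at N x -> {for x, continuous (fun z => \det (N z))}.
Proof.
move=> cN; apply: continuous_at_sum => s.
apply: continuousM; first exact: cst_continuous.
by apply: continuous_at_prod => i; exact: cN.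
Qed.

(** Cramer's rule: near x the determinant does not vanish and the inverse is the adjugate divided by
    it. *)
Lemma mx_continuous_inv p (N : T -> 'M[R]_p) x :
  N x \in unitmx -> mx_continuous_at N x -> mx_continuous_at (fun z => invmx (N z)) x.
Proof.
move=> Nu cN a b; have cd := continuous_at_det cN.
have d0 : \det (N x) != 0 by rewrite -unitfE -unitmxE.
apply: (@near_eq_continuous _ _ (fun z => (\det (N z))^-1 * cofactor (N z) b a)).
  have : \forall z \near x, \det (N z) != 0.
    exact: (cd _ (open_near (@open_neq R 0) d0)).
  apply: filterS => z dz; rewrite /invmx unitmxE unitfE dz.
  by rewrite !mxE.
apply: continuousM; first exact: continuousV.
apply: continuousM; first exact: cst_continuous.
apply: continuous_at_det => c d; apply: eq_continuous_at (cN _ _) => z.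
by rewrite !mxE.
Qed.

Lemma continuous_at_bil p (B : T -> 'M[R]_p) (v w : T -> 'rV[R]_p) x :
  mx_continuous_at B x -> mx_continuous_at v x -> mx_continuous_at w x ->
  {for x, continuous (fun z => bil (B z) (v z) (w z))}.
Proof.
move=> cB cv cw; rewrite /bil.
apply: (mx_continuous_mul _ (mx_continuous_tr cw)).
exact: mx_continuous_mul.
Qed.

End MatrixContinuity.

(** * Bilinear forms and coercivity *)

Section Bilinear.
Context {R : realType} {m : nat}.
Implicit Types (B : 'M[R]_m) (v w : 'rV[R]_m).

Lemma bil_mul B (J : 'M[R]_m) v w : bil B (v *m J) (w *m J) = bil (J *m B *m J^T) v w.
Proof. by rewrite /bil trmx_mul !mulmxA. Qed.

Lemma bilZl B a v w : bil B (a *: v) w = a * bil B v w.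
Proof. by rewrite /bil -!scalemxAl mxE. Qed.

Lemma bilZr B a v w : bil B v (a *: w) = a * bil B v w.
Proof. by rewrite /bil linearZ /= -scalemxAr mxE. Qed.

Lemma bilDl B v v' w : bil B (v + v') w = bil B v w + bil B v' w.
Proof. by rewrite /bil !mulmxDl mxE. Qed.

Lemma bilDr B v w w' : bil B v (w + w') = bil B v w + bil B v w'.
Proof. by rewrite /bil linearD /= mulmxDr mxE. Qed.

Lemma bilNl B v w : bil B (- v) w = - bil B v w.
Proof. by rewrite -scaleN1r bilZl mulN1r. Qed.

Lemma bilNr B v w : bil B v (- w) = - bil B v w.
Proof. by rewrite -scaleN1r bilZr mulN1r. Qed.

Lemma bilBr B v w w' : bil B v (w - w') = bil B v w - bil B v w'.
Proof. by rewrite bilDr bilNr. Qed.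

Lemma bilBl B v v' w : bil B (v - v') w = bil B v w - bil B v' w.
Proof. by rewrite bilDl bilNl. Qed.

Lemma bil0l B w : bil B 0 w = 0.
Proof. by rewrite /bil !mul0mx mxE. Qed.

Lemma bil0r B v : bil B v 0 = 0.
Proof. by rewrite /bil trmx0 mulmx0 mxE. Qed.

Lemma pos_def_unit B : pos_def B -> B \in unitmx.
Proof.
move=> [_ Bp]; rewrite -row_free_unit -kermx_eq0; apply: contraT => /rowV0Pn[v /sub_kermxP vB v0].
by have := Bp v v0; rewrite /bil vB mul0mx mxE ltxx.
Qed.

Lemma pos_def_ge0 B v : pos_def B -> 0 <= bil B v v.
Proof.
by move=> [_ Bp]; have [->|/Bp/ltW//] := eqVneq v 0; rewrite bil0l.
Qed.

Lemma bilC B v w : B^T = B -> bil B v w = bil B w v.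
Proof.
move=> BT; have E : w *m B *m v^T = (v *m B *m w^T)^T.
  by rewrite !trmx_mul trmxK BT mulmxA.
by rewrite [RHS]/bil E mxE.
Qed.

Lemma mulmx_row_le p (L : R) (N : 'M[R]_(m, p)) v c : (forall a, `|N a c| <= L) ->
  `|(v *m N) 0 c| <= m%:R * L * `|v|.
Proof.
move=> NL; rewrite mxE (le_trans (ler_norm_sum _ _ _))//.
have -> : m%:R * L * `|v| = \sum_(a < m) L * `|v|.
  by rewrite sumr_const card_ord -mulrA mulr_natl.
by apply: ler_sum => a _; rewrite normrM mulrC ler_pM// row_norm_ge.
Qed.

Lemma bil_le (L : R) B v w : 0 <= L -> (forall a b, `|B a b| <= L) ->
  `|bil B v w| <= m%:R * (m%:R * L) * `|v| * `|w|.
Proof.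
move=> L0 BL; rewrite /bil mxE (le_trans (ler_norm_sum _ _ _))//.
have -> : m%:R * (m%:R * L) * `|v| * `|w| = \sum_(a < m) m%:R * L * `|v| * `|w|.
  by rewrite sumr_const card_ord -!mulrA mulr_natl.
apply: ler_sum => a _; rewrite normrM ler_pM//.
  by apply: mulmx_row_le => b; exact: BL.
by rewrite mxE row_norm_ge.
Qed.

Lemma continuous_bil_self B : continuous (fun v => bil B v v).
Proof.
move=> v; apply: continuous_at_bil => a b.
- exact: cst_continuous.
- exact: matrix_normedtype.coord_continuous.
- exact: matrix_normedtype.coord_continuous.
Qed.

(** The constant is the minimum of the quadratic form over the unit sphere, extended to all vectors
    by homogeneity. *)
Lemma pos_def_coercive B : pos_def B ->
  exists2 l : R, 0 < l & forall v, l * `|v| ^+ 2 <= bil B v v.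
Proof.
move=> pB; pose Sph := [set v : 'rV[R]_m | `|v| = 1].
have cS : compact Sph.
  apply: bounded_closed_compact.
    exists 1; split; first exact: num_real.
    by move=> x x1 v /= ->; exact: ltW.
  have -> : Sph = (fun v => `|v|) @^-1` [set t : R | t = 1] by [].
  by apply: preimage_closed; [move=> v _; exact: norm_continuous|exact: closed_eq].
(* The sphere is empty in dimension 0, where every vector is 0 and any constant works. *)
have [S0|S0] := pselect (Sph !=set0); last first.
  exists 1 => // v; have -> : v = 0.
    apply/eqP; apply: contraT => v0; exfalso; apply: S0.
    by exists (`|v|^-1 *: v); rewrite /Sph/= normrZ normfV normr_id mulVf// normr_eq0.
  by rewrite normr0 expr0n mulr0 bil0l.
have [w Sw wmin] := @EVT_min_rV R _ (fun v => bil B v v) Sph S0 cS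
  (continuous_subspaceT (@continuous_bil_self B)).
have w1 : `|w| = 1 by rewrite inE in Sw.
exists (bil B w w).
  by apply: pB.2; rewrite -normr_eq0 w1 oner_eq0.
move=> v; have [->|v0] := eqVneq v 0; first by rewrite normr0 expr0n mulr0 bil0l.
have nv : 0 < `|v| by rewrite normr_gt0.
have := wmin (`|v|^-1 *: v); rewrite inE /Sph/= normrZ normfV normr_id mulVf ?gt_eqF//.
move=> /(_ erefl); rewrite bilZl bilZr mulrA -expr2 exprVn mulrC.
by rewrite ler_pdivlMr// exprn_gt0.
Qed.

Lemma near_entries_le (T : topologicalType) p q (N : T -> 'M[R]_(p, q)) x :
  mx_continuous_at N x -> forall e : R, 0 < e ->
  \forall z \near x, forall a b, `|N z a b - N x a b| <= e.
Proof.
move=> cN e e0; apply: filter_forall => a; apply: filter_forall => b.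
have /cvgrPdist_le/(_ _ e0) := cN a b.
by apply: filterS => z; rewrite distrC.
Qed.

Lemma near_entries_bounded (T : topologicalType) p q (N : T -> 'M[R]_(p, q)) x :
  mx_continuous_at N x ->
  exists2 L : R, 0 < L & \forall z \near x, forall a b, `|N z a b| <= L.
Proof.
move=> cN; pose L := 1 + \sum_a \sum_b `|N x a b|.
exists L; first by rewrite ltr_pwDl// sumr_ge0// => a _; rewrite sumr_ge0.
apply: filterS (near_entries_le cN ltr01) => z Nz a b.
rewrite -(subrK (N x a b) (N z a b)) (le_trans (ler_normD _ _))// lerD//.
rewrite (bigD1 a)//= (bigD1 b)//= -addrA lerDl addr_ge0//; first by rewrite sumr_ge0.
by rewrite sumr_ge0// => c _; rewrite sumr_ge0.
Qed.

Lemma near_coercive (T : topologicalType) (N : T -> 'M[R]_m) x :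
  mx_continuous_at N x -> pos_def (N x) ->
  exists2 l : R, 0 < l & \forall z \near x, forall v, l * `|v| ^+ 2 <= bil (N z) v v.
Proof.
move=> cN pN; have [l l0 lN] := pos_def_coercive pN.
exists (l / 2); first by rewrite divr_gt0.
(* Entrywise errors at most e perturb the quadratic form by at most m^2 e times the squared norm,
   hence by at most half of the coercivity at x. *)
pose e := l / 2 / (1 + m%:R * m%:R).
have C0 : 0 < 1 + m%:R * m%:R :> R by rewrite ltr_pwDl.
have e0 : 0 < e by rewrite !divr_gt0.
apply: filterS (near_entries_le cN e0) => z Nz v.
have := @bil_le e (N z - N x) v v (ltW e0).
have -> : bil (N z - N x) v v = bil (N z) v v - bil (N x) v v.
  by rewrite /bil mulmxBr mulmxBl !mxE.
move=> H; have {H} : `|bil (N z) v v - bil (N x) v v| <= m%:R * (m%:R * e) * `|v| * `|v|.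
  by apply: H => a b; rewrite !mxE.
have me : m%:R * (m%:R * e) <= l / 2.
  rewrite mulrA /e mulrA ler_pdivrMr// mulrC ler_wpM2l//; last by rewrite lerDr.
  by rewrite divr_ge0// ltW.
rewrite ler_distl => /andP[H _].
have := lN v; rewrite expr2 => lv.
have : m%:R * (m%:R * e) * `|v| * `|v| <= l / 2 * (`|v| * `|v|).
  by rewrite -mulrA ler_wpM2r// mulr_ge0.
move: H lv; set q := `|v| * `|v|; lra.
Qed.

End Bilinear.

(** * Gradient, flux and drift in a fixed chart *)

Section ChartComponents.
Context {R : realType} {m : nat} {M : ptopologicalType} (S : manifold R m M).
Implicit Types (i j : chart S) (U V W : set M) (x : M) (f u psi : M -> R).

(** Row-vector convention: tangent vectors are multiplied on the right by [jac], and covectors by a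
    transposed Jacobian. *)
Definition jac i j x : 'M[R]_m := jacobian (coord j \o param i) (coord i x).

Lemma differentiable_transition i j x : dom i x -> dom j x ->
  differentiable (coord j \o param i) (coord i x).
Proof.
move=> ix jx; have [+ _] := @transition_smooth _ _ _ S i j 1; apply.
by rewrite image_coordE; split; [exact: codomain_coord|rewrite coordK].
Qed.

Lemma tangent_changeE i j x v : tangent_change i j x v = v *m jac i j x.
Proof. by rewrite /tangent_change /jac /jacobian mul_rV_lin1. Qed.

Lemma near_codomain i x : dom i x -> nbhs (coord i x) (codomain i).
Proof. by move=> ix; apply: (open_near (@open_codomain _ _ _ S i)); exact: codomain_coord. Qed.

(** The two transition maps are inverse to each other near [coord i x], so the chain rule gives
    inverse differentials. *)
Lemma jacK i j x : dom i x -> dom j x -> jac i j x *m jac j i x = 1%:M.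
Proof.
move=> ix jx; apply/row_matrixP => a; rewrite !rowE mulmxA mulmx1.
rewrite -!tangent_changeE /tangent_change.
set e := delta_mx 0 a.
have dij := differentiable_transition ix jx.
have E : coord j x = (coord j \o param i) (coord i x) by rewrite /comp coordK.
have dji := differentiable_transition jx ix; rewrite E in dji *.
have -> : 'd (coord i \o param j) ((coord j \o param i) (coord i x))
      ('d (coord j \o param i) (coord i x) e) =
    'd ((coord i \o param j) \o (coord j \o param i)) (coord i x) e.
  exact: (esym (congr1 (fun h => h e) (diff_comp dij dji))).
rewrite -deriveE; last exact: differentiable_comp.
rewrite -[RHS](derive_id (coord i x)); apply: near_eq_derive.
have cj : {for coord i x, continuous (param i)}.
  by apply: param_continuous; exact: codomain_coord.
have nj : nbhs (coord i x) (fun y => dom j (param i y)).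
  by apply: cj; rewrite coordK//; exact: (open_near (@dom_open _ _ _ S j)).
apply: filterS2 nj (near_codomain ix) => y jy iy /=.
by rewrite coordK// paramK.
Qed.

Definition dch i f x : 'rV[R]_m :=
  \row_c 'D_(delta_mx 0 c) (f \o param i) (coord i x).

Definition diffM i f x := differentiable (f \o param i) (coord i x).

Lemma C1M_diff i U f x : CkM S 1 U f -> U x -> dom i x -> diffM i f x.
Proof.
move=> Cf Ux ix; apply (Cf i).1.
by rewrite image_coordE; split; [exact: codomain_coord|rewrite coordK].
Qed.

Lemma dch_change i j f x : dom i x -> dom j x -> diffM j f x ->
  dch i f x = dch j f x *m (jac i j x)^T.
Proof.
move=> ix jx df; apply/rowP => c; rewrite !mxE.
have dij := differentiable_transition ix jx.
have E : coord j x = (coord j \o param i) (coord i x) by rewrite /comp coordK.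
have df' := df; rewrite /diffM E in df'.
have -> : 'D_(delta_mx 0 c) (f \o param i) (coord i x) =
    'D_(delta_mx 0 c) ((f \o param j) \o (coord j \o param i)) (coord i x).
  apply: near_eq_derive.
  have cj : {for coord i x, continuous (param i)}.
    by apply: param_continuous; exact: codomain_coord.
  have nj : nbhs (coord i x) (fun y => dom j (param i y)).
    by apply: cj; rewrite coordK//; exact: (open_near (@dom_open _ _ _ S j)).
  by apply: filterS nj => y jy /=; rewrite coordK.
rewrite deriveE; last exact: differentiable_comp.
have -> : 'd ((f \o param j) \o (coord j \o param i)) (coord i x) (delta_mx 0 c) =
    'd (f \o param j) ((coord j \o param i) (coord i x)) (tangent_change i j x (delta_mx 0 c)).
  exact: (congr1 (fun h => h (delta_mx 0 c)) (diff_comp dij df')).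
rewrite -deriveE// -E derive_sum_coord//.
by apply: eq_bigr => b _; rewrite !mxE mulrC; congr (_ * _).
Qed.

Lemma tensor_inE i B x :
  tensor_in i B x = jac i (chart_at S x) x *m B x *m (jac i (chart_at S x) x)^T.
Proof.
apply/matrixP => a b; rewrite mxE !tangent_changeE bil_mul /bil.
by rewrite -rowE trmx_delta -colE !mxE.
Qed.

Variable g : M -> 'M[R]_m.
Hypothesis gpos : forall x, pos_def (g x).

Definition chart_grad i u x : 'rV[R]_m := dch i u x *m invmx (tensor_in i g x).

Lemma invmx_unique (A B : 'M[R]_m) : A *m B = 1%:M -> invmx A = B.
Proof.
move=> AB; have [uA _] := mulmx1_unit AB.
by rewrite -[LHS]mulmx1 -AB mulmxA mulVmx// mul1mx.
Qed.

(** Raising an index commutes with a change of chart: J is the Jacobian, G the metric and d a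
    differential. *)
Lemma invmx_congr_cancel (J J' G : 'M[R]_m) (d : 'rV[R]_m) :
  J *m J' = 1%:M -> J' *m J = 1%:M -> G \in unitmx ->
  d *m invmx G = d *m J^T *m invmx (J *m G *m J^T) *m J.
Proof.
move=> JJ' J'J Gu.
have JJT : J^T *m J'^T = 1%:M by rewrite -trmx_mul J'J trmx1.
have -> : invmx (J *m G *m J^T) = J'^T *m (invmx G *m J').
  apply: invmx_unique; rewrite -[J *m G *m J^T *m _]mulmxA (mulmxA J^T) JJT mul1mx.
  by rewrite -[J *m G *m _]mulmxA (mulmxA G) mulmxV// mul1mx.
by rewrite -!mulmxA J'J mulmx1 (mulmxA J^T) JJT mul1mx.
Qed.

(** Exchanges the preferred chart, which varies with x, for the fixed chart i, where continuity in x
    makes sense. *)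
Lemma gradient_chart i u x : dom i x -> diffM (chart_at S x) u x ->
  gradient S g u x = chart_grad i u x *m jac i (chart_at S x) x.
Proof.
move=> ix du; have jx := dom_chart_at S x; set j := chart_at S x in du jx *.
have -> : gradient S g u x = dch j u x *m invmx (g x) by [].
rewrite /chart_grad (dch_change ix jx du) tensor_inE -/j.
by apply: invmx_congr_cancel (jacK ix jx) (jacK jx ix) (pos_def_unit (gpos x)).
Qed.

Lemma vector_in_chart i (X : M -> 'rV[R]_m) x : dom i x ->
  X x = vector_in i X x *m jac i (chart_at S x) x.
Proof.
move=> ix; rewrite /vector_in tangent_changeE -mulmxA jacK ?mulmx1//.
exact: dom_chart_at.
Qed.

Lemma bil_chart i B x v w :
  bil (B x) (v *m jac i (chart_at S x) x) (w *m jac i (chart_at S x) x) =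
  bil (tensor_in i B x) v w.
Proof. by rewrite bil_mul tensor_inE. Qed.

Lemma pos_def_tensor_in i B x : dom i x -> pos_def (B x) -> pos_def (tensor_in i B x).
Proof.
move=> ix [BT Bp]; split; first by rewrite tensor_inE !trmx_mul trmxK BT mulmxA.
move=> v v0; rewrite -bil_chart; apply: Bp; apply: contra v0 => /eqP vJ.
by rewrite -[v]mulmx1 -(jacK ix (dom_chart_at S x)) mulmxA vJ mul0mx.
Qed.

Lemma chart_continuous i (f : M -> R) x U :
  Ck 0 (coord i @` (dom i `&` U)) (f \o param i) -> dom i x -> U x -> {for x, continuous f}.
Proof.
move=> cf ix Ux; apply: (continuous_param_comp ix); apply: cf.
by rewrite image_coordE; split; [exact: codomain_coord|rewrite coordK].
Qed.

Lemma tensor_in_continuous i B x : Ck_tensor_field S 0 B -> dom i x ->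
  mx_continuous_at (tensor_in i B) x.
Proof.
move=> cB ix a b; apply: (@chart_continuous i _ x setT) => //.
by rewrite setIT; exact: cB.
Qed.

Lemma vector_in_continuous i X x : Ck_vector_field S 0 X -> dom i x ->
  mx_continuous_at (vector_in i X) x.
Proof.
move=> cX ix a b; apply: (continuous_param_comp ix).
rewrite (ord1 a); have cXx := cX i _ (codomain_coord ix).
exact: (continuous_comp cXx (@matrix_normedtype.coord_continuous _ _ _ 0 b _)).
Qed.

Lemma dch_continuous i U f x : open U -> CkM S 1 U f -> dom i x -> U x ->
  mx_continuous_at (dch i f) x.
Proof.
move=> oU Cf ix Ux a b; rewrite (ord1 a).
apply: (@chart_continuous i _ x U) => //.
have cD : Ck 0 (coord i @` (dom i `&` U)) (fun y => 'D_(delta_mx 0 b) (f \o param i) y).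
  exact: (Cf i).2.
apply: (@Ck_eq _ _ _ 0 _ _ _ _ _ cD); first exact: open_image_coord.
by move=> y; rewrite image_coordE => -[iy _]; rewrite /= /dch mxE paramK.
Qed.

Hypothesis gC : Ck_tensor_field S 0 g.

Lemma inv_metric_continuous i x : dom i x ->
  mx_continuous_at (fun z => invmx (tensor_in i g z)) x.
Proof.
move=> ix; apply: mx_continuous_inv; last exact: tensor_in_continuous.
by apply: pos_def_unit; exact: pos_def_tensor_in.
Qed.

Lemma chart_grad_continuous i U u x : open U -> CkM S 1 U u -> dom i x -> U x ->
  mx_continuous_at (chart_grad i u) x.
Proof.
move=> oU Cu ix Ux; apply: mx_continuous_mul; last exact: inv_metric_continuous.
exact: (dch_continuous oU).
Qed.

Lemma gnorm_chart i u x : dom i x -> diffM (chart_at S x) u x ->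
  gnorm g x (gradient S g u x) =
  Num.sqrt (bil (tensor_in i g x) (chart_grad i u x) (chart_grad i u x)).
Proof. by move=> ix du; rewrite /gnorm (gradient_chart ix du) bil_chart. Qed.

Lemma gnorm_ge0 x v : 0 <= gnorm g x v.
Proof. exact: sqrtr_ge0. Qed.

Lemma gnorm_continuous U u x : open U -> CkM S 1 U u -> U x ->
  {for x, continuous (fun z => gnorm g z (gradient S g u z))}.
Proof.
move=> oU Cu Ux; pose i := chart_at S x; have ix : dom i x by exact: dom_chart_at.
pose F z := Num.sqrt (bil (tensor_in i g z) (chart_grad i u z) (chart_grad i u z)).
apply: (@near_eq_continuous _ _ F).
  apply: filterS2 (open_near (@dom_open _ _ _ S i) ix) (open_near oU Ux) => z iz Uz.
  by rewrite /F -gnorm_chart//; apply: C1M_diff Cu Uz _; exact: dom_chart_at.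
have cb : {for x, continuous (fun z => bil (tensor_in i g z) (chart_grad i u z) (chart_grad i u z))}.
  apply: continuous_at_bil; [exact: tensor_in_continuous| |];
    exact: (chart_grad_continuous oU).
exact: (continuous_comp cb (@sqrt_continuous _ _)).
Qed.

Variables (A : R -> R) (T : M -> 'M[R]_m) (X : M -> 'rV[R]_m).

(** The vector whose pairing with d psi is T(grad u, grad psi): the inverse metric that raises the
    index of d psi has been moved to this side. *)
Definition flux_dir i u x : 'rV[R]_m :=
  chart_grad i u x *m tensor_in i T x *m (invmx (tensor_in i g x))^T.

Definition flux i u x : 'rV[R]_m := A (gnorm g x (gradient S g u x)) *: flux_dir i u x.

Definition drift u x : R := bil (g x) (X x) (gradient S g u x).

Lemma weak_L_chart i u psi x : dom i x ->
  diffM (chart_at S x) u x -> diffM (chart_at S x) psi x ->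
  weak_L S g A T X u psi x =
  \sum_c flux i u x 0 c * dch i psi x 0 c + drift u x * psi x.
Proof.
move=> ix du dpsi; rewrite /weak_L -/(drift u x); congr (_ + _).
rewrite (gradient_chart ix du) (gradient_chart ix dpsi) bil_chart.
rewrite -(gradient_chart ix du) {2}/chart_grad /bil trmx_mul mulmxA.
rewrite -/(flux_dir i u x) mxE mulr_sumr; apply: eq_bigr => c _.
by rewrite /flux !mxE mulrA.
Qed.

Lemma drift_continuous U u x : Ck_vector_field S 0 X -> open U -> CkM S 1 U u -> U x ->
  {for x, continuous (drift u)}.
Proof.
move=> cX oU Cu Ux; pose i := chart_at S x; have ix : dom i x by exact: dom_chart_at.
apply: (@near_eq_continuous _ _
    (fun z => bil (tensor_in i g z) (vector_in i X z) (chart_grad i u z))).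
  apply: filterS2 (open_near (@dom_open _ _ _ S i) ix) (open_near oU Ux) => z iz Uz.
  rewrite -bil_chart -vector_in_chart// -gradient_chart//.
  by apply: C1M_diff Cu Uz _; exact: dom_chart_at.
apply: continuous_at_bil; first exact: tensor_in_continuous.
  exact: vector_in_continuous.
exact: (chart_grad_continuous oU).
Qed.

End ChartComponents.

(** * Sign and monotonicity of phi *)

Section PhiFacts.
Context {R : realType}.
Variable A : R -> R.
Hypotheses (A1 : assumption_A1 A) (A2 : assumption_A2 A).

Lemma derivable_phi t : 0 < t -> derivable (phi A) t 1.
Proof.
move=> t0; have [dA _] := A1 t0.
have -> : phi A = (fun t => t) * A by apply/funext.
by apply: derivableM => //; exact: derivable_id.
Qed.

Lemma phi_lt s t : 0 < s -> s < t -> phi A s < phi A t.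
Proof.
move=> s0 st.
have dphi r : r \in `]s, t[ -> is_derive r (1 : R) (phi A) (derive1 (phi A) r).
  rewrite in_itv /= => /andP[sr _]; rewrite derive1E; apply: derivableP.
  exact/derivable_phi/(lt_trans s0).
have cphi : {within `[s, t], continuous (phi A)}.
  apply: continuous_in_subspaceT => r; rewrite inE /= in_itv /= => /andP[sr _].
  apply: differentiable_continuous; apply/derivable1_diffP.
  exact/derivable_phi/(lt_le_trans s0).
have [r] := MVT st dphi cphi; rewrite in_itv /= => /andP[sr _] E.
by rewrite -subr_gt0 E mulr_gt0 ?subr_gt0// A2.1// (lt_trans s0).
Qed.

Lemma phi_small e : 0 < e -> exists2 d : R, 0 < d & forall t, 0 < t -> t < d -> `|phi A t| < e.
Proof.
move=> e0; have := A2.2 => /cvgr0Pnorm_lt/(_ _ e0).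
move=> [d /= d0 dP]; exists d => // t t0 td; apply: dP => //=.
by rewrite /ball_ sub0r normrN gtr0_norm.
Qed.

(** If phi were nonpositive at t, it would be negative at t / 2 and, being increasing, below that
    negative value at all smaller s, against its limit 0. *)
Lemma phi_gt0 t : 0 < t -> 0 < phi A t.
Proof.
move=> t0; rewrite ltNge; apply/negP => pt.
have t2 : 0 < t / 2 by rewrite divr_gt0.
have tt : t / 2 < t by rewrite ltr_pdivrMr// ltr_pMr// ltr1n.
have p2 : phi A (t / 2) < 0 by rewrite (lt_le_trans (phi_lt t2 tt)).
have np : 0 < - phi A (t / 2) by rewrite oppr_gt0.
have [d d0 dP] := phi_small np.
pose s := Num.min (d / 2) (t / 4).
have s0 : 0 < s by rewrite lt_min !divr_gt0.
have sd : s < d by rewrite gt_min ltr_pdivrMr// ltr_pMr// ltr1n.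
have st : s < t / 2 by rewrite gt_min; apply/orP; right; lra.
have := dP _ s0 sd; have := phi_lt s0 st.
have := ler_norm (- phi A s); rewrite normrN; lra.
Qed.

End PhiFacts.

Lemma continuous_at0 (R : realType) (T : topologicalType) (f : T -> R) x :
  f x = 0 -> (forall e, 0 < e -> \forall z \near x, `|f z| < e) ->
  {for x, continuous f}.
Proof. by move=> f0 fe; rewrite /prop_for /continuous_at f0; apply/cvgr0Pnorm_lt. Qed.

(** * First-order operators on test functions *)

Section FirstOrder.
Context {R : realType} {m : nat} {M : ptopologicalType} (S : manifold R m M).
Implicit Types (i j : chart S) (U V W : set M) (x : M) (f u psi : M -> R).
Variables (g : M -> 'M[R]_m) (A : R -> R) (T : M -> 'M[R]_m) (X : M -> 'rV[R]_m).
Hypotheses (gpos : forall x, pos_def (g x)) (gC : Ck_tensor_field S 0 g).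

Local Notation gn u := (fun z => gnorm g z (gradient S g u z)).

Lemma near_gnorm_chart i U u x : open U -> CkM S 1 U u -> dom i x -> U x ->
  \forall z \near x, [/\ dom i z, U z &
    gn u z ^+ 2 = bil (tensor_in i g z) (chart_grad g i u z) (chart_grad g i u z)].
Proof.
move=> oU Cu ix Ux.
apply: filterS2 (open_near (@dom_open _ _ _ S i) ix) (open_near oU Ux) => z iz Uz; split => //.
rewrite (gnorm_chart gpos iz (C1M_diff Cu Uz (dom_chart_at S z))).
by rewrite sqr_sqrtr// pos_def_ge0//; exact: pos_def_tensor_in.
Qed.

(** Coercivity of the metric, uniform near x, compares the sup norm of the chart components with the
    Riemannian norm. *)
Lemma near_grad_le i U u x : open U -> CkM S 1 U u -> dom i x -> U x ->
  exists2 L : R, 0 < L & \forall z \near x, `|chart_grad g i u z| <= L * gn u z.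
Proof.
move=> oU Cu ix Ux.
have [l l0 lP] := near_coercive (tensor_in_continuous gC ix) (pos_def_tensor_in ix (gpos x)).
have sl0 : 0 < Num.sqrt l by rewrite sqrtr_gt0.
exists (Num.sqrt l)^-1; first by rewrite invr_gt0.
apply: filterS2 lP (near_gnorm_chart oU Cu ix Ux) => z lz [iz Uz nE].
rewrite ler_pdivlMl//.
rewrite -(@ler_pXn2r _ 2)// ?nnegrE ?mulr_ge0 ?gnorm_ge0 ?(ltW sl0)//.
by rewrite nE exprMn sqr_sqrtr ?(ltW l0)// lz.
Qed.

Lemma near_flux_dir_le i U u x : Ck_tensor_field S 0 T -> open U -> CkM S 1 U u ->
  dom i x -> U x ->
  exists2 K : R, 0 < K & \forall z \near x, forall c, `|flux_dir g T i u z 0 c| <= K * gn u z.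
Proof.
move=> cT oU Cu ix Ux.
have [L L0 LP] := near_grad_le oU Cu ix Ux.
have cN : mx_continuous_at
    (fun z => tensor_in i T z *m (invmx (tensor_in i g z))^T) x.
  apply: mx_continuous_mul; first exact: tensor_in_continuous.
  by apply: mx_continuous_tr; exact: inv_metric_continuous.
have [K K0 KP] := near_entries_bounded cN.
exists ((m%:R * K + 1) * L); first by rewrite mulr_gt0// ltr_wpDl// mulr_ge0// ltW.
apply: filterS2 LP KP => z Lz Kz c; rewrite /flux_dir -mulmxA.
rewrite (le_trans (mulmx_row_le _ (fun a => Kz a c)))// -[leRHS]mulrA.
have mK0 : 0 <= m%:R * K by rewrite mulr_ge0// ltW.
have mK1 : m%:R * K <= m%:R * K + 1 by rewrite lerDl.
exact: ler_pM.
Qed.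

Hypotheses (A1 : assumption_A1 A) (A2 : assumption_A2 A) (TC : Ck_tensor_field S 0 T).

(** At a critical point A(|grad u|) may blow up nearby and its value at 0 is arbitrary. Since the
    direction is bounded by K |grad u|, the flux is bounded by K |phi(|grad u|)|, which tends to 0
    by (A2). *)
Lemma flux_continuous i U u x : open U -> CkM S 1 U u -> dom i x -> U x ->
  mx_continuous_at (flux g A T i u) x.
Proof.
move=> oU Cu ix Ux a c; rewrite (ord1 a) {a}.
have cn := gnorm_continuous gpos gC oU Cu Ux.
have cfd : {for x, continuous (fun z => flux_dir g T i u z 0 c)}.
  apply: mx_continuous_mul.
    apply: mx_continuous_mul; last exact: tensor_in_continuous.
    exact: (chart_grad_continuous gpos gC oU).
  by apply: mx_continuous_tr; exact: inv_metric_continuous.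
apply: (@eq_continuous_at _ _ (fun z => A (gn u z) * flux_dir g T i u z 0 c)).
  by move=> z; rewrite /flux [in RHS]mxE.
have := gnorm_ge0 g x (gradient S g u x); rewrite le_eqVlt => /orP[/eqP n0|n0].
  have [K K0 KP] := near_flux_dir_le TC oU Cu ix Ux.
  have fd0 : flux_dir g T i u x 0 c = 0.
    apply/normr0_eq0/eqP; rewrite eq_le normr_ge0 andbT.
    by rewrite (le_trans (nbhs_singleton KP c))// -n0 mulr0.
  apply: (@continuous_at0 _ _ (fun z => A (gn u z) * flux_dir g T i u z 0 c)).
    by rewrite fd0 mulr0.
  move=> e e0.
  have eK : 0 < e / K by rewrite divr_gt0.
  have [d d0 dP] := phi_small A2 eK.
  have nd : \forall z \near x, gn u z < d.
    have : gn u x < d by rewrite -n0.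
    by move=> /(open_near (@open_lt _ d)) /cn.
  apply: filterS2 nd KP => z zd Kz.
  rewrite normrM.
  have := gnorm_ge0 g z (gradient S g u z); rewrite le_eqVlt => /orP[/eqP z0|z0].
    have -> : `|flux_dir g T i u z 0 c| = 0.
      by apply/eqP; rewrite eq_le normr_ge0 andbT (le_trans (Kz c))// -z0 mulr0.
    by rewrite mulr0.
  have := dP _ z0 zd; rewrite /phi normrM gtr0_norm// ltr_pdivlMr// => He.
  apply: le_lt_trans He; rewrite mulrC mulrAC ler_wpM2r//.
  by rewrite mulrC Kz.
have [dA _] := A1 n0.
have cA : {for gn u x, continuous A}.
  by apply: differentiable_continuous; apply/derivable1_diffP.
exact: (continuousM (continuous_comp cn cA) cfd).
Qed.

(** The coefficients depend on the chart and are continuous; linearity in the first jet of psi gives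
    locality, additivity and stability under C^1 approximation. *)
Definition first_order V (P : (M -> R) -> M -> R) : Prop :=
  forall i, exists (a : M -> 'rV[R]_m) (b : M -> R), forall x, dom i x -> V x ->
    [/\ mx_continuous_at a x, {for x, continuous b} &
      forall psi, CkM S 1 setT psi ->
        P psi x = \sum_c a x 0 c * dch i psi x 0 c + b x * psi x].

Lemma first_order_weak_L V u : Ck_vector_field S 0 X -> open V -> CkM S 1 V u ->
  first_order V (weak_L S g A T X u).
Proof.
move=> XC oV Cu i; exists (flux g A T i u), (drift S g X u) => x ix Vx.
have du := C1M_diff Cu Vx (dom_chart_at S x).
split; first exact: (flux_continuous oV).
  exact: (drift_continuous gpos gC XC oV).
move=> psi Cpsi; rewrite (weak_L_chart gpos A T X ix du)//.
exact: (C1M_diff Cpsi I (dom_chart_at S x)).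
Qed.

Lemma first_orderB V P Q : first_order V P -> first_order V Q ->
  first_order V (fun psi x => P psi x - Q psi x).
Proof.
move=> FP FQ i; have [a [b H]] := FP i; have [a' [b' H']] := FQ i.
exists (fun x => a x - a' x), (fun x => b x - b' x) => x ix Vx.
have [ca cb PE] := H x ix Vx; have [ca' cb' QE] := H' x ix Vx.
split.
- move=> k l; apply: eq_continuous_at (continuousB (ca k l) (ca' k l)) => z.
  by rewrite !mxE.
- exact: continuousB.
- move=> psi Cpsi; rewrite PE// QE// opprD addrACA -sumrB mulrBl; congr (_ + _).
  by apply: eq_bigr => c _; rewrite !mxE mulrBl.
Qed.

Lemma first_orderD0 V P (h : M -> R) : first_order V P -> (forall x, V x -> {for x, continuous h}) ->
  first_order V (fun psi x => P psi x + h x * psi x).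
Proof.
move=> FP ch i; have [a [b H]] := FP i.
exists a, (fun x => b x + h x) => x ix Vx; have [ca cb PE] := H x ix Vx; split => //.
- exact: (continuousD cb (ch _ Vx)).
- by move=> psi Cpsi; rewrite PE// mulrDl addrA.
Qed.

Lemma first_orderN V P : first_order V P -> first_order V (fun psi x => - P psi x).
Proof.
move=> FP i; have [a [b H]] := FP i.
exists (fun x => - a x), (fun x => - b x) => x ix Vx; have [ca cb PE] := H x ix Vx; split.
- by move=> k l; apply: eq_continuous_at (continuousN (ca k l)) => z; rewrite !mxE.
- exact: continuousN.
- move=> psi Cpsi; rewrite PE// opprD mulNr -sumrN; congr (_ + _).
  by apply: eq_bigr => c _; rewrite !mxE mulNr.
Qed.

Lemma first_order_continuous V P psi x : first_order V P -> V x -> CkM S 1 setT psi ->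
  open V -> {for x, continuous (P psi)}.
Proof.
move=> FP Vx Cpsi oV; pose i := chart_at S x; have ix : dom i x by exact: dom_chart_at.
have [a [b H]] := FP i; have [ca cb _] := H x ix Vx.
apply: (@near_eq_continuous _ _ (fun z => \sum_c a z 0 c * dch i psi z 0 c + b z * psi z)).
  apply: filterS2 (open_near (@dom_open _ _ _ S i) ix) (open_near oV Vx) => z iz Vz.
  by have [_ _ ->] := H z iz Vz.
apply: continuousD.
  apply: continuous_at_sum => c; apply: continuousM; first exact: ca.
  exact: (dch_continuous openT Cpsi ix I).
apply: continuousM => //; exact: (CkM_continuous (U := setT) I Cpsi).
Qed.

Lemma dch_near0 i psi x : dom i x -> (\forall z \near x, psi z = 0) -> dch i psi x = 0.
Proof.
move=> ix p0; apply/rowP => c; rewrite !mxE.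
rewrite -(@derive_cst _ _ _ (0 : R) (coord i x) (delta_mx 0 c)); apply: near_eq_derive.
have cj : {for coord i x, continuous (param i)}.
  by apply: param_continuous; exact: codomain_coord.
have n0 : nbhs (param i (coord i x)) [set z | psi z = 0] by rewrite coordK.
exact: (cj _ n0).
Qed.

Lemma first_order_near0 V P psi x : first_order V P -> V x -> CkM S 1 setT psi ->
  (\forall z \near x, psi z = 0) -> P psi x = 0.
Proof.
move=> FP Vx Cpsi p0; pose i := chart_at S x; have ix : dom i x by exact: dom_chart_at.
have [a [b H]] := FP i; have [_ _ ->//] := H x ix Vx.
rewrite (dch_near0 ix p0) (nbhs_singleton p0) mulr0 addr0 big1// => c _.
by rewrite mxE mulr0.
Qed.

Lemma dch_sum i (L : Type) (r : seq L) (F : L -> M -> R) x : dom i x ->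
  (forall l, CkM S 1 setT (F l)) ->
  dch i (fun z => \sum_(l <- r) F l z) x = \sum_(l <- r) dch i (F l) x.
Proof.
move=> ix CF; elim: r => [|l r IH].
  rewrite big_nil; apply: dch_near0 => //; apply: nearW => z; exact: big_nil.
rewrite big_cons -IH; apply/rowP => c; rewrite !mxE.
have -> : (fun z => \sum_(l <- l :: r) F l z) \o param i =
    (F l \o param i) + ((fun z => \sum_(l <- r) F l z) \o param i).
  by apply/funext => y; rewrite /= big_cons.
have d1 : diffM i (F l) x by exact: (C1M_diff (CF l) I ix).
have d2 : diffM i (fun z => \sum_(l <- r) F l z) x.
  exact: (C1M_diff (CkM_sum r openT CF) I ix).
by rewrite deriveD//; apply: diff_derivable.
Qed.

Lemma first_order_sum V P (L : Type) (r : seq L) (F : L -> M -> R) x :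
  first_order V P -> V x -> (forall l, CkM S 1 setT (F l)) ->
  P (fun z => \sum_(l <- r) F l z) x = \sum_(l <- r) P (F l) x.
Proof.
move=> FP Vx CF; pose i := chart_at S x; have ix : dom i x by exact: dom_chart_at.
have [a [b H]] := FP i; have [_ _ PE] := H x ix Vx.
rewrite PE; last exact: (CkM_sum r openT CF).
under [RHS]eq_bigr do rewrite PE//.
rewrite big_split /= mulr_sumr; congr (_ + _).
rewrite exchange_big /=; apply: eq_bigr => c _.
by rewrite dch_sum// summxE mulr_sumr.
Qed.

End FirstOrder.

(** * The Riemannian volume *)

Section IteratedIntegral.
Context {R : realType}.
Local Open Scope ereal_scope.

(* Unlike ge0_le_integral, this requires no measurability. *)
Lemma integral_mono d (Z : measurableType d) (mu : {measure set Z -> \bar R}) (D : set Z)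
    (f h : Z -> \bar R) :
  (forall t, D t -> 0 <= f t) -> (forall t, D t -> f t <= h t) ->
  \int[mu]_(t in D) f t <= \int[mu]_(t in D) h t.
Proof.
move=> f0 fh; rewrite [leLHS]integral_mkcond [leRHS]integral_mkcond.
have fhD t : (f \_ D) t <= (h \_ D) t.
  by rewrite !patchE; case: ifPn => //; rewrite inE => /fh.
have fD0 t : 0 <= (f \_ D) t by rewrite patchE; case: ifPn => //; rewrite inE => /f0.
have hD0 t : 0 <= (h \_ D) t by exact: le_trans (fhD t).
rewrite !ge0_integralTE//; apply: ereal_sup_le => _ [k kf <-]; exists k => // t.
exact: le_trans (fhD t).
Qed.

Lemma rV_integral_ge0 m (f : 'rV[R]_m -> \bar R) : (forall y, 0 <= f y) -> 0 <= rV_integral f.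
Proof.
by elim: m f => [|m IH] f f0 /=; [exact: f0|apply: integral_ge0 => t _; exact: IH].
Qed.

Lemma integral_cst_itv (C a r : R) : (0 < r)%R ->
  \int[lebesgue_measure]_(t in [set: R])
    ((cst C%:E) \_ [set` `](a - r)%R, (a + r)%R[]) t = (C * (2 * r))%:E.
Proof.
move=> r0; rewrite -integral_mkcond integral_cst//.
have := lebesgue_measure_itv `](a - r)%R, (a + r)%R[.
rewrite /= lte_fin ltrD2l gtrN// => E; rewrite [X in _ * X]E.
by rewrite -EFinB -EFinM; congr EFin; ring.
Qed.

Lemma row_mx_entry0 m (t : R) (y : 'rV[R]_m) :
  (row_mx (t%:M : 'rV[R]_1) y : 'rV[R]_m.+1) 0%R ord0 = t.
Proof.
transitivity ((row_mx (t%:M : 'rV[R]_1) y) 0%R (lshift m (ord0 : 'I_1))).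
  by congr (fun_of_matrix _ _ _); exact: val_inj.
by rewrite row_mxEl mxE eqxx.
Qed.

Lemma row_mx_entryS m (t : R) (y : 'rV[R]_m) (b : 'I_m) :
  (row_mx (t%:M : 'rV[R]_1) y : 'rV[R]_m.+1) 0%R (lift ord0 b) = y 0%R b.
Proof.
transitivity ((row_mx (t%:M : 'rV[R]_1) y) 0%R (rshift 1 b)).
  by congr (fun_of_matrix _ _ _); exact: val_inj.
by rewrite row_mxEr.
Qed.

(** Induction on the dimension, slice by slice. The inner integral is compared with a step function
    of the first coordinate, which avoids any discussion of its measurability. *)
Lemma rV_integral_ge_box m (f : 'rV[R]_m -> \bar R) (c r : R) (y0 : 'rV[R]_m) :
  (0 <= c)%R -> (0 < r)%R -> (forall y, 0 <= f y) ->
  (forall y : 'rV[R]_m, (forall b, `|y 0%R b - y0 0%R b| < r)%R -> c%:E <= f y) ->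
  (c * (2 * r) ^+ m)%:E <= rV_integral f.
Proof.
elim: m f c y0 => [|m IH] f c y0 c0 r0 f0 fc.
  by rewrite expr0 mulr1 /=; apply: fc => -[].
pose a : R := y0 0%R ord0; pose D : set R := [set` `](a - r)%R, (a + r)%R[].
pose C := (c * (2 * r) ^+ m)%R.
have -> : (c * (2 * r) ^+ m.+1)%:E = \int[lebesgue_measure]_(t in [set: R]) ((cst C%:E) \_ D) t.
  by rewrite integral_cst_itv//; congr EFin; rewrite /C exprS; ring.
apply: integral_mono => t _.
  rewrite patchE; case: ifP => // _ /=; rewrite lee_fin /C mulr_ge0// exprn_ge0// mulr_ge0//.
  exact: ltW.
rewrite patchE; case: ifP => [|_]; last by apply: rV_integral_ge0 => y; exact: f0.
rewrite inE /D /= in_itv /= => /andP[ta at_].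
apply: (IH _ c (\row_b y0 0%R (lift ord0 b))) => // y yb; apply: fc => b.
case: (unliftP ord0 b) => [b' ->|->]; last first.
  by rewrite row_mx_entry0 ltr_distl ta.
by rewrite row_mx_entryS; have := yb b'; rewrite mxE.
Qed.

Lemma rV_integral_le_box m (f : 'rV[R]_m -> \bar R) (c r : R) (y0 : 'rV[R]_m) :
  (0 <= c)%R -> (0 < r)%R -> (forall y, 0 <= f y) -> (forall y, f y <= c%:E) ->
  (forall (y : 'rV[R]_m) b, (r <= `|y 0%R b - y0 0%R b|)%R -> f y = 0) ->
  rV_integral f <= (c * (2 * r) ^+ m)%:E.
Proof.
elim: m f c y0 => [|m IH] f c y0 c0 r0 f0 fc fout.
  by rewrite expr0 mulr1 /=; exact: fc.
pose a : R := y0 0%R ord0; pose D : set R := [set` `](a - r)%R, (a + r)%R[].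
pose C := (c * (2 * r) ^+ m)%R.
have -> : (c * (2 * r) ^+ m.+1)%:E = \int[lebesgue_measure]_(t in [set: R]) ((cst C%:E) \_ D) t.
  by rewrite integral_cst_itv//; congr EFin; rewrite /C exprS; ring.
apply: integral_mono => t _.
  by apply: rV_integral_ge0 => y; exact: f0.
rewrite patchE; case: ifPn => [_|].
  apply: (IH _ c (\row_b y0 0%R (lift ord0 b))) => // y b; rewrite mxE => yb.
  by apply: (fout _ (lift ord0 b)); rewrite row_mx_entryS.
rewrite notin_setE /D /= in_itv /= => /negP ta.
have H : (r <= `|t - a|)%R by rewrite leNgt ltr_distl.
have -> : (fun y : 'rV[R]_m => f (row_mx (t%:M : 'rV[R]_1) y)) = cst 0.
  by apply/funext => y; apply: (fout _ ord0); rewrite row_mx_entry0.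
(* The slice vanishes identically; the induction hypothesis with c = 0 says that its integral is at
   most 0. *)
have := IH (cst 0) 0%R 0%R (lexx _) r0 (fun=> lexx _) (fun=> lexx _) (fun _ _ _ => erefl).
by rewrite mul0r.
Qed.

End IteratedIntegral.

(* The segment from the identity to [B] consists of positive definite, hence
   invertible, matrices, so that the determinant keeps its sign along it. *)
Lemma pos_def_det_gt0 {R : realType} {m : nat} (B : 'M[R]_m) : pos_def B -> 0 < \det B.
Proof.
move=> pB; pose N (t : R) := (1 - t) *: 1%:M + t *: B.
have pN t : 0 <= t -> t <= 1 -> pos_def (N t).
  move=> t0 t1; have [BT Bp] := pB; split.
    by rewrite /N !linearD !linearZ /= BT tr_scalar_mx.
  move=> v v0; have -> : bil (N t) v v = (1 - t) * bil 1%:M v v + t * bil B v v.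
    by rewrite /bil /N mulmxDr mulmxDl -!scalemxAr -!scalemxAl !mxE.
  have p1 : 0 < bil 1%:M v v.
    rewrite /bil mulmx1 mxE lt_neqAle sumr_ge0 ?andbT; last first.
      by move=> b _; rewrite mxE -expr2 sqr_ge0.
    rewrite eq_sym; apply: contra v0 => /eqP s0; apply/eqP/rowP => b.
    have /eqP := s0; rewrite psumr_eq0 => [/allP/(_ b)|c _]; last first.
      by rewrite mxE -expr2 sqr_ge0.
    by rewrite mem_index_enum => /(_ isT); rewrite !mxE -expr2 sqrf_eq0 => /eqP.
  have := Bp v v0; have [->|t10] := eqVneq t 1; first by rewrite subrr mul0r add0r mul1r.
  move=> pv; rewrite ltr_pwDl ?mulr_ge0 ?(ltW pv)// mulr_gt0// subr_gt0.
  by rewrite lt_neqAle t10.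
have cN : {within `[0, 1], continuous (fun t => \det (N t))}.
  apply: continuous_subspaceT => t; apply: continuous_at_det => a b.
  apply: (@eq_continuous_at _ _ (fun t : R => (1 - t) * (1%:M : 'M[R]_m) a b + t * B a b)) => [s|].
    by rewrite !mxE.
  apply: continuousD; apply: continuousM; try exact: cst_continuous; try exact: cvg_id.
  by apply: continuousB; [exact: cst_continuous|exact: cvg_id].
have N0 : N 0 = 1%:M by rewrite /N subr0 scale1r scale0r addr0.
have N1 : N 1 = B by rewrite /N subrr scale1r scale0r add0r.
rewrite ltNge; apply/negP => dB.
have [|t] := IVT (v := 0) ler01 cN.
  by rewrite N0 N1 det1 ge_min dB orbT le_max ler01.
rewrite in_itv /= => /andP[t0 t1] dt.
by have := pos_def_unit (pN t t0 t1); rewrite unitmxE dt unitr0.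
Qed.

Lemma patch_ge0 {R : realType} (T : Type) (h : T -> R) (D : set T) y :
  (forall z, 0 <= h z) -> (0 <= ((fun z => (h z)%:E) \_ D) y)%E.
Proof. by move=> h0; rewrite patchE; case: ifP => _; rewrite ?lee_fin. Qed.

Lemma patch_ge {R : realType} (T : Type) (h : T -> R) (D : set T) y (c : R) :
  D y -> c <= h y -> (c%:E <= ((fun z => (h z)%:E) \_ D) y)%E.
Proof. by move=> Dy hc; rewrite patchE mem_set. Qed.

Lemma patch_out {R : realType} (T : Type) (h : T -> R) (D : set T) y :
  ~ D y -> ((fun z => (h z)%:E) \_ D) y = 0%E.
Proof. by move=> nDy; rewrite patchE memNset. Qed.

Lemma patch_le {R : realType} (T : Type) (h : T -> R) (D : set T) y (c : R) :
  0 <= c -> (D y -> h y <= c) -> (((fun z => (h z)%:E) \_ D) y <= c%:E)%E.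
Proof.
by move=> c0 hc; rewrite patchE; case: ifPn => [|_]; rewrite ?inE lee_fin.
Qed.

Section Volume.
Context {R : realType} {m : nat} {M : ptopologicalType} (S : manifold R m M).
Implicit Types (i j : chart S) (U V W C : set M) (x : M) (f u psi : M -> R).
Variables (g : M -> 'M[R]_m) (vol : {measure set (@borel M) -> \bar R}).
Hypotheses (gpos : forall x, pos_def (g x)) (gC : Ck_tensor_field S 0 g).
Hypothesis volg : riemannian_volume S g vol.

Lemma measurable_open U : open U -> measurable (U : set (@borel M)).
Proof. by move=> oU; exact: sub_sigma_algebra. Qed.

Lemma measurable_closed U : closed U -> measurable (U : set (@borel M)).
Proof.
move=> cU; rewrite -[U]setCK; apply: measurableC; apply: measurable_open.
exact: closed_openC.
Qed.

Lemma measurable_compact C : compact C -> measurable (C : set (@borel M)).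
Proof. by move=> cC; apply: measurable_closed; exact: (closed_compact S). Qed.

Definition chart_ball i (y0 : 'rV[R]_m) (r : R) : set M :=
  [set x | dom i x /\ `|coord i x - y0| < r].

Lemma open_chart_ball i y0 r : open (chart_ball i y0 r).
Proof.
rewrite openE => x [ix xr].
have cd : {for x, continuous (fun z => `|coord i z - y0|)}.
  exact: (continuous_comp (coord_continuous ix) (@continuous_row_dist _ _ y0 _)).
exact: (filterI (open_near (@dom_open _ _ _ S i) ix) (cd _ (open_near (@open_lt _ r) xr))).
Qed.

Definition density i x : R := Num.sqrt (\det (tensor_in i g x)).

Lemma density_gt0 i x : dom i x -> 0 < density i x.
Proof. by move=> ix; rewrite sqrtr_gt0 pos_def_det_gt0//; exact: pos_def_tensor_in. Qed.

Lemma density_continuous i x : dom i x -> {for x, continuous (density i)}.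
Proof.
move=> ix; have cd := continuous_at_det (tensor_in_continuous gC ix).
exact: (continuous_comp cd (@sqrt_continuous _ _)).
Qed.

(** Near x0 the density stays between half and twice its positive value at x0, and a sup-norm ball
    of radius r is a cube of side 2 r. *)
Lemma chart_ball_volume i x0 : dom i x0 ->
  exists r0 c C : R, [/\ 0 < r0, 0 < c &
    forall r, 0 < r -> r <= r0 ->
      ((c * r ^+ m)%:E <= vol (chart_ball i (coord i x0) r) <= (C * r ^+ m)%:E)%E].
Proof.
move=> ix; set y0 := coord i x0; pose d := density i x0.
have d0 : 0 < d by exact: density_gt0.
have d2 : 0 < d / 2 by rewrite divr_gt0.
pose V := [set x | d / 2 < density i x < d + d] `&` dom i.
have nV : nbhs x0 V.
  have H : \forall z \near x0, `|density i x0 - density i z| < d / 2.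
    by have /cvgrPdist_lt/(_ _ d2) := density_continuous ix.
  apply: filterI (open_near (@dom_open _ _ _ S i) ix).
  apply: filterS H => z; rewrite -/d /= ltr_distlC => /andP[h1 h2].
  by apply/andP; split; lra.
have [r0 r00 bV] : exists2 r, 0 < r & box_in i (interior V) y0 r.
  by apply: box_in_exists => //; exact: open_interior.
exists r0, (d / 2 * 2 ^+ m), ((d + d) * 2 ^+ m); split => //.
  by rewrite mulr_gt0// exprn_gt0.
move=> r rp rr0.
have sB : chart_ball i y0 r `<=` dom i by move=> x [].
have volE : vol (chart_ball i y0 r) = rV_integral
    ((fun y => (density i (param i y))%:E) \_ (coord i @` chart_ball i y0 r)).
  exact: (volg (measurable_open (@open_chart_ball i y0 r)) sB).
rewrite volE.
have inV y : (coord i @` chart_ball i y0 r) y ->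
    d / 2 < density i (param i y) < d + d.
  move=> [x [ixx xr] <-]; rewrite coordK//.
  have xr0 : `|coord i x - y0| <= r0 by rewrite (le_trans (ltW xr)).
  by have [_] := bV _ xr0; rewrite coordK// => /interior_subset[].
have E (k : R) : k * 2 ^+ m * r ^+ m = k * (2 * r) ^+ m by rewrite exprMn mulrA.
rewrite !E; apply/andP; split.
- apply: (rV_integral_ge_box (y0 := y0)); [exact: ltW|by []| |] => y.
    by apply: patch_ge0 => z; exact: sqrtr_ge0.
  move=> yr; have yr' : `|y - y0| < r.
    by apply: row_norm_lt => // b; rewrite !mxE.
  have By : (coord i @` chart_ball i y0 r) y.
    have [iy _] := bV y (le_trans (ltW yr') rr0).
    exists (param i y); last exact: paramK.
    by split; [exact: dom_param|rewrite paramK].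
  have /andP[h _] := inV _ By.
  exact: (patch_ge By (ltW h)).
- apply: (rV_integral_le_box (y0 := y0)) => //.
  + by rewrite addr_ge0// ltW.
  + by move=> y; apply: patch_ge0 => z; exact: sqrtr_ge0.
  + move=> y; apply: patch_le => [|/inV /andP[_ h]]; first by rewrite addr_ge0// ltW.
    exact: ltW.
  + move=> y b yb; apply: patch_out => -[x [_ xr] xy].
    move: xr; rewrite xy ltNge (le_trans yb)//.
    by have := row_norm_ge (y - y0) b; rewrite !mxE.
Qed.

(** A compact set is covered by finitely many chart balls of finite volume. *)
Lemma compact_volume C : compact C -> (vol C < +oo)%E.
Proof.
move=> cC.
pose P x (B : set M) := [/\ open B, B x & (vol B < +oo)%E].
have exB x : exists B, P x B.
  have [r0 [c [c' [r00 c0 H]]]] := chart_ball_volume (dom_chart_at S x).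
  exists (chart_ball (chart_at S x) (coord (chart_at S x) x) r0); split.
  - exact: open_chart_ball.
  - by split; [exact: dom_chart_at|rewrite subrr normr0].
  - have /andP[_ h] := H r0 r00 (lexx _).
    by rewrite (le_lt_trans h)// ltry.
have [B BP] := choice exB.
have := cC; rewrite compact_cover => /(_ _ C B) [|x Cx|D DC CD].
- by move=> x _; have [] := BP x.
- by exists x => //; have [] := BP x.
have fin s : measurable (\big[setU/set0]_(x <- s) B x : set (@borel M)) /\
    (vol (\big[setU/set0]_(x <- s) B x) < +oo)%E.
  elim: s => [|x s [ms fs]]; first by rewrite big_nil measure0.
  have [oB _ fB] := BP x; have mB := measurable_open oB.
  rewrite big_cons; split; first exact: measurableU.
  by rewrite (le_lt_trans (measureU2 _ mB ms))// lte_add_pinfty.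
have [mD fD] := fin (finmap.enum_fset D).
rewrite (le_lt_trans _ fD)// le_measure ?inE//; first exact: (measurable_compact cC).
by move=> x /CD; rewrite /cover bigcup_fset.
Qed.

Lemma measurable_fun_continuous_on V (D : set M) f : open V -> D `<=` V ->
  measurable (D : set (@borel M)) -> (forall x, V x -> {for x, continuous f}) ->
  measurable_fun (D : set (@borel M)) f.
Proof.
move=> oV DV mD cf; apply: (measurability _ (measurable_realfun.RGenOpens.measurableE R)).
move=> _ [_ [a [b ->] <-]].
have -> : D `&` f @^-1` `]a, b[ = D `&` (V `&` f @^-1` `]a, b[).
  by apply/seteqP; split=> x [Dx]; [move=> fx; split=> //; split=> //; exact: DV|move=> [_ fx]].
apply: measurableI => //; apply: measurable_open.
rewrite openE => x [Vx fx].
exact: (filterI (open_near oV Vx) (cf _ Vx _ (open_near (@interval_open _ _ _ _ _) fx))).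
Qed.

Lemma integrable_compact V C f : open V -> C `<=` V -> compact C ->
  (forall x, V x -> {for x, continuous f}) ->
  vol.-integrable C (EFin \o f).
Proof.
move=> oV CV cC cf; apply: measurable_bounded_integrable.
- exact: measurable_compact.
- exact: compact_volume.
- by apply: (measurable_fun_continuous_on oV) => //; exact: measurable_compact.
- have cfC : {within C, continuous f}.
    by apply: continuous_in_subspaceT => x; rewrite inE => /CV; exact: cf.
  have /compact_bounded[N [Nr NP]] := continuous_compact cfC cC.
  by exists N; split => // r Nr' x Cx; apply: NP => //; exists x.
Qed.

Lemma integral_eq_support (V C : set M) (F : M -> \bar R) :
  C `<=` V -> (forall x, V x -> ~ C x -> F x = 0%E) ->
  (\int[vol]_(x in V) F x = \int[vol]_(x in C) F x)%E.
Proof.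
move=> CV F0; rewrite [LHS]integral_mkcond [RHS]integral_mkcond; congr (integral vol setT _).
apply/funext => x; rewrite !patchE; case: ifPn; rewrite ?inE ?notin_setE => Vx.
  by case: ifPn => //; rewrite notin_setE => /(F0 _ Vx).
by case: ifPn => //; rewrite inE => /CV.
Qed.

End Volume.

(** * Extending weak inequalities to C^1 test functions *)

Section Extension.
Context {R : realType} {m : nat} {M : ptopologicalType} (S : manifold R m M).
Implicit Types (i j : chart S) (U V W C : set M) (x : M) (f u psi xi : M -> R).
Variables (g : M -> 'M[R]_m) (vol : {measure set (@borel M) -> \bar R}).
Hypotheses (gpos : forall x, pos_def (g x)) (gC : Ck_tensor_field S 0 g).
Hypothesis volg : riemannian_volume S g vol.

Definition weakly_nonneg V (P : (M -> R) -> M -> R) : Prop :=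
  forall psi, test_function S V psi -> (forall x, 0 <= psi x) ->
    (0 <= \int[vol]_(x in V) (P psi x)%:E)%E.

Lemma near_notin C xi x : closed C -> (forall x, ~ C x -> xi x = 0) -> ~ C x ->
  \forall z \near x, xi z = 0.
Proof.
by move=> cC xi0 nCx; apply: filterS (open_near (closed_openC cC) nCx) => z /xi0.
Qed.

Lemma first_order_support V C P xi : first_order S V P -> closed C -> C `<=` V ->
  CkM S 1 setT xi -> (forall x, ~ C x -> xi x = 0) ->
  (\int[vol]_(x in V) (P xi x)%:E = \int[vol]_(x in C) (P xi x)%:E)%E.
Proof.
move=> FP cC CV Cxi xi0; apply: integral_eq_support => // x Vx nCx; congr EFin.
by apply: (first_order_near0 FP Vx Cxi); exact: near_notin nCx.
Qed.

Lemma dch_pullback i xi x : dom i x ->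
  dch i xi x = \row_c 'D_(delta_mx 0 c) (chart_pullback i xi) (coord i x).
Proof.
move=> ix; apply/rowP => c; rewrite !mxE; apply: near_eq_derive.
by apply: filterS (near_codomain ix) => y iy; rewrite chart_pullbackE.
Qed.

Lemma dch_lift i (h : 'rV[R]_m -> R) x : dom i x ->
  dch i (chart_lift i h) x = \row_c 'D_(delta_mx 0 c) h (coord i x).
Proof.
move=> ix; apply/rowP => c; rewrite !mxE; apply: near_eq_derive.
apply: filterS (near_codomain ix) => y iy /=.
by rewrite chart_liftE ?paramK//; exact: dom_param.
Qed.

Lemma derive_sqr (h : 'rV[R]_m -> R) y v : differentiable h y ->
  'D_v (fun y => h y ^+ 2) y = 2 * h y * 'D_v h y.
Proof.
move=> dh; have -> : (fun y => h y ^+ 2) = h * h by apply/funext => z; rewrite expr2.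
rewrite deriveM; last 2 first.
- exact: diff_derivable.
- exact: diff_derivable.
by rewrite /GRing.scale /=; ring.
Qed.

Lemma dch_sqr i xi x : diffM i xi x ->
  dch i (fun z => xi z ^+ 2) x = (2 * xi (param i (coord i x))) *: dch i xi x.
Proof. by move=> dxi; apply/rowP => c; rewrite !mxE -(derive_sqr _ dxi). Qed.

Lemma le0_of_small (a h : R) : (forall e, 0 < e -> e <= 1 -> 0 <= a + e * h) -> 0 <= a.
Proof.
move=> H; case: (leP h 0) => h0.
  by have := H 1 ltr01 (lexx _); rewrite mul1r => /le_trans; apply; rewrite gerDl.
rewrite leNgt; apply/negP => a0.
pose e := Num.min 1 (- a / (2 * h)).
have e0 : 0 < e by rewrite lt_min ltr01 divr_gt0 ?oppr_gt0 ?mulr_gt0.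
have e1 : e <= 1 by rewrite ge_min lexx.
have e2 : e * (2 * h) <= - a.
  by rewrite -ler_pdivlMr ?mulr_gt0// ge_min lexx orbT.
by have := H e e0 e1; move: e2; rewrite mulrCA; lra.
Qed.

(** The error is e times a quantity depending only on the limits t and D', not on the approximations
    s and D. Its integral is thus a fixed number, and e can tend to 0 afterwards. *)
Lemma sqr_perturbation (n : nat) (a D D' : 'rV[R]_n) (b s t e : R) :
  0 < e -> e <= 1 -> `|s - t| <= e -> (forall c, `|D 0 c - D' 0 c| <= e) ->
  \sum_c a 0 c * (2 * s * D 0 c) + b * s ^+ 2 <=
  \sum_c a 0 c * (2 * t * D' 0 c) + b * t ^+ 2 +
  e * (\sum_c `|a 0 c| * (2 * (`|t| + `|D' 0 c| + 1)) + `|b| * (2 * `|t| + 1)).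
Proof.
move=> e0 e1 st DD.
have -> : \sum_c a 0 c * (2 * t * D' 0 c) + b * t ^+ 2 +
  e * (\sum_c `|a 0 c| * (2 * (`|t| + `|D' 0 c| + 1)) + `|b| * (2 * `|t| + 1)) =
  \sum_c (a 0 c * (2 * t * D' 0 c) + e * (`|a 0 c| * (2 * (`|t| + `|D' 0 c| + 1)))) +
  (b * t ^+ 2 + e * (`|b| * (2 * `|t| + 1))).
  by rewrite big_split /= -mulr_sumr; ring.
apply: lerD.
  apply: ler_sum => c _; rewrite -lerBlDl -mulrBr (le_trans (ler_norm _))// normrM mulrCA.
  rewrite ler_wpM2l//.
  have -> : 2 * s * D 0 c - 2 * t * D' 0 c =
      2 * (t * (D 0 c - D' 0 c) + (s - t) * D' 0 c + (s - t) * (D 0 c - D' 0 c)) by ring.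
  rewrite normrM ger0_norm// mulrCA ler_wpM2l//.
  have -> : e * (`|t| + `|D' 0 c| + 1) = `|t| * e + e * `|D' 0 c| + e * 1 by ring.
  rewrite (le_trans (ler_normD _ _))// lerD//.
    by rewrite (le_trans (ler_normD _ _))// lerD// normrM ?ler_wpM2l// ler_wpM2r.
  by rewrite normrM ler_pM// (le_trans (DD _)).
rewrite -lerBlDl -mulrBr (le_trans (ler_norm _))// normrM mulrCA ler_wpM2l//.
have -> : s ^+ 2 - t ^+ 2 = (s - t) * (2 * t + (s - t)) by ring.
rewrite normrM ler_pM// (le_trans (ler_normD _ _))// lerD//; last exact: le_trans e1.
by rewrite normrM ger0_norm.
Qed.

Lemma continuous_at_norm f x :
  {for x, continuous f} -> {for x, continuous (fun z => `|f z|)}.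
Proof. by move=> cf; exact: (continuous_comp cf (@norm_continuous _ _ (f x))). Qed.

(* [xi] is only C^1; its smooth approximations have nonnegative squares, which are
   admissible test functions. *)
Lemma weakly_nonneg_sqr_box V P i y0 r r' xi : open V -> first_order S V P -> weakly_nonneg V P ->
  box_in i V y0 r' -> 0 < r -> r < r' -> CkM S 1 setT xi ->
  (forall x, ~ chart_box i y0 r x -> xi x = 0) ->
  (0 <= \int[vol]_(x in V) (P (fun z => (xi z ^+ 2)%R) x)%:E)%E.
Proof.
move=> oV FP Pw bV' r0 rr' Cxi xi0.
have bV := box_in_le (ltW rr') bV'.
set C := chart_box i y0 r'.
have cC : compact C by exact: compact_chart_box bV'.
have clC : closed C by exact: (closed_compact S cC).
have CV : C `<=` V by exact: chart_box_sub bV'.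
have xiC x : ~ C x -> xi x = 0.
  move=> nCx; apply: xi0; apply: contra_not nCx => /(chart_boxP x bV)[ix xr].
  by apply/(chart_boxP x bV'); split => //; rewrite (le_trans xr)// ltW.
have Cxi2 : CkM S 1 setT (fun z => xi z ^+ 2) by exact: CkMX openT Cxi.
have xi2C x : ~ C x -> xi x ^+ 2 = 0 by move=> /xiC->; rewrite expr0n.
rewrite (first_order_support FP clC CV Cxi2 xi2C).
pose h := chart_pullback i xi.
have Ch : Ck 1 setT h by exact: Ck_pullback bV xi0 Cxi.
have dh y : differentiable h y by apply Ch.1.
have h0 y : r < `|y - y0| -> h y = 0 by exact: chart_pullback_out bV xi0.
have [a [b H]] := FP i.
pose V' := V `&` dom i.
have oV' : open V' by apply: openI => //; exact: dom_open.
have CV' : C `<=` V' by move=> x Cx; split; [exact: CV|have [] := (chart_boxP x bV').1 Cx].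
(* The coefficient of e in [sqr_perturbation]; its continuity makes it integrable on the box. *)
pose Hf x := \sum_c `|a x 0 c| * (2 * (`|xi x| + `|dch i xi x 0 c| + 1)) +
  `|b x| * (2 * `|xi x| + 1).
have cxi x : {for x, continuous xi} by exact: (CkM_continuous (U := setT) I Cxi).
have cHf x : V' x -> {for x, continuous Hf}.
  move=> [Vx ix]; have [ca cb _] := H x ix Vx.
  have cst1 (k : R) : {for x, continuous (fun=> k : R)} by exact: cst_continuous.
  apply: continuousD.
    apply: continuous_at_sum => c; apply: continuousM; first exact/continuous_at_norm/ca.
    apply: continuousM => //; apply: continuousD => //; apply: continuousD.
      exact: continuous_at_norm.
    exact/continuous_at_norm/(dch_continuous openT Cxi ix I).
  apply: continuousM; first exact: continuous_at_norm.
  by apply: continuousD => //; apply: continuousM => //; exact: continuous_at_norm.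
have integr f : (forall x, V' x -> {for x, continuous f}) -> vol.-integrable C (EFin \o f).
  exact: (integrable_compact gpos gC volg oV' CV' cC).
have cP psi : CkM S 1 setT psi -> forall x, V' x -> {for x, continuous (P psi)}.
  by move=> Cpsi x [Vx _]; exact: (first_order_continuous FP Vx Cpsi oV).
have mC : measurable (C : set (@borel M)) by exact: (measurable_compact S cC).
have iP := integr _ (cP _ Cxi2); have iH := integr _ cHf.
have fP := integrable_fin_num mC iP; have fH := integrable_fin_num mC iH.
rewrite -(fineK fP) lee_fin.
apply: (@le0_of_small _ (fine (\int[vol]_(x in C) (EFin \o Hf) x))) => e e0 e1.
have [k [Cok kout kh]] := smooth_approx r0 rr' e0 Ch h0.
pose psi := chart_lift i (fun y => k y ^+ 2).
have k2out y : r' < `|y - y0| -> k y ^+ 2 = 0 by move=> /kout->; rewrite expr0n.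
have Ck2 l : Ck l setT (fun y => k y ^+ 2) by exact: Ck_exp openT (Cok l).
have tpsi : test_function S V psi by exact: test_function_lift bV' k2out Ck2.
have psi0 x : 0 <= psi x.
  by rewrite /psi /chart_lift; case: pselect => // ix; exact: sqr_ge0.
have [Cpsiall _ _] := tpsi; have Cpsi := Cpsiall 1%N.
have psiC x : ~ C x -> psi x = 0 by exact: chart_lift_out bV' k2out.
have := Pw psi tpsi psi0; rewrite (first_order_support FP clC CV Cpsi psiC).
move=> Ppsi; rewrite -lee_fin EFinD EFinM fineK// fineK//.
have iHe : vol.-integrable C (fun x => (e%:E * (EFin \o Hf) x)%E) by exact: integrableZl.
rewrite -integralZl// -integralD//.
apply: le_trans Ppsi _; apply: le_integral => //.
- exact: integr _ (cP _ Cpsi).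
- exact: integrableD.
move=> x; rewrite inE => Cx; have [Vx ix] := CV' _ Cx.
have [_ _ PE] := H x ix Vx.
rewrite /= -EFinM -EFinD lee_fin (PE _ Cpsi) (PE _ Cxi2).
have dxi : diffM i xi x by exact: (C1M_diff Cxi I ix).
rewrite (dch_lift _ ix) (dch_sqr dxi) /psi chart_liftE// coordK//.
have xy := ((chart_boxP x bV').1 Cx).2.
have [kh1 kh2] := kh _ xy.
have hE : xi x = h (coord i x) by rewrite /h chart_pullbackE ?coordK//; exact: codomain_coord.
have dk y : differentiable k y by apply (Cok 1%N).1.
have DE c : dch i xi x 0 c = 'D_(delta_mx 0 c) h (coord i x).
  by rewrite (dch_pullback xi ix) mxE.
have := @sqr_perturbation _ (a x) (\row_c 'D_(delta_mx 0 c) k (coord i x)) (dch i xi x) (b x)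
  (k (coord i x)) (h (coord i x)) e e0 e1 kh1.
rewrite /Hf hE => SP.
have E1 : \sum_c a x 0 c * (\row_c 'D_(delta_mx 0 c) (fun y => k y ^+ 2) (coord i x)) 0 c =
    \sum_c a x 0 c * (2 * k (coord i x) * (\row_c 'D_(delta_mx 0 c) k (coord i x)) 0 c).
  by apply: eq_bigr => c _; rewrite !mxE derive_sqr.
have E2 : \sum_c a x 0 c * ((2 * h (coord i x)) *: dch i xi x) 0 c =
    \sum_c a x 0 c * (2 * h (coord i x) * dch i xi x 0 c).
  by apply: eq_bigr => c _; rewrite [in LHS]mxE.
rewrite E1 E2; apply: SP => c; by rewrite mxE DE.
Qed.

End Extension.

Section GlobalExtension.
Context {R : realType} {m : nat} {M : ptopologicalType} (S : manifold R m M).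
Implicit Types (i j : chart S) (U V W C : set M) (x : M) (f u psi xi : M -> R).
Variables (g : M -> 'M[R]_m) (vol : {measure set (@borel M) -> \bar R}).
Hypotheses (gpos : forall x, pos_def (g x)) (gC : Ck_tensor_field S 0 g).
Hypothesis volg : riemannian_volume S g vol.

(** The lattice bump of a one-node grid (n = 0), serving as a smooth cutoff around y0. *)
Definition box_bump (y0 : 'rV[R]_m) (r : R) : 'rV[R]_m -> R :=
  @cell_bump R m y0 r 0 [ffun=> ord0].

Lemma node0 (y0 : 'rV[R]_m) (r : R) : @node R m y0 r 0 [ffun=> ord0] = y0.
Proof. by apply/rowP => b; rewrite mxE ffunE mulr0 addr0. Qed.

Lemma Ck_box_bump k y0 r : Ck k setT (box_bump y0 r).
Proof. exact: Ck_cell_bump. Qed.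

Lemma box_bump_out y0 r y : 0 < r -> r < `|y - y0| -> box_bump y0 r y = 0.
Proof. by move=> r0 yr; apply: cell_bump_far => //; rewrite node0. Qed.

Lemma box_bump_center y0 r : box_bump y0 r y0 = 1.
Proof.
rewrite /box_bump /cell_bump big1// => b _.
by rewrite /cell_coord ffunE subrr mulr0 subr0 bump0.
Qed.

Lemma box_bump_ge0 y0 r y : 0 <= box_bump y0 r y.
Proof. exact: cell_bump_ge0. Qed.

Lemma box_bump_le1 y0 r y : box_bump y0 r y <= 1.
Proof.
suff /andP[] : 0 <= box_bump y0 r y <= 1 by [].
rewrite /box_bump /cell_bump; elim/big_ind : _ => [|a b /andP[a0 a1] /andP[b0 b1]|b _].
- by rewrite ler01 lexx.
- by rewrite mulr_ge0// mulr_ile1.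
- by rewrite bump_ge0 bump_le1.
Qed.

Definition rsqrt (t : R) : R := (Num.sqrt t)^-1.
Definition drsqrt (t : R) : R := - (Num.sqrt t)^-1 ^+ 2 * (2 * Num.sqrt t)^-1.

Lemma is_derive_rsqrt (t : R) : 0 < t -> is_derive t (1 : R) rsqrt (drsqrt t).
Proof.
move=> t0; have s0 : Num.sqrt t != 0 by rewrite gt_eqF// sqrtr_gt0.
have dV := @is_deriveV _ (@Num.sqrt R) _ _ _ s0 (is_derive1_sqrt t0).
by apply: (is_derive_eq dV); rewrite /drsqrt -exprVn.
Qed.

Lemma continuous_drsqrt (t : R) : 0 < t -> {for t, continuous drsqrt}.
Proof.
move=> t0; have s0 : Num.sqrt t != 0 by rewrite gt_eqF// sqrtr_gt0.
have cs : {for t, continuous (@Num.sqrt R)} by exact: sqrt_continuous.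
have cV : {for t, continuous (fun t : R => (Num.sqrt t)^-1)} by exact: (continuousV s0 cs).
have s20 : 2 * Num.sqrt t != 0 by rewrite mulf_neq0.
have c2 : {for t, continuous (fun t : R => 2 * Num.sqrt t)}.
  by apply: continuousM => //; exact: cst_continuous.
have c3 : {for t, continuous (fun t : R => (2 * Num.sqrt t)^-1)}.
  exact: (@continuousV _ _ (fun t : R => 2 * Num.sqrt t) t s20 c2).
have c4 : {for t, continuous (fun t : R => (Num.sqrt t)^-1 ^+ 2)}.
  exact: (continuous_comp cV (@exprn_continuous _ 2 _)).
exact: (continuousM (continuousN c4) c3).
Qed.

(** Localisation must keep the shape of a square. With W the sum of the squares of finitely many
    cutoffs chi, xi^2 is the sum of the squares of chi xi / sqrt W, each supported in a single chart
    box. *)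
Lemma weakly_nonneg_sqr V P C xi : open V -> first_order S V P -> weakly_nonneg S vol V P ->
  compact C -> C `<=` V -> CkM S 1 setT xi -> (forall x, ~ C x -> xi x = 0) ->
  (0 <= \int[vol]_(x in V) (P (fun z => (xi z ^+ 2)%R) x)%:E)%E.
Proof.
move=> oV FP Pw cC CV Cxi xi0.
have clC : closed C by exact: (closed_compact S cC).
have mC : measurable (C : set (@borel M)) := measurable_compact S cC.
have exr x : exists r, V x -> 0 < r /\ box_in (chart_at S x) V (coord (chart_at S x) x) r.
  case: (pselect (V x)) => Vx; last by exists 0.
  by have [r r0 rV] := box_in_exists oV Vx (dom_chart_at S x); exists r.
have [r rP] := choice exr.
pose chi x := chart_lift (chart_at S x) (box_bump (coord (chart_at S x) x) (r x / 2)).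
have r2 x : V x -> 0 < r x / 2 /\ r x / 2 < r x.
  by move=> /rP[rx _]; rewrite divr_gt0// ltr_pdivrMr// ltr_pMr// ltr1n.
have chiout x z : V x -> ~ chart_box (chart_at S x) (coord (chart_at S x) x) (r x / 2) z ->
    chi x z = 0.
  move=> Vx; have [r20 rr] := r2 _ Vx; have [_ bV] := rP _ Vx.
  by apply: (chart_lift_out (box_in_le (ltW rr) bV)) => y; exact: box_bump_out.
have Cchi x : V x -> CkM S 1 setT (chi x).
  move=> Vx; have [r20 rr] := r2 _ Vx; have [_ bV] := rP _ Vx.
  apply: (CkM_lift (box_in_le (ltW rr) bV)) => [y|]; first exact: box_bump_out.
  exact: Ck_box_bump.
have chi1 x : chi x x = 1.
  by rewrite /chi chart_liftE ?box_bump_center//; exact: dom_chart_at.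
pose B x := [set z | V x /\ 0 < chi x z].
have := cC; rewrite compact_cover => /(_ _ C B) [|x Cx|D DC CD].
- move=> x /CV Vx; rewrite openE => z [_ z0].
  have cz := CkM_continuous (U := setT) I (Cchi _ Vx) (x := z).
  have nz : nbhs z [set y | 0 < chi x y] by exact: (cz _ (open_near (@open_gt _ 0) z0)).
  by apply: filterS nz => y.
- by exists x => //; split; [exact: CV|rewrite chi1].
pose s := [seq x <- finmap.enum_fset D | `[< V x >]].
(* Away from V the radius, hence chi, is arbitrary; the value 0 makes every member of the family
   C^1, as the lemmas on sums require. *)
pose chi' x := if `[< V x >] then chi x else fun=> 0.
have chi'T x : V x -> chi' x = chi x by move=> Vx; rewrite /chi' asboolT.
have chi'F x : ~ V x -> chi' x = fun=> 0 by move=> Vx; rewrite /chi' asboolF.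
have Cchi' x : CkM S 1 setT (chi' x).
  have [Vx|Vx] := pselect (V x).
    by rewrite (chi'T x Vx); exact: (Cchi x Vx).
  by rewrite (chi'F x Vx); exact: (CkM_cst 1 setT (0 : R)).
pose W z := \sum_(x <- s) chi' x z ^+ 2.
have CW : CkM S 1 setT W := CkM_sum s openT (fun x => CkMX 2 openT (Cchi' x)).
have W0 z : C z -> 0 < W z.
  move=> /CD[x xD] [Vx xz].
  have xs : x \in s by rewrite mem_filter; apply/andP; split => //; exact/asboolP.
  rewrite /W (bigD1_seq x)//=; last by rewrite filter_uniq// finmap.fset_uniq.
  rewrite ltr_pwDl//; last by rewrite sumr_ge0// => *; exact: sqr_ge0.
  by rewrite chi'T// exprn_gt0.
(* W is positive only around C; outside C the factor xi vanishes, so the value of [rsqrt] there does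
   not affect regularity. *)
pose kappa z := xi z * rsqrt (W z).
have Ckappa : CkM S 1 setT kappa.
  apply: CkM_loc => z _; case: (pselect (C z)) => Cz.
    exists [set z | 0 < W z].
      split; last exact: W0.
      rewrite openE => y y0; have cy := CkM_continuous (U := setT) I CW (x := y).
      exact: (cy _ (open_near (@open_gt _ 0) y0)).
    have oW : open [set z | 0 < W z].
      rewrite openE => y y0; have cy := CkM_continuous (U := setT) I CW (x := y).
      exact: (cy _ (open_near (@open_gt _ 0) y0)).
    apply: (CkMM oW); first exact: CkM_sub Cxi.
    apply: (C1M_comp1 (h' := drsqrt) oW) => [x|x|].
    - exact: is_derive_rsqrt.
    - exact: continuous_drsqrt.
    - exact: CkM_sub CW.
  exists (~` C); first by split => //; exact: closed_openC.
  apply: (@CkM_eq _ _ _ _ _ _ (fun=> 0)); first exact: closed_openC.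
    by move=> x nCx; rewrite /kappa xi0// mul0r.
  exact: CkM_cst.
pose xis x z := chi' x z * kappa z.
have Cxis x : CkM S 1 setT (xis x) := CkMM openT (Cchi' x) Ckappa.
have xis0 x z : ~ C z -> xis x z = 0 by move=> nCz; rewrite /xis /kappa xi0// mul0r mulr0.
have xiE : (fun z => xi z ^+ 2) = (fun z => \sum_(x <- s) xis x z ^+ 2).
  apply/funext => z; case: (pselect (C z)) => Cz; last first.
    by rewrite xi0// expr0n big1// => x _; rewrite xis0// expr0n.
  under eq_bigr do rewrite exprMn.
  rewrite -mulr_suml -/(W z) /kappa exprMn /rsqrt exprVn sqr_sqrtr; last exact/ltW/W0.
  by rewrite mulrCA mulfV ?mulr1// gt_eqF// W0.
have Cxi2 : CkM S 1 setT (fun z => xi z ^+ 2) := CkMX 2 openT Cxi.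
have xi20 z : ~ C z -> xi z ^+ 2 = 0 by move=> /xi0->; rewrite expr0n.
have Cxis2 x : CkM S 1 setT (fun z => xis x z ^+ 2) := CkMX 2 openT (Cxis x).
have xis20 x z : ~ C z -> xis x z ^+ 2 = 0 by move=> /(xis0 x)->; rewrite expr0n.
rewrite (first_order_support vol FP clC CV Cxi2 xi20).
have -> : (\int[vol]_(x in C) (P (fun z => (xi z ^+ 2)%R) x)%:E =
    \int[vol]_(x in C) (\sum_(l <- s) (P (fun z => (xis l z ^+ 2)%R) x)%:E))%E.
  apply: eq_integral => x; rewrite inE => Cx.
  by rewrite xiE (first_order_sum s FP (CV _ Cx) Cxis2) sumEFin.
rewrite integral_sum//; last first.
  move=> l; apply: (integrable_compact gpos gC volg oV CV cC) => x Vx.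
  exact: (first_order_continuous FP Vx (Cxis2 l) oV).
apply: sume_ge0 => l _.
rewrite -(first_order_support vol FP clC CV (Cxis2 l) (xis20 l)).
case: (pselect (V l)) => Vl; last first.
  rewrite integral_ge0// => x Vx; rewrite lee_fin.
  have -> : P (fun z => xis l z ^+ 2) x = 0; last by [].
  apply: (first_order_near0 FP Vx (Cxis2 l)); apply: nearW => z.
  by rewrite /xis chi'F// mul0r expr0n.
have [r20 rr] := r2 _ Vl; have [_ bV] := rP _ Vl.
apply: (weakly_nonneg_sqr_box gpos gC volg oV FP Pw bV r20 rr (Cxis l)) => z nz.
by rewrite /xis chi'T// chiout// mul0r.
Qed.

End GlobalExtension.

(** * Interior maxima of strict subsolutions *)

Section PowerGrowth.
Context {R : realType}.
Variable A : R -> R.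
Hypotheses (A1 : assumption_A1 A) (A2 : assumption_A2 A) (A3 : assumption_A3 A).

(** An integer p >= 1 / delta replaces the real exponent: the p-th power of t^delta is at most t for
    t < 1. *)
Lemma phi_power_growth : exists (p : nat) (w C : R), [/\ (0 < p)%N, 0 < w, 0 < C &
  forall t, 0 < t -> t < w -> phi A t ^+ p <= C ^+ p * t].
Proof.
have [w [C [d [w0 C0 d0 H]]]] := A3.
pose p := (Num.truncn d^-1).+1.
have pd : 1 <= d * p%:R.
  rewrite -ler_pdivrMl// mulr1 ltW//.
  by rewrite /p; apply: truncnS_gt.
exists p, (Num.min w 1), C; split => //; first by rewrite lt_min w0 ltr01.
move=> t t0; rewrite lt_min => /andP[tw t1].
have ph : 0 <= phi A t by apply/ltW/phi_gt0.
have tw' : 0 < t < w by rewrite t0 tw.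
have := H t tw' => Ht.
have : phi A t ^+ p <= (C * t `^ d) ^+ p.
  by rewrite lerXn2r// nnegrE mulr_ge0 ?powR_ge0 ?(ltW C0).
move=> /le_trans; apply; rewrite exprMn ler_wpM2l ?exprn_ge0 ?(ltW C0)//.
rewrite -powR_mulrn ?powR_ge0// -powRrM.
rewrite -[leRHS]powRr1 ?(ltW t0)//; apply: ger_powR => //.
by rewrite t0 ltW.
Qed.

(* Either the absorption term [lam phi t / tau^p] wins over the gradient of the
   cutoff, or [t] is so small that the growth condition bounds [phi]. *)
Lemma absorption (n p : nat) (z t ph lam L C tau : R) :
  0 <= t -> 0 <= z -> z <= 1 -> (0 < p)%N -> 0 < tau -> 0 <= ph -> 0 < lam -> 0 <= L -> 0 <= C ->
  ph ^+ p <= C ^+ p * t ->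
  2 * n.+1%:R * L * z ^+ (2 * n).+1 * ph <=
  z ^+ (2 * n).+2 * (lam * ph * t / tau ^+ p) +
  2 * n.+1%:R * L * (C * (1 + 2 * n.+1%:R * L / lam)) * tau * z ^+ (2 * n).
Proof.
move=> t0 z0 z1 p0 tau0 ph0 lam0 L0 C0 pht.
set N := 2 * n.+1%:R * L; have N0 : 0 <= N by rewrite !mulr_ge0.
set k := 1 + N / lam; have Nl : 0 <= N / lam by rewrite divr_ge0// ltW.
have k1 : 1 <= k by rewrite /k lerDl.
have k0 : 0 <= k by exact: le_trans k1.
have taup : 0 < tau ^+ p by rewrite exprn_gt0.
have rest0 : 0 <= N * (C * k) * tau * z ^+ (2 * n).
  by rewrite !mulr_ge0 ?exprn_ge0// ltW.
move: z0; rewrite le_eqVlt => /orP[/eqP<-|z0].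
  by rewrite !exprS !mul0r !(mulr0, mul0r, add0r) !mulr_ge0 ?exprn_ge0// ltW.
have zn0 : 0 < z ^+ (2 * n) by rewrite exprn_gt0.
case: (leP (N * tau ^+ p) (z * (lam * t))) => h.
  rewrite -[leLHS]addr0 lerD//.
  have -> : N * z ^+ (2 * n).+1 * ph = z ^+ (2 * n) * z * ph * N by rewrite exprS; ring.
  have -> : z ^+ (2 * n).+2 * (lam * ph * t / tau ^+ p) =
      z ^+ (2 * n) * z * ph * (z * (lam * t) / tau ^+ p).
    by rewrite !exprS; field; rewrite gt_eqF.
  rewrite ler_wpM2l ?mulr_ge0 ?(ltW zn0) ?(ltW z0)//.
  by rewrite ler_pdivlMr.
(* Here z t < (N / lam) tau^p. The growth bound, z^p <= z and N / lam <= k <= k^p give the p-th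
   power of the claim. *)
have zphle : z * ph <= C * k * tau.
  rewrite -(@ler_pXn2r _ p)// ?nnegrE ?mulr_ge0 ?(ltW z0) ?(ltW tau0)//.
  rewrite exprMn (@le_trans _ _ (z ^+ p * (C ^+ p * t)))//.
    by rewrite ler_wpM2l ?exprn_ge0// ltW.
  have -> : z ^+ p * (C ^+ p * t) = C ^+ p * (z ^+ p * t) by ring.
  have -> : (C * k * tau) ^+ p = C ^+ p * (k ^+ p * tau ^+ p) by rewrite !exprMn mulrA.
  rewrite ler_wpM2l ?exprn_ge0//.
  have zp : z ^+ p <= z.
    by rewrite -[leRHS]expr1 ler_wiXn2l// ltW.
  rewrite (@le_trans _ _ (z * t))//; first by rewrite ler_wpM2r.
  rewrite (@le_trans _ _ (N / lam * tau ^+ p))//.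
    rewrite [leRHS]mulrAC ler_pdivlMr// -[leLHS]mulrA [t * lam]mulrC.
    exact: ltW.
  rewrite ler_wpM2r ?(ltW taup)//.
  have kp : k <= k ^+ p by rewrite -[leLHS]expr1 ler_weXn2l.
  by rewrite (le_trans _ kp)// /k lerDr.
rewrite -[leLHS]add0r lerD//.
  rewrite mulr_ge0 ?exprn_ge0 ?(ltW z0)//.
  by rewrite divr_ge0 ?(ltW taup)// !mulr_ge0// ltW.
have -> : N * z ^+ (2 * n).+1 * ph = N * z ^+ (2 * n) * (z * ph) by rewrite exprS; ring.
have -> : N * (C * k) * tau * z ^+ (2 * n) = N * z ^+ (2 * n) * (C * k * tau) by ring.
by rewrite ler_wpM2l// mulr_ge0// ltW.
Qed.

End PowerGrowth.

Section ChartDerivatives.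
Context {R : realType} {m : nat} {M : ptopologicalType} (S : manifold R m M).
Implicit Types (i j : chart S) (U V W C : set M) (x : M) (f u psi xi : M -> R).

Lemma dch_mul i f h x : dom i x -> diffM i f x -> diffM i h x ->
  dch i (fun z => f z * h z) x = f x *: dch i h x + h x *: dch i f x.
Proof.
move=> ix df dh; apply/rowP => c; rewrite !mxE.
have -> : (fun z => f z * h z) \o param i = (f \o param i) * (h \o param i) by [].
rewrite deriveM; last 2 first.
- exact: diff_derivable.
- exact: diff_derivable.
by rewrite /= coordK.
Qed.

Lemma dch_exp i f n x : dom i x -> diffM i f x ->
  dch i (fun z => f z ^+ n.+1) x = (n.+1%:R * f x ^+ n) *: dch i f x.
Proof.
move=> ix df; apply/rowP => c; rewrite !mxE.
have -> : (fun z => f z ^+ n.+1) \o param i = (f \o param i) ^+ n.+1.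
  by rewrite exprfctE.
rewrite deriveX; last exact: diff_derivable.
by rewrite /= coordK.
Qed.

Lemma dch_comp1 i (h : R -> R) (d : R) f x : dom i x -> diffM i f x ->
  is_derive (f x) (1 : R) h d -> dch i (h \o f) x = d *: dch i f x.
Proof.
move=> ix df dh; apply/rowP => c; rewrite !mxE.
have dh' : is_derive ((f \o param i) (coord i x)) (1 : R) h d by rewrite /= coordK.
exact: (derive_comp1 _ dh' df).
Qed.

(** Restricted to each coordinate line through x, f has an interior maximum at parameter 0. *)
Lemma dch_at_max i V f x : open V -> V x -> dom i x -> CkM S 1 V f ->
  (forall z, V z -> f z <= f x) -> dch i f x = 0.
Proof.
move=> oV Vx ix Cf fmax; apply/rowP => c; rewrite !mxE.
set y := coord i x; pose F (t : R) := f (param i (t *: delta_mx 0 c + y)).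
have [r r0 bV] := box_in_exists oV Vx ix.
have ndelta : `|delta_mx 0 c : 'rV[R]_m| <= 1.
  by apply: row_norm_le => // b; rewrite mxE; case: (_ && _); rewrite ?normr1 ?normr0.
have inb (t : R) : `|t| <= r -> `|t *: delta_mx 0 c + y - y| <= r.
  by move=> tr; rewrite addrK normrZ (le_trans _ tr)// ler_piMr.
have E (t : R) : (fun h : R => h^-1 *: (F (h *: 1 + t) - F t)) =
    (fun h : R => h^-1 *: ((f \o param i) (h *: delta_mx 0 c + (t *: delta_mx 0 c + y)) -
                           (f \o param i) (t *: delta_mx 0 c + y))).
  by apply/funext => h; rewrite /F [h *: 1]mulr1 scalerDl addrA.
have dF (t : R) : t \in `](- r), r[ -> derivable F t 1.
  rewrite in_itv /= => /andP[t1 t2].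
  have tr : `|t| <= r by rewrite ler_norml !ltW.
  have [it Vt] := bV _ (inb _ tr).
  have df : differentiable (f \o param i) (t *: delta_mx 0 c + y).
    by apply (Cf i).1; rewrite image_coordE.
  rewrite /derivable E.
  exact: (@diff_derivable _ _ _ (f \o param i) (t *: delta_mx 0 c + y) (delta_mx 0 c) df).
have Fmax (t : R) : t \in `](- r), r[ -> F t <= F 0.
  rewrite in_itv /= => /andP[t1 t2].
  have tr : `|t| <= r by rewrite ler_norml !ltW.
  have [it Vt] := bV _ (inb _ tr).
  by rewrite /F scale0r add0r coordK//; exact: fmax.
have r_r : - r <= r by rewrite ge0_cp// ltW.
have in0 : (0 : R) \in `](- r), r[ by rewrite in_itv /= oppr_lt0 r0.
have [_ dF0] := derive1_at_max r_r dF in0 Fmax.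
rewrite -[RHS]dF0 /derive E scale0r add0r //.
Qed.

End ChartDerivatives.

Section CriticalPoint.
Context {R : realType} {m : nat} {M : ptopologicalType} (S : manifold R m M).
Implicit Types (i j : chart S) (U V W C : set M) (x : M) (f u psi xi : M -> R).
Variables (g : M -> 'M[R]_m) (A : R -> R) (T : M -> 'M[R]_m) (X : M -> 'rV[R]_m).
Hypotheses (gpos : forall x, pos_def (g x)) (gC : Ck_tensor_field S 0 g).
Hypotheses (TC : Ck_tensor_field S 0 T) (Tpos : forall x, pos_def (T x)).
Hypothesis XC : Ck_vector_field S 0 X.

Local Notation gn u := (fun z => gnorm g z (gradient S g u z)).

Lemma flux_dot i u f x :
  \sum_c flux g A T i u x 0 c * dch i f x 0 c =
  A (gn u x) * bil (tensor_in i T x) (chart_grad g i u x) (chart_grad g i f x).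
Proof.
rewrite [chart_grad g i f x]/chart_grad /bil trmx_mul mulmxA.
rewrite -/(flux_dir g T i u x) mxE mulr_sumr; apply: eq_bigr => c _.
by rewrite /flux !mxE mulrA.
Qed.

(** The differential at x vanishes, and the little-o remainder is used with constant 1. *)
Lemma near_first_order_small i f x : dom i x -> diffM i f x -> dch i f x = 0 ->
  \forall z \near x, `|f z - f x| <= `|coord i z - coord i x|.
Proof.
move=> ix df d0; set y := coord i x.
have dv v : 'd (f \o param i) y v = 0.
  rewrite -deriveE// derive_sum_coord// big1// => b _.
  by have := congr1 (fun w : 'rV[R]_m => w 0 b) d0; rewrite !mxE => ->; rewrite mulr0.
have := diff_locally df => /eqaddoP/(_ 1 ltr01) H.
have ny : \forall h \near (0 : 'rV[R]_m), `|(f \o param i) (h + y) - (f \o param i) y| <= `|h|.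
  apply: filterS H => h; rewrite /= !fctE /= mul1r.
  by rewrite -[coord i x]/y dv addr0.
have ny' : \forall z \near y, `|(f \o param i) z - (f \o param i) y| <= `|z - y|.
  by apply/nbhs0P; apply: filterS ny => h; rewrite [y + h]addrC addrK.
have cc : {for x, continuous (coord i)} by exact: coord_continuous.
have := cc _ ny'.
apply: filterS2 (open_near (@dom_open _ _ _ S i) ix) => z iz.
by rewrite /= !coordK.
Qed.

(** T is uniformly coercive near x in the sup norm of the chart, while the metric is bounded
    there. *)
Lemma near_ellipticity i U u x : open U -> CkM S 1 U u -> dom i x -> U x ->
  exists2 l : R, 0 < l & \forall z \near x,
    l * gn u z ^+ 2 <= bil (tensor_in i T z) (chart_grad g i u z) (chart_grad g i u z).
Proof.
move=> oU Cu ix Ux.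
have [l l0 lP] := near_coercive (tensor_in_continuous TC ix) (pos_def_tensor_in ix (Tpos x)).
have [L L0 LP] := near_entries_bounded (tensor_in_continuous gC ix).
pose K := m%:R * (m%:R * L) + 1.
have K0 : 0 < K by rewrite ltr_wpDl// !mulr_ge0// ltW.
exists (l / K); first by rewrite divr_gt0.
have nn := near_gnorm_chart gpos oU Cu ix Ux.
apply: filterS3 lP LP nn => z lz Lz [iz Uz nE].
rewrite (le_trans _ (lz _))// -mulrA ler_wpM2l ?(ltW l0)//.
rewrite ler_pdivrMl// nE (le_trans (ler_norm _))//.
rewrite (le_trans (bil_le _ _ (ltW L0) Lz))// -mulrA -expr2 ler_wpM2r ?sqr_ge0//.
by rewrite lerDl.
Qed.

Lemma gradient_eq0 x u : diffM (chart_at S x) u x -> dch (chart_at S x) u x = 0 ->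
  gradient S g u x = 0.
Proof.
move=> du d0; rewrite (gradient_chart gpos (dom_chart_at S x) du).
by rewrite /chart_grad d0 !mul0mx.
Qed.

Lemma gnorm0 x : gnorm g x 0 = 0.
Proof. by rewrite /gnorm bil0l sqrtr0. Qed.

End CriticalPoint.

Lemma nonpos_of_small {R : realType} (a B e0 : R) : 0 < e0 -> 0 <= B ->
  (forall e, 0 < e -> e <= e0 -> a <= B * e) -> a <= 0.
Proof.
move=> e00 B0 H; rewrite leNgt; apply/negP => a0.
have B1 : 0 < 2 * (B + 1) by rewrite mulr_gt0// ltr_wpDl.
pose e := Num.min e0 (a / (2 * (B + 1))).
have ep : 0 < e by rewrite lt_min e00 divr_gt0.
have h1 : e <= e0 by rewrite ge_min lexx.
have h2 : e * (2 * (B + 1)) <= a by rewrite -ler_pdivlMr// ge_min lexx orbT.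
have := H e ep h1; have Be : 0 <= B * e by rewrite mulr_ge0// ltW.
lra.
Qed.

Section StrictSubsolution.
Context {R : realType} {m : nat} {M : ptopologicalType} (S : manifold R m M).
Implicit Types (i j : chart S) (U V W C : set M) (x : M) (f u psi xi : M -> R).
Variables (g : M -> 'M[R]_m) (A : R -> R) (T : M -> 'M[R]_m) (X : M -> 'rV[R]_m).
Variable vol : {measure set (@borel M) -> \bar R}.
Hypotheses (gpos : forall x, pos_def (g x)) (gC : Ck_tensor_field S 0 g).
Hypothesis volg : riemannian_volume S g vol.
Hypotheses (A1 : assumption_A1 A) (A2 : assumption_A2 A) (A3 : assumption_A3 A).
Hypotheses (TC : Ck_tensor_field S 0 T) (Tpos : forall x, pos_def (T x)).
Hypothesis XC : Ck_vector_field S 0 X.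

Local Notation gn u := (fun z => gnorm g z (gradient S g u z)).

Lemma phi_ge0 t : 0 <= t -> 0 <= phi A t.
Proof.
rewrite le_eqVlt => /orP[/eqP<-|/(phi_gt0 A1 A2)/ltW//].
by rewrite /phi mul0r.
Qed.

(** Where grad u = 0 the value A(0) has no known sign, but the bound on the flux direction makes
    both sides 0. *)
Lemma flux_dot_grad_ge (l K : R) i u x : 0 < l ->
  (forall c, `|flux_dir g T i u x 0 c| <= K * gn u x) ->
  l * gn u x ^+ 2 <= bil (tensor_in i T x) (chart_grad g i u x) (chart_grad g i u x) ->
  l * phi A (gn u x) * gn u x <= \sum_c flux g A T i u x 0 c * dch i u x 0 c.
Proof.
move=> l0 fK lT.
have := gnorm_ge0 g x (gradient S g u x); rewrite le_eqVlt => /orP[/eqP n0|n0].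
  rewrite -n0 mulr0 big1// => c _; rewrite /flux mxE.
  suff -> : flux_dir g T i u x 0 c = 0 by rewrite mulr0 mul0r.
  by apply/normr0_eq0/eqP; rewrite eq_le normr_ge0 andbT (le_trans (fK c))// -n0 mulr0.
have An : 0 < A (gn u x) by have := phi_gt0 A1 A2 n0; rewrite /phi pmulr_rgt0.
rewrite flux_dot.
have -> : l * phi A (gn u x) * gn u x = A (gn u x) * (l * gn u x ^+ 2) by rewrite /phi; ring.
by rewrite ler_wpM2l// ltW.
Qed.

Lemma flux_dot_le (K D : R) i u f x : 0 <= K ->
  (forall c, `|flux_dir g T i u x 0 c| <= K * gn u x) ->
  (forall c, `|dch i f x 0 c| <= D) ->
  `|\sum_c flux g A T i u x 0 c * dch i f x 0 c| <= phi A (gn u x) * (m%:R * (K * D)).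
Proof.
move=> K0 fK fD; rewrite (le_trans (ler_norm_sum _ _ _))//.
have -> : phi A (gn u x) * (m%:R * (K * D)) = \sum_(c < m) phi A (gn u x) * (K * D).
  by rewrite sumr_const card_ord mulrCA mulr_natl.
apply: ler_sum => c _; rewrite normrM.
have -> : phi A (gn u x) * (K * D) = phi A (gn u x) * K * D by rewrite mulrA.
apply: ler_pM => //.
have pn := phi_ge0 (gnorm_ge0 g x (gradient S g u x)).
rewrite /flux mxE normrM (le_trans (ler_wpM2l (normr_ge0 _) (fK c)))//.
have -> : `|A (gn u x)| * (K * gn u x) = `|phi A (gn u x)| * K.
  by rewrite /phi normrM (ger0_norm (gnorm_ge0 _ _ _)); ring.
by rewrite ger0_norm.
Qed.

Variables (V : set M) (u : M -> R) (x0 : M) (c : R).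
Hypotheses (oV : open V) (Vx0 : V x0) (Cu : CkM S 1 setT u) (c0 : 0 < c).
Hypothesis umax : forall z, V z -> u z <= u x0.

Let i := chart_at S x0.
Let ix0 : dom i x0. Proof. exact: dom_chart_at. Qed.

(** The drift is at most c / 2 and |grad u| < w near x0 because grad u vanishes at the maximum point
    and both quantities are continuous. *)
Lemma near_max_data (w : R) : 0 < w -> exists K l : R, [/\ 0 < K, 0 < l &
  \forall z \near x0, [/\ dom i z /\ V z, forall b, `|flux_dir g T i u z 0 b| <= K * gn u z,
    l * gn u z ^+ 2 <= bil (tensor_in i T z) (chart_grad g i u z) (chart_grad g i u z),
    `|drift S g X u z| <= c / 2 /\ gn u z < w &
    u x0 - u z <= `|coord i z - coord i x0|]].
Proof.
move=> w0.
have [K K0 KP] := near_flux_dir_le gpos gC TC openT Cu ix0 I.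
have [l l0 lP] := near_ellipticity gpos gC TC Tpos openT Cu ix0 I.
exists K, l; split => //.
have d0 : dch i u x0 = 0.
  exact: (dch_at_max oV Vx0 ix0 (CkM_sub (@subsetT _ V) Cu) umax).
have du : diffM i u x0 by exact: (C1M_diff Cu I ix0).
have g0 : gradient S g u x0 = 0 by exact: gradient_eq0.
have nd : \forall z \near x0, `|drift S g X u z| < c / 2.
  have cd := drift_continuous gpos gC XC openT Cu (x := x0) I.
  have c2 : 0 < c / 2 by rewrite divr_gt0.
  have cd' : drift S g X u @ x0 --> (0 : R).
    by have := cd; rewrite /prop_for /continuous_at {2}/drift g0 bil0r.
  by move: cd' => /cvgr0Pnorm_lt/(_ _ c2).
have ng : \forall z \near x0, gn u z < w.
  have cg := gnorm_continuous gpos gC openT Cu (x := x0) I.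
  have : gn u x0 < w by rewrite g0 gnorm0.
  by move=> /(open_near (@open_lt _ w)) /cg.
have nl := near_first_order_small ix0 du d0.
have nb : \forall z \near x0, dom i z /\ V z.
  exact: (filterI (open_near (@dom_open _ _ _ S i) ix0) (open_near oV Vx0)).
near=> z; split.
- by near: z.
- by near: z.
- by near: z.
- split; last by near: z.
  by apply: ltW; near: z.
- have uz : u z <= u x0 by apply: umax; have [] // : dom i z /\ V z by near: z.
  rewrite -[leLHS]ger0_norm ?subr_ge0// distrC; near: z; exact: nl.
Unshelve. all: by end_near. Qed.

Hypothesis Lu : weakly_nonneg S vol V
  (fun psi x => - (weak_L S g A T X u psi x + c * psi x)).

Lemma first_order_strict : first_order S V
  (fun psi x => - (weak_L S g A T X u psi x + c * psi x)).
Proof.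
apply: first_orderN; apply: first_orderD0 => [|x _]; last exact: cst_continuous.
exact: (first_order_weak_L gpos gC A1 A2 TC XC oV (CkM_sub (@subsetT _ V) Cu)).
Qed.

Definition weight (s : R) (z : M) : R := expR ((u z - u x0) / s).

Lemma C1_weight s : CkM S 1 setT (weight s).
Proof.
have C1 : CkM S 1 setT (fun z => (u z - u x0) * s^-1).
  exact: (CkMM openT (CkMB openT Cu (CkM_cst 1 setT (u x0))) (CkM_cst 1 setT s^-1)).
exact: (C1M_comp1 (h' := expR) openT (fun x _ => is_derive_expR _)
  (fun x _ => @continuous_expR R _) C1).
Qed.

Lemma dch_weight s z : dom i z -> dch i (weight s) z = (weight s z / s) *: dch i u z.
Proof.
move=> iz; have du : diffM i u z by exact: (C1M_diff Cu I iz).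
have dh : is_derive (u z) (1 : R) (fun t : R => expR ((t - u x0) / s)) (weight s z / s).
  have d4 : is_derive (u z) (1 : R) (fun t : R => (t - u x0) / s) s^-1.
    have d5 := is_deriveB (is_derive_id (u z) (1 : R)) (is_derive_cst (u x0) (u z) (1 : R)).
    have d6 := is_deriveM d5 (is_derive_cst s^-1 (u z) (1 : R)).
    by apply: (is_derive_eq d6); rewrite /= scaler0 add0r subr0 /GRing.scale /= mulr1.
  exact: (@is_derive1_comp _ expR (fun t : R => (t - u x0) / s) _ _ _ (is_derive_expR _) d4).
exact: (@dch_comp1 _ _ _ S i (fun t : R => expR ((t - u x0) / s)) _ u z iz du dh).
Qed.

(** Doubling the scale takes the square root of the weight, which exhibits the test functions of
    [no_interior_max] as squares. *)
Lemma weight_sqr s z : weight (2 * s) z ^+ 2 = weight s z.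
Proof.
rewrite /weight -expRM_natl; congr expR; rewrite invfM.
by move: (u z - u x0) (s^-1) => a b; field.
Qed.

(* Let I_n(t) be the integral of zeta^(2n) exp((u - u x0) / t^p), with zeta a cutoff
   around x0.  Testing with its integrand gives I_(n+1)(t) = O(t) I_n(t), because
   the exponential weight lets the diffusion absorb the gradient of zeta; hence
   I_n(t) = O(t^n).  But u is flat at x0 to first order, so that on a ball of
   radius t^p the integrand is bounded below and I_n(t) is at least of order
   t^(p m). *)
Lemma no_interior_max : False.
Proof.
have [p [w [Cp [p0 w0 Cp0 phiP]]]] := phi_power_growth A1 A2 A3.
have [K [l [K0 l0 near0]]] := near_max_data w0.
pose N : set M := [set z | [/\ dom i z /\ V z, forall b, `|flux_dir g T i u z 0 b| <= K * gn u z,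
    l * gn u z ^+ 2 <= bil (tensor_in i T z) (chart_grad g i u z) (chart_grad g i u z),
    `|drift S g X u z| <= c / 2 /\ gn u z < w &
    u x0 - u z <= `|coord i z - coord i x0|]].
pose y0 := coord i x0.
have [r' r'0 bN] : exists2 r, 0 < r & box_in i (interior N) y0 r.
  by apply: box_in_exists => //; exact: open_interior.
have bV' : box_in i V y0 r'.
  by move=> y yr; have [iy /interior_subset[[_ Vy] _ _ _ _]] := bN _ yr.
pose r := r' / 2.
have r0 : 0 < r by rewrite divr_gt0.
have rr' : r < r' by rewrite ltr_pdivrMr// ltr_pMr// ltr1n.
have bV := box_in_le (ltW rr') bV'.
pose C := chart_box i y0 r.
have cC : compact C := compact_chart_box bV.
have clC : closed C := closed_compact S cC.
have mC : measurable (C : set (@borel M)) := measurable_compact S cC.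
have CV : C `<=` V := chart_box_sub bV.
have CN z : C z -> N z.
  move=> /(chart_boxP z bV)[iz zr].
  have [_ /interior_subset] := bN _ (le_trans zr (ltW rr')).
  by rewrite coordK.
pose zeta := chart_lift i (box_bump y0 r).
have zeta_out z : ~ C z -> zeta z = 0.
  by apply: (chart_lift_out bV) => y; exact: box_bump_out.
have Czeta : CkM S 1 setT zeta.
  by apply: (CkM_lift bV) => [y|]; [exact: box_bump_out|exact: Ck_box_bump].
have zeta0 z : 0 <= zeta z.
  by rewrite /zeta /chart_lift; case: pselect => // iz; exact: box_bump_ge0.
have zeta1 z : zeta z <= 1.
  by rewrite /zeta /chart_lift; case: pselect => // iz; exact: box_bump_le1.
have zetax0 : zeta x0 = 1 by rewrite /zeta chart_liftE// box_bump_center.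
have [D D0 DP] : exists2 D : R, 0 <= D & forall z b, C z -> `|dch i zeta z 0 b| <= D.
  pose F z := \sum_b `|dch i zeta z 0 b|.
  have cF : {within C, continuous F}.
    apply: continuous_in_subspaceT => z; rewrite inE => Cz.
    have [iz _] := (chart_boxP z bV).1 Cz.
    apply: continuous_at_sum => b; apply: continuous_at_norm.
    exact: (dch_continuous openT Czeta iz I).
  have [D [_ DP]] := compact_bounded (continuous_compact cF cC).
  exists (`|D| + 1) => [|z b Cz]; first by rewrite addr_ge0.
  have DD : D < `|D| + 1 by rewrite (le_lt_trans (ler_norm D))// ltrDl.
  have FC : [set F z | z in C] (F z) by exists z.
  have := DP _ DD _ FC; apply: le_trans; rewrite [leRHS]ger0_norm; last by rewrite /F sumr_ge0.
  by rewrite /F (bigD1 b)//= lerDl sumr_ge0.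
pose L := m%:R * (K * D).
have L0 : 0 <= L by rewrite !mulr_ge0// ltW.
pose k n := 2 * n.+1%:R * L * (Cp * (1 + 2 * n.+1%:R * L / l)).
have k0 n : 0 <= k n.
  have h1 : 0 <= 2 * n.+1%:R * L by apply: mulr_ge0 => //; apply: mulr_ge0.
  by rewrite mulr_ge0// mulr_ge0 ?(ltW Cp0)// addr_ge0// divr_ge0// ltW.
pose F n (t : R) z := zeta z ^+ (2 * n) * weight (t ^+ p) z.
have CF n t : CkM S 1 setT (F n t).
  exact: (CkMM openT (CkMX (2 * n) openT Czeta) (C1_weight (t ^+ p))).
have F0 n t z : 0 <= F n t z by rewrite mulr_ge0 ?exprn_ge0// expR_ge0.
have iF n t : vol.-integrable C (EFin \o F n t).
  apply: (integrable_compact gpos gC volg oV CV cC) => z _.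
  exact: (CkM_continuous (U := setT) I (CF n t)).
(* Half of c pays for the drift. The derivative of the weight yields the energy l phi(|grad u|)
   |grad u| / t^p, which by [absorption] (with lam = l, tau = t) controls the gradient of zeta up to
   k n t F n t. *)
have pw n t z : 0 < t -> C z ->
    - (weak_L S g A T X u (F n.+1 t) z + c * F n.+1 t z) <=
    k n * t * F n t z - c / 2 * F n.+1 t z.
  move=> t0 Cz; have [[iz Vz] fd ell [dr gw] _] := CN z Cz.
  have dF := C1M_diff (CF n.+1 t) I (dom_chart_at S z).
  rewrite (weak_L_chart gpos A T X iz (C1M_diff Cu I (dom_chart_at S z)) dF).
  have dz : diffM i zeta z := C1M_diff Czeta I iz.
  have dzn : diffM i (fun z => zeta z ^+ (2 * n).+2) z.
    exact: (C1M_diff (CkMX (2 * n).+2 openT Czeta) I iz).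
  have dw : diffM i (weight (t ^+ p)) z := C1M_diff (C1_weight (t ^+ p)) I iz.
  have FE : F n.+1 t = (fun z => zeta z ^+ (2 * n).+2 * weight (t ^+ p) z).
    by apply/funext => y; rewrite /F mulnS.
  pose h := weight (t ^+ p) z; have h0 : 0 < h by exact: expR_gt0.
  pose Z2 := zeta z ^+ (2 * n).+2; pose Z1 := zeta z ^+ (2 * n).+1.
  have dE b : dch i (F n.+1 t) z 0 b =
      Z2 * h / t ^+ p * dch i u z 0 b + h * (2 * n.+1%:R) * Z1 * dch i zeta z 0 b.
    rewrite FE (dch_mul iz dzn dw) (dch_exp _ iz dz) (dch_weight _ iz) !mxE -/h.
    have -> : (2 * n).+2%:R = 2 * n.+1%:R :> R by rewrite -natrM mulnS.
    by rewrite /Z2 /Z1; ring.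
  pose S1 := \sum_b flux g A T i u z 0 b * dch i u z 0 b.
  pose S2 := \sum_b flux g A T i u z 0 b * dch i zeta z 0 b.
  have sE : \sum_b flux g A T i u z 0 b * dch i (F n.+1 t) z 0 b =
      Z2 * h / t ^+ p * S1 + h * (2 * n.+1%:R) * Z1 * S2.
    rewrite /S1 /S2 !mulr_sumr -big_split /=; apply: eq_bigr => b _.
    by rewrite dE; ring.
  have s1 : l * phi A (gn u z) * gn u z <= S1 := flux_dot_grad_ge l0 fd ell.
  have s2 : `|S2| <= phi A (gn u z) * L := flux_dot_le (ltW K0) fd (fun b => DP z b Cz).
  have FnE : F n.+1 t z = Z2 * h by rewrite FE.
  have Fn0 : F n t z = zeta z ^+ (2 * n) * h by [].
  rewrite sE FnE Fn0.
  pose ph := phi A (gn u z); rewrite -/ph in s1 s2.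
  have gn0 := gnorm_ge0 g z (gradient S g u z).
  have ph0 : 0 <= ph by exact: phi_ge0.
  have php : ph ^+ p <= Cp ^+ p * gn u z.
    move: gn0; rewrite le_eqVlt => /orP[/eqP e0|n0]; last exact: phiP.
    by rewrite /ph -e0 /phi mul0r expr0n gtn_eqF// mulr0.
  have ab := absorption n gn0 (zeta0 z) (zeta1 z) p0 t0 ph0 l0 L0 (ltW Cp0) php.
  have drz : - (c / 2) <= drift S g X u z by move: dr; rewrite ler_norml => /andP[].
  have s2' : - (ph * L) <= S2 by move: s2; rewrite ler_norml => /andP[].
  have Z20 : 0 <= Z2 by rewrite exprn_ge0.
  have Z10 : 0 <= Z1 by rewrite exprn_ge0.
  have tp0 : 0 < t ^+ p by rewrite exprn_gt0.
  have h0' := ltW h0; have tp0' := ltW tp0.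
  have n0 : 0 <= 2 * n.+1%:R :> R by rewrite mulr_ge0.
  have e1 : Z2 * h / t ^+ p * (l * ph * gn u z) <= Z2 * h / t ^+ p * S1.
    by rewrite ler_wpM2l// divr_ge0// mulr_ge0.
  have e2 : h * (2 * n.+1%:R) * Z1 * - (ph * L) <= h * (2 * n.+1%:R) * Z1 * S2.
    by rewrite ler_wpM2l// mulr_ge0// mulr_ge0.
  have e3 : - (c / 2) * (Z2 * h) <= drift S g X u z * (Z2 * h).
    by rewrite ler_wpM2r// mulr_ge0.
  have e4 := ler_wpM2l h0' ab.
  rewrite -/Z2 -/Z1 -/(k n) in e4.
  have E1 : h * (2 * n.+1%:R * L * Z1 * ph) = - (h * (2 * n.+1%:R) * Z1 * - (ph * L)) by ring.
  have E2 : h * (Z2 * (l * ph * gn u z / t ^+ p) + k n * t * zeta z ^+ (2 * n)) =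
      Z2 * h / t ^+ p * (l * ph * gn u z) + k n * t * (zeta z ^+ (2 * n) * h) by ring.
  rewrite E1 E2 in e4.
  move: e1 e2 e3 e4; generalize (Z2 * h / t ^+ p * S1) (h * (2 * n.+1%:R) * Z1 * S2)
    (Z2 * h / t ^+ p * (l * ph * gn u z)) (h * (2 * n.+1%:R) * Z1 * - (ph * L))
    (k n * t * (zeta z ^+ (2 * n) * h)) (Z2 * h) => a1 a2 b1 b2 b4 b5 e1 e2 e3 e4.
  lra.
pose IF n t := \int[vol]_(z in C) F n t z.
have step n t : 0 < t -> c / 2 * IF n.+1 t <= k n * t * IF n t.
  move=> t0.
  pose xi z := zeta z ^+ n.+1 * weight (2 * t ^+ p) z.
  have Cxi : CkM S 1 setT xi.
    exact: (CkMM openT (CkMX n.+1 openT Czeta) (C1_weight (2 * t ^+ p))).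
  have xiE : (fun z => xi z ^+ 2) = F n.+1 t.
    by apply/funext => z; rewrite /xi /F exprMn weight_sqr -exprM mulnC.
  have xi0 z : ~ C z -> xi z = 0 by move=> nCz; rewrite /xi zeta_out// expr0n mul0r.
  have Fout z : ~ C z -> F n.+1 t z = 0.
    by move=> nCz; rewrite /F zeta_out// expr0n mul0r.
  pose P psi x := - (weak_L S g A T X u psi x + c * psi x).
  have FP : first_order S V P := first_order_strict.
  have LP : weakly_nonneg S vol V P := Lu.
  have := weakly_nonneg_sqr_box gpos gC volg oV FP LP bV' r0 rr' Cxi xi0.
  rewrite xiE (first_order_support vol FP clC CV (CF _ _) Fout) => H.
  have iZ a n' : vol.-integrable C (EFin \o (fun z => a * F n' t z)).
    exact: (integrableZl mC a (iF n' t)).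
  have iD : vol.-integrable C (EFin \o (fun z => k n * t * F n t z - c / 2 * F n.+1 t z)).
    exact: (integrableB mC (iZ (k n * t) n) (iZ (c / 2) n.+1)).
  have : 0 <= \int[vol]_(z in C) (k n * t * F n t z - c / 2 * F n.+1 t z).
    apply: fine_ge0; apply: le_trans H _; apply: le_integral => //.
      apply: (integrable_compact gpos gC volg oV CV cC) => z Vz.
      exact: (first_order_continuous FP Vz (CF _ _) oV).
    by move=> z; rewrite inE => Cz; rewrite lee_fin pw.
  by rewrite RintegralB// !RintegralZl// subr_ge0.
have upper n : exists2 B : R, 0 <= B & forall t, 0 < t -> IF n t <= B * t ^+ n.
  elim: n => [|n [B B0 HB]].
    exists (fine (vol C)) => [|t t0]; first exact: fine_ge0.
    rewrite expr0 mulr1 -[leRHS]mul1r -(Rintegral_cst vol mC 1) le_Rintegral//.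
      by apply: (integrable_compact gpos gC volg oV CV cC) => z _; exact: cst_continuous.
    move=> z Cz; rewrite /F muln0 expr0 mul1r /weight -expR0 ler_expR.
    by rewrite pmulr_lle0 ?invr_gt0 ?exprn_gt0// subr_le0; exact/umax/CV.
  exists (2 / c * (k n * B)); first by rewrite mulr_ge0 ?divr_ge0 ?(ltW c0)// mulr_ge0.
  move=> t t0; have := step n t t0.
  have c2 : 0 < c / 2 by rewrite divr_gt0.
  rewrite -ler_pdivlMl// => /le_trans; apply.
  have -> : (c / 2)^-1 = 2 / c by rewrite invf_div.
  have -> : 2 / c * (k n * B) * t ^+ n.+1 = 2 / c * (k n * t * (B * t ^+ n)) by rewrite exprS; ring.
  have kt0 : 0 <= k n * t by apply: mulr_ge0 => //; exact: ltW.
  have c20 : 0 <= 2 / c by rewrite divr_ge0// ltW.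
  exact: (ler_wpM2l c20 (ler_wpM2l kt0 (HB t t0))).
have [rv [kv [Kv [rv0 kv0 volb]]]] := chart_ball_volume gpos gC volg ix0.
have [rz rz0 zetaP] : exists2 rz, 0 < rz &
    forall z, dom i z -> `|coord i z - y0| <= rz -> 1 / 2 <= zeta z.
  have oz : open [set z | 1 / 2 < zeta z].
    rewrite openE => z zz; have cz : {for z, continuous zeta} := CkM_continuous (U := setT) I Czeta.
    exact: (cz _ (open_near (@open_gt _ (1 / 2)) zz)).
  have z12 : 1 / 2 < zeta x0 by rewrite zetax0 ltr_pdivrMr// mul1r ltr1n.
  have [rz rz0 bz] := box_in_exists oz z12 ix0.
  exists rz => // z iz zr; have [_] := bz _ zr; rewrite coordK// => /ltW; exact.
pose t0 := Num.min 1 (Num.min (r / 2) (Num.min rv rz)).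
have t00 : 0 < t0 by rewrite !lt_min ltr01 rv0 rz0 divr_gt0.
(* One more than the exponent p m of t in the volume of the ball of radius t^p, so that the upper
   bound is of smaller order than the lower one. *)
pose n := (p * m).+1.
have [B B0 HB] := upper n.
(* A lower bound of the integrand on the ball of radius s = t^p: the cutoff is at least 1/2 there,
   and u(x0) - u <= s keeps the weight above exp(-1). *)
pose q := (1 / 2) ^+ (2 * n) * expR (- 1) : R.
have q0 : 0 < q by rewrite mulr_gt0 ?expR_gt0 ?exprn_gt0.
suff : q * kv <= 0 by rewrite leNgt mulr_gt0.
apply: (nonpos_of_small t00 B0) => t tp; rewrite !le_min => /and4P[t1 tr tv tz].
pose s := t ^+ p; have s0 : 0 < s by rewrite exprn_gt0.
have st : s <= t by rewrite -[leRHS]expr1 ler_wiXn2l// ltW.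
pose Bl := chart_ball i y0 s.
have mB : measurable (Bl : set (@borel M)) by apply: measurable_open; exact: open_chart_ball.
have sr : s <= r by rewrite (le_trans st)// (le_trans tr)// ler_pdivrMr// ler_pMr// ler1n.
have BC : Bl `<=` C.
  by move=> z [iz zs]; apply/(chart_boxP z bV); split => //; exact: le_trans (ltW zs) sr.
have low z : Bl z -> q <= F n t z.
  move=> Bz; have [iz zs] := Bz; have [_ _ _ _ ul] := CN _ (BC _ Bz).
  rewrite /F ler_pM ?exprn_ge0 ?expR_ge0//.
    rewrite lerXn2r// ?nnegrE//; apply: zetaP => //.
    by rewrite (le_trans (ltW zs))// (le_trans st).
  rewrite /weight ler_expR -/s ler_pdivlMr// mulN1r lerNl opprB.
  by rewrite (le_trans ul)// ltW.
have svol := volb s s0 (le_trans st tv).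
have : (q%:E * (kv * s ^+ m)%:E <= (IF n t)%:E)%E.
  have -> : (IF n t)%:E = (\int[vol]_(z in C) (F n t z)%:E)%E.
    by rewrite fineK//; exact: (integrable_fin_num mC (iF n t)).
  have /integrableP[mF _] := iF n t.
  apply: le_trans (ge0_subset_integral vol mB mC mF _ BC); last first.
    by move=> z _; rewrite lee_fin F0.
  apply: (@le_trans _ _ (q%:E * vol Bl)%E).
    by rewrite lee_pmul2l// ?lte_fin//; have /andP[] := svol.
  rewrite -(integral_cst vol mB); apply: ge0_le_integral => //.
  - by move=> z _; rewrite lee_fin ltW.
  - exact: (measurable_funS mC BC mF).
rewrite -EFinM lee_fin => /le_trans /(_ (HB t tp)).
have tpm : 0 < t ^+ (p * m) by rewrite exprn_gt0.
have -> : q * (kv * s ^+ m) = q * kv * t ^+ (p * m) by rewrite /s -exprM; ring.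
have -> : B * t ^+ n = B * t * t ^+ (p * m) by rewrite /n exprS; ring.
by rewrite ler_pM2r.
Qed.

End StrictSubsolution.

(** * Comparison of a subsolution with a supersolution *)

Section Monotonicity.
Context {R : realType} {m : nat} {M : ptopologicalType}.
Variables (g : M -> 'M[R]_m) (A : R -> R) (T : M -> 'M[R]_m).
Hypotheses (gpos : forall x, pos_def (g x)) (Tpos : forall x, pos_def (T x)).
Hypotheses (A1 : assumption_A1 A) (A2 : assumption_A2 A) (T2 : assumption_T2 g A T).

Lemma gnorm_gt0 x v : v != 0 -> 0 < gnorm g x v.
Proof. by move=> v0; rewrite sqrtr_gt0; have [_] := gpos x; apply. Qed.

Lemma A_gt0 t : 0 < t -> 0 < A t.
Proof. by move=> t0; have := phi_gt0 A1 A2 t0; rewrite /phi pmulr_rgt0. Qed.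

(** A is known to be positive only away from 0; if s = 0 or v = 0, another factor vanishes. *)
Lemma scaled_A_ge0 x s v : 0 <= s -> 0 <= s * A (gnorm g x (s *: v)) * bil (T x) v v.
Proof.
rewrite le_eqVlt => /orP[/eqP<-|s0]; first by rewrite !mul0r.
have [->|v0] := eqVneq v 0; first by rewrite bil0l mulr0.
rewrite mulr_ge0 ?pos_def_ge0// mulr_ge0 ?(ltW s0)//; apply/ltW/A_gt0/gnorm_gt0.
by rewrite scaler_eq0 negb_or gt_eqF.
Qed.

Lemma gnormN x v : gnorm g x (- v) = gnorm g x v.
Proof. by rewrite /gnorm bilNl bilNr opprK. Qed.

Lemma is_derive_flux_segment x (eta v : 'rV[R]_m) (t : R) : eta + t *: v != 0 ->
  is_derive t (1 : R) (fun t : R => A (gnorm g x (eta + t *: v)) * bil (T x) (eta + t *: v) v)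
    (T2_form g A T x (eta + t *: v) v v).
Proof.
move=> p0; set p := eta + t *: v.
have gT : (g x)^T = g x by have [] := gpos x.
pose a := bil (g x) eta eta; pose b := bil (g x) eta v; pose c := bil (g x) v v.
pose Q (s : R) := a + s * (2 * b) + s * (s * c).
have QE s : Q s = bil (g x) (eta + s *: v) (eta + s *: v).
  by rewrite /Q !(bilDl, bilDr, bilZl, bilZr) (bilC v eta gT) -/a -/b -/c; ring.
pose d := bil (T x) eta v; pose e := bil (T x) v v.
have nQ : gnorm g x p = Num.sqrt (Q t) by rewrite /gnorm QE.
have Q0 : 0 < Q t by rewrite QE; have [_] := gpos x; apply.
have dQ : is_derive t (1 : R) Q (2 * bil (g x) p v).
  have h1 := is_deriveM (is_derive_id t (1 : R)) (is_derive_cst (2 * b) t (1 : R)).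
  have h0 := is_deriveM (is_derive_id t (1 : R)) (is_derive_cst c t (1 : R)).
  have h2 := is_deriveM (is_derive_id t (1 : R)) h0.
  have h3 := is_deriveD (is_deriveD (is_derive_cst a t (1 : R)) h1) h2.
  apply: (is_derive_eq h3); rewrite /p bilDl bilZl -/b -/c.
  rewrite /= !scaler0 !add0r /GRing.scale /=.
  have -> : (id * cst c) t = t * c by [].
  ring.
have n0 : 0 < Num.sqrt (Q t) by rewrite sqrtr_gt0.
have dn : is_derive t (1 : R) (fun s => Num.sqrt (Q s)) (bil (g x) p v / gnorm g x p).
  have h := @is_derive1_comp _ Num.sqrt Q _ _ _ (is_derive1_sqrt Q0) dQ.
  apply: (is_derive_eq h); rewrite nQ; field; exact: lt0r_neq0.
have dA : is_derive (Num.sqrt (Q t)) (1 : R) A (derive1 A (gnorm g x p)).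
  rewrite -nQ derive1E; have n1 : 0 < gnorm g x p by rewrite nQ.
  by have [dA0 _] := A1 n1; exact: (derivableP dA0).
have dAn := @is_derive1_comp _ A (fun s => Num.sqrt (Q s)) _ _ _ dA dn.
have dl : is_derive t (1 : R) (fun s : R => d + s * e) e.
  have h1 := is_deriveM (is_derive_id t (1 : R)) (is_derive_cst e t (1 : R)).
  have h3 := is_deriveD (is_derive_cst d t (1 : R)) h1.
  by apply: (is_derive_eq h3); rewrite /= scaler0 !add0r /GRing.scale /= mulr1.
have H := is_deriveM dAn dl.
have -> : (fun t : R => A (gnorm g x (eta + t *: v)) * bil (T x) (eta + t *: v) v) =
    (A \o (fun s => Num.sqrt (Q s))) * (fun s : R => d + s * e).
  apply/funext => s; rewrite [RHS]/= /gnorm -QE bilDl bilZl -/d -/e; reflexivity.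
apply: (is_derive_eq H).
rewrite /T2_form /sym_prod /= -nQ /p !bilDl !bilZl -/b -/c -/d -/e -/p.
rewrite /GRing.scale /=.
field; rewrite nQ; exact: lt0r_neq0.
Qed.

Lemma flux_monotone x (xi eta : 'rV[R]_m) :
  0 <= bil (T x) (A (gnorm g x xi) *: xi - A (gnorm g x eta) *: eta) (xi - eta).
Proof.
set v := xi - eta; have xiE : xi = eta + 1 *: v by rewrite scale1r addrC subrK.
pose h (t : R) := A (gnorm g x (eta + t *: v)) * bil (T x) (eta + t *: v) v.
have -> : bil (T x) (A (gnorm g x xi) *: xi - A (gnorm g x eta) *: eta) v = h 1 - h 0.
  by rewrite /h -xiE scale0r addr0 bilBl !bilZl.
have [p0|] := pselect (forall t : R, t \in `[0, 1] -> eta + t *: v != 0).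
  have dh (t : R) : t \in `[0, 1] -> is_derive t (1 : R) h (T2_form g A T x (eta + t *: v) v v).
    by move=> /p0 pt; exact: is_derive_flux_segment.
  have ch : {within `[0, 1], continuous h}.
    apply: continuous_in_subspaceT => t; rewrite inE => t01.
    have dt := dh t t01.
    by apply: differentiable_continuous; apply/derivable1_diffP.
  have sub (t : R) : t \in `]0, 1[ -> t \in `[0, 1] := @subset_itv_oo_cc _ _ 0 1 t.
  have [t t01 ->] := MVT (@ltr01 R) (fun t t01 => dh t (sub t t01)) ch.
  rewrite subr0 mulr1.
  have [->|v0] := eqVneq v 0; last by apply/ltW; have [_] := T2 x (p0 _ (sub t t01)); apply.
  by rewrite /T2_form /sym_prod !(bil0r, mulr0, mul0r, addr0).
(* The segment meets the origin, where (T2) gives nothing. Then xi = (1 - t) v and eta = - t v, and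
   each of the two terms is nonnegative by itself. *)
move=> /existsNP[t /not_implyP[]]; rewrite in_itv /= => /andP[t0 t1] /negP/negPn/eqP pt0.
have etaE : eta = - (t *: v) by apply/eqP; rewrite -addr_eq0 pt0.
have xiE' : eta + 1 *: v = (1 - t) *: v by rewrite {1}etaE scalerBl addrC.
have s1 : 0 <= 1 - t by rewrite subr_ge0.
rewrite /h xiE' scale0r addr0 {1 2}etaE gnormN bilNl !bilZl.
have := scaled_A_ge0 x v s1; have := scaled_A_ge0 x v t0.
lra.
Qed.

End Monotonicity.

Section Comparison.
Context {R : realType} {m : nat} {M : ptopologicalType} (S : manifold R m M).
Implicit Types (i j : chart S) (U V W C N : set M) (x : M) (f psi : M -> R).
Variables (g : M -> 'M[R]_m) (A : R -> R) (T : M -> 'M[R]_m) (X : M -> 'rV[R]_m).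
Variable vol : {measure set (@borel M) -> \bar R}.
Hypotheses (gpos : forall x, pos_def (g x)) (gC : Ck_tensor_field S 0 g).
Hypothesis volg : riemannian_volume S g vol.

(** By continuity F stays below half of its negative value at x0 on a small chart ball, which has
    positive volume. *)
Lemma integral_lt0 V C N (F : M -> R) x0 : open V -> compact C -> C `<=` V -> open N -> N `<=` C -> N x0 ->
  (forall x, V x -> {for x, continuous F}) -> (forall x, C x -> F x <= 0) -> F x0 < 0 ->
  (\int[vol]_(x in C) (F x)%:E < 0)%E.
Proof.
move=> oV cC CV oN NC Nx0 cF F0 Fx0.
have mC : measurable (C : set (@borel M)) := measurable_compact S cC.
have iF : vol.-integrable C (EFin \o F) := integrable_compact gpos gC volg oV CV cC cF.
pose c := - F x0 / 2; have c0 : 0 < c by rewrite divr_gt0 ?oppr_gt0.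
have nN : \forall z \near x0, N z /\ F z < - c.
  apply: filterI (open_near oN Nx0) _.
  have Fc : F x0 < - c by rewrite /c mulNr opprK; lra.
  exact: (cF _ (CV _ (NC _ Nx0)) _ (open_near (@open_lt _ (- c)) Fc)).
have ix0 := dom_chart_at S x0; set i := chart_at S x0 in ix0.
have oI : open (interior [set z | N z /\ F z < - c]) by exact: open_interior.
have [r1 r10 bN] := box_in_exists oI nN ix0.
have [r2 [kv [Kv [r20 kv0 volb]]]] := chart_ball_volume gpos gC volg ix0.
pose r := Num.min r1 r2; have r0 : 0 < r by rewrite lt_min r10.
have [rr1 rr2] : r <= r1 /\ r <= r2 by rewrite !ge_min !lexx orbT.
pose B := chart_ball i (coord i x0) r.
have mB : measurable (B : set (@borel M)) by apply: measurable_open; exact: open_chart_ball.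
have BN z : B z -> N z /\ F z < - c.
  move=> [iz zr]; have [_] := bN _ (le_trans (ltW zr) rr1).
  by rewrite coordK// => /interior_subset.
have BC : B `<=` C by move=> z /BN[/NC].
have cFN x : V x -> {for x, continuous (fun x => - F x)} by move=> /cF; exact: continuousN.
have /integrableP[mN _] : vol.-integrable C (EFin \o (fun x => - F x)).
  exact: (integrable_compact gpos gC volg oV CV cC cFN).
have : (0 < \int[vol]_(x in C) (- F x)%:E)%E.
  apply: lt_le_trans (ge0_subset_integral vol mB mC mN _ BC); last first.
    by move=> z Cz; rewrite lee_fin oppr_ge0 F0.
  apply: (@lt_le_trans _ _ (c%:E * vol B)%E).
    rewrite mule_gt0 ?lte_fin//; have /andP[vB _] := volb r r0 rr2.
    by apply: lt_le_trans vB; rewrite lte_fin mulr_gt0// exprn_gt0.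
  rewrite -(integral_cst vol mB); apply: ge0_le_integral => //.
  - by move=> z _; rewrite lee_fin ltW.
  - exact: (measurable_funS mC BC mN).
  - by move=> z /BN[_ Fz]; rewrite lee_fin lerNr ltW.
have -> : (\int[vol]_(x in C) (- F x)%:E = - \int[vol]_(x in C) (F x)%:E)%E.
  rewrite -integralN; first by apply: eq_integral => x _; rewrite EFinN.
  exact: integrable_add_def iF.
by rewrite oppe_gt0.
Qed.

Hypotheses (A1 : assumption_A1 A) (A2 : assumption_A2 A) (T2 : assumption_T2 g A T).
Hypotheses (TC : Ck_tensor_field S 0 T) (Tpos : forall x, pos_def (T x)).
Hypothesis XC : Ck_vector_field S 0 X.

(** When grad psi is a nonnegative multiple of grad u - grad gam, the diffusion part of the
    difference is nonnegative by [flux_monotone], and only the drift remains. *)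
Lemma weak_LB_ge0 u gam psi x (k : R) : 0 <= k ->
  gradient S g psi x = k *: (gradient S g u x - gradient S g gam x) ->
  bil (g x) (X x) (gradient S g u x - gradient S g gam x) * psi x <=
  weak_L S g A T X u psi x - weak_L S g A T X gam psi x.
Proof.
move=> k0 E; rewrite /weak_L E; move: (psi x) => p {E}.
move: (gradient S g u x) (gradient S g gam x) => v w.
have := mulr_ge0 k0 (flux_monotone gpos Tpos A1 A2 T2 x v w).
move: (A (gnorm g x v)) (A (gnorm g x w)) (T x) (X x) (g x) => a b B y G.
rewrite bilBl !bilZl !bilZr !bilBr -subr_ge0 => H; rewrite -subr_ge0.
apply: le_trans H _; rewrite le_eqVlt; apply/orP; left.
move: (bil B v v) (bil B v w) (bil B w v) (bil B w w) (bil G y v) (bil G y w) => s1 s2 s3 s4 c d.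
by apply/eqP; ring.
Qed.

Lemma gradientB U u gam x : CkM S 1 U u -> CkM S 1 U gam -> U x ->
  gradient S g (fun z => u z - gam z) x = gradient S g u x - gradient S g gam x.
Proof.
move=> Cu Cgam Ux; have ix := dom_chart_at S x.
have du : diffM (chart_at S x) u x := C1M_diff Cu Ux ix.
have dg : diffM (chart_at S x) gam x := C1M_diff Cgam Ux ix.
rewrite /gradient -mulmxBl; congr (_ *m _); apply/rowP => c; rewrite !mxE.
have -> : (fun z => u z - gam z) \o param (chart_at S x) =
  (u \o param (chart_at S x)) - (gam \o param (chart_at S x)) by apply/funext.
by rewrite deriveB//; apply: diff_derivable.
Qed.

Lemma gradient_comp1 h d f x : diffM (chart_at S x) f x ->
  is_derive (f x) (1 : R) h d -> gradient S g (h \o f) x = d *: gradient S g f x.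
Proof.
move=> df dh; have E := dch_comp1 (dom_chart_at S x) df dh.
by rewrite /gradient scalemxAl -E.
Qed.

Lemma gradient_near u gam x : (\forall z \near x, u z = gam z) ->
  gradient S g u x = gradient S g gam x.
Proof.
move=> E; congr (_ *m _); apply/rowP => c; rewrite !mxE; apply: near_eq_derive.
have ix := dom_chart_at S x.
have cj : {for coord (chart_at S x) x, continuous (param (chart_at S x))}.
  by apply: param_continuous; exact: codomain_coord.
have n0 : nbhs (param (chart_at S x) (coord (chart_at S x) x)) [set z | u z = gam z].
  by rewrite coordK.
exact: (cj _ n0).
Qed.

Section ComparisonPrinciple.
Variables (V C : set M) (u gam b : M -> R) (tau0 : R) (x3 : M).
Hypotheses (oV : open V) (cC : compact C) (CV : C `<=` V).
Hypotheses (Cu : CkM S 1 V u) (Cgam : CkM S 1 V gam).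
Hypotheses (bC : forall x, V x -> {for x, continuous b}) (b0 : forall x, V x -> 0 < b x).
Hypothesis outC : forall x, V x -> ~ C x -> u x - gam x <= tau0.
Hypotheses (Vx3 : V x3) (fx3 : tau0 < u x3 - gam x3).
Hypothesis Lnn : weakly_nonneg S vol V
  (fun psi x => - (weak_L S g A T X u psi x - weak_L S g A T X gam psi x + b x * psi x)).

Let f x := u x - gam x.
Let Y x := drift S g X u x - drift S g X gam x.

Let Cf : CkM S 1 V f := CkMB oV Cu Cgam.

Let Y_continuous x : V x -> {for x, continuous Y}.
Proof.
move=> Vx; apply: continuousB; exact: (drift_continuous gpos gC XC oV _ Vx).
Qed.

Let Y0_at_max x : V x -> (forall z, V z -> f z <= f x) -> Y x = 0.
Proof.
move=> Vx fx; rewrite /Y /drift -bilBr -(gradientB Cu Cgam Vx).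
have ix := dom_chart_at S x.
have d0 := dch_at_max oV Vx ix Cf fx.
by rewrite (gradient_eq0 gpos (C1M_diff Cf Vx ix) d0) bil0r.
Qed.

Lemma open_level_abs_lt : open (V `&` [set x | `|Y x| < b x]).
Proof.
rewrite openE => x [Vx Yb]; apply: (filterI (open_near oV Vx)).
have cY : {for x, continuous (fun z => `|Y z| - b z)}.
  by apply: continuousB (bC Vx); exact: (continuous_at_norm (Y_continuous Vx)).
have Yb0 : `|Y x| - b x < 0 by rewrite subr_lt0.
have nY : \forall z \near x, `|Y z| - b z < 0 by exact: (cY _ (open_near (@open_lt _ 0) Yb0)).
by apply: filterS nY => z /=; rewrite subr_lt0.
Qed.

Lemma near_max_threshold : exists2 x1, C x1 /\ (forall z, V z -> f z <= f x1) &
  exists tau, [/\ tau0 < tau, tau < f x1 & forall z, C z -> tau <= f z -> `|Y z| < b z].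
Proof.
have Cx3 : C x3 by apply: contrapT => /(outC Vx3); rewrite leNgt fx3.
have cf : {within C, continuous f}.
  apply: continuous_in_subspaceT => z; rewrite inE => /CV Vz.
  exact: (CkM_continuous Vz Cf).
have [x1] := @compact_EVT_max _ _ f C (ex_intro _ _ Cx3) cC cf.
rewrite inE => Cx1 x1max0.
have x1max z : C z -> f z <= f x1 by move=> Cz; apply: x1max0; rewrite inE.
have fx1 : tau0 < f x1 by apply: lt_le_trans fx3 (x1max _ Cx3).
have x1V z : V z -> f z <= f x1.
  move=> Vz; have [/x1max//|nC] := pselect (C z).
  by apply: ltW; apply: le_lt_trans (outC Vz nC) fx1.
exists x1 => //.
(* The compact set where the drift is not dominated by b. It contains no maximum point of f, as Y
   vanishes at such points. *)
pose B := C `&` ~` (V `&` [set x | `|Y x| < b x]).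
have cB : compact B.
  apply: (subclosed_compact _ cC); last by move=> z [].
  apply: closedI; first exact: (closed_compact S cC).
  exact: open_closedC open_level_abs_lt.
have [[z0 Bz0]|B0] := pselect (exists z, B z); last first.
  exists ((tau0 + f x1) / 2); split; [lra|lra|] => z Cz _.
  apply: contrapT => nz; apply: B0; exists z; split => // -[_]; exact: nz.
have cfB : {within B, continuous f}.
  apply: continuous_in_subspaceT => z; rewrite inE => -[/CV Vz _].
  exact: (CkM_continuous Vz Cf).
have [z1] := @compact_EVT_max _ _ f B (ex_intro _ _ Bz0) cB cfB.
rewrite inE => -[Cz1 nz1] z1max.
have fz1 : f z1 < f x1.
  rewrite ltNge; apply/negP => fz1; apply: nz1; split; first exact: CV.
  rewrite /= Y0_at_max ?normr0//; first by apply/b0/CV.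
    exact: CV.
  by move=> z /x1V fz; exact: le_trans fz fz1.
(* The threshold lies strictly between the maximum of f over B and its overall maximum, so that {f
   >= tau} avoids B. *)
exists ((Num.max tau0 (f z1) + f x1) / 2).
have mx : Num.max tau0 (f z1) < f x1 by rewrite gt_max fx1.
have mx0 : tau0 <= Num.max tau0 (f z1) by rewrite le_max lexx.
have mx1 : f z1 <= Num.max tau0 (f z1) by rewrite le_max lexx orbT.
split; [lra|lra|] => z Cz tz; apply: contrapT => nz.
have Bz : B z by split => // -[_]; exact: nz.
have := z1max z; rewrite inE => /(_ Bz); lra.
Qed.

Lemma comparison_principle : False.
Proof.
have [x1 [Cx1 x1V] [tau [t0 t1 tP]]] := near_max_threshold.
(* A C^1 function vanishing exactly for t <= tau, with h' >= 0: the gradient of h(f)^2 is 2 h h'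
   grad f, a nonnegative multiple as [weak_LB_ge0] demands. *)
pose h (t : R) := flat 0 (t - tau).
have dtau (t : R) : is_derive t (1 : R) (fun t : R => t - tau) 1.
  apply: (is_derive_eq (is_deriveB (is_derive_id t (1 : R)) (is_derive_cst tau t (1 : R)))).
  by rewrite subr0.
have dh (t : R) : is_derive t (1 : R) h (flat 2 (t - tau)).
  have H := @is_derive1_comp _ (flat 0) (fun t => t - tau) _ _ _ (is_derive_flat 0 _) (dtau t).
  by apply: (is_derive_eq H); rewrite mul0r subr0 mulr1.
have ch' : continuous (fun t : R => flat 2 (t - tau)).
  move=> t; apply: (@continuous_comp _ _ _ (fun t => t - tau) (flat 2)); last exact: continuous_flat.
  by apply: continuousB; [exact: cvg_id|exact: cst_continuous].
pose xi z := if pselect (V z) then h (f z) else 0.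
(* The extension by 0 is of class C^1 because f <= tau0 < tau on V outside the compact set C. *)
have xiV z : V z -> xi z = h (f z) by rewrite /xi; case: pselect.
have xi0 z : ~ C z -> xi z = 0.
  rewrite /xi; case: pselect => // Vz nC; apply: flat_le0.
  by rewrite subr_le0; apply: le_trans (outC Vz nC) (ltW t0).
have oC : open (~` C) by apply: closed_openC; exact: (closed_compact S cC).
have Cxi : CkM S 1 setT xi.
  apply: CkM_loc => z _; have [Cz|nCz] := pselect (C z).
    exists V; first by split => //; exact: CV.
    have Ch : CkM S 1 V (h \o f).
      exact: (C1M_comp1 (h' := fun t => flat 2 (t - tau)) oV (fun x _ => dh (f x)) (fun x _ => ch' (f x)) Cf).
    by apply: (CkM_eq oV _ Ch) => y Vy; rewrite xiV.
  exists (~` C) => //.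
  by apply: (CkM_eq oC _ (CkM_cst 1 (~` C) 0)) => y nCy; rewrite xi0.
pose psi z := xi z ^+ 2.
have Cpsi : CkM S 1 setT psi := CkMX 2 openT Cxi.
pose P psi x := - (weak_L S g A T X u psi x - weak_L S g A T X gam psi x + b x * psi x).
have FP : first_order S V P.
  apply: first_orderN; apply: first_orderD0 => //.
  apply: first_orderB; first exact: (first_order_weak_L gpos gC A1 A2 TC XC oV Cu).
  exact: (first_order_weak_L gpos gC A1 A2 TC XC oV Cgam).
have := weakly_nonneg_sqr gpos gC volg oV FP Lnn cC CV Cxi xi0.
rewrite (first_order_support vol FP (closed_compact S cC) CV Cpsi); last first.
  by move=> z /xi0 E; rewrite /psi E expr0n.
have psi_le z : C z -> P psi z <= - ((Y z + b z) * psi z).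
  move=> /CV Vz; rewrite /P lerN2 mulrDl lerD2r.
  have h0 : 0 <= h (f z) := flat_ge0 _ _.
  pose k := h (f z) * flat 2 (f z - tau) + h (f z) * flat 2 (f z - tau).
  have k0 : 0 <= k by rewrite addr_ge0// mulr_ge0// flat_ge0.
  have gE : gradient S g psi z = k *: (gradient S g u z - gradient S g gam z).
    have -> : gradient S g psi z = gradient S g ((fun t => h t * h t) \o f) z.
      apply: gradient_near; apply: filterS (open_near oV Vz) => y Vy.
      by rewrite /psi xiV// expr2.
    have df : diffM (chart_at S z) f z := C1M_diff Cf Vz (dom_chart_at S z).
    have dhh := is_deriveM (dh (f z)) (dh (f z)).
    by rewrite (gradient_comp1 df dhh) -(gradientB Cu Cgam Vz).
  by have := weak_LB_ge0 k0 gE; rewrite bilBr.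
have strict z : C z -> tau < f z -> P psi z < 0.
  move=> Cz tz; apply: le_lt_trans (psi_le z Cz) _; rewrite oppr_lt0.
  have := tP z Cz (ltW tz); rewrite ltr_norml => /andP[Yb _].
  rewrite mulr_gt0//; first by rewrite -ltrBlDr sub0r.
  by rewrite /psi xiV ?exprn_gt0 ?flat_gt0 ?subr_gt0//; exact: CV.
pose N := V `&` [set z | tau < f z].
have oN : open N.
  rewrite openE => z [Vz tz]; apply: (filterI (open_near oV Vz)).
  exact: (CkM_continuous Vz Cf (open_near (@open_gt _ tau) tz)).
have NC : N `<=` C.
  move=> z [Vz tz]; apply: contrapT => /(outC Vz); rewrite leNgt.
  by rewrite (lt_trans t0).
have Nx1 : N x1 by split => //; exact: CV.
apply/negP; rewrite -ltNge.
apply: (integral_lt0 oV cC CV oN NC Nx1) => [z Vz|z Cz|].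
- exact: (first_order_continuous FP Vz Cpsi oV).
- have [tz|tz] := ltP tau (f z); first by apply/ltW/strict.
  have hz : h (f z) = 0 by apply: flat_le0; rewrite subr_le0.
  have p0 : psi z = 0 by rewrite /psi (xiV z (CV Cz)) hz expr0n.
  by apply: le_trans (psi_le z Cz) _; rewrite p0 mulr0 oppr0.
- exact: strict.
Qed.

End ComparisonPrinciple.
End Comparison.

(** * Restricting and adding weak inequalities *)

Section WeakSubsolution.
Context {R : realType} {m : nat} {M : ptopologicalType} (S : manifold R m M).
Implicit Types (i j : chart S) (U V W C : set M) (x : M) (f psi : M -> R).
Variables (g : M -> 'M[R]_m) (A : R -> R) (T : M -> 'M[R]_m) (X : M -> 'rV[R]_m).
Variable vol : {measure set (@borel M) -> \bar R}.
Hypotheses (gpos : forall x, pos_def (g x)) (gC : Ck_tensor_field S 0 g).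
Hypothesis volg : riemannian_volume S g vol.

Lemma test_function_sub U V psi : V `<=` U -> test_function S V psi -> test_function S U psi.
Proof. by move=> VU [Cpsi cpsi sV]; split => //; exact: subset_trans VU. Qed.

Lemma test_function_out V psi x : test_function S V psi ->
  ~ closure [set x | psi x != 0] x -> psi x = 0.
Proof. by move=> _ nx; apply: contrapT => /eqP px; apply: nx; exact: subset_closure. Qed.

Lemma weakly_nonneg_sub U V P : V `<=` U -> first_order S U P ->
  weakly_nonneg S vol U P -> weakly_nonneg S vol V P.
Proof.
move=> VU FP nP psi tpsi psi0.
have tU := test_function_sub VU tpsi.
have [Cpsi cpsi sV] := tpsi; have out x := test_function_out (x := x) tpsi.
have cl : closed (closure [set x | psi x != 0]) := @closed_closure _ _.
have FPV : first_order S V P.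
  by move=> i; have [a [b H]] := FP i; exists a, b => x ix /VU Ux; exact: H.
rewrite (first_order_support vol FPV cl sV (Cpsi 1%N) out).
rewrite -(first_order_support vol FP cl (subset_trans sV VU) (Cpsi 1%N) out).
exact: nP.
Qed.

Lemma weakly_nonnegD V P Q : open V -> first_order S V P -> first_order S V Q ->
  weakly_nonneg S vol V P -> weakly_nonneg S vol V Q ->
  weakly_nonneg S vol V (fun psi x => P psi x + Q psi x).
Proof.
move=> oV FP FQ nP nQ psi tpsi psi0.
have [Cpsi cpsi sV] := tpsi; have out x := test_function_out (x := x) tpsi.
have cl : closed (closure [set x | psi x != 0]) := @closed_closure _ _.
set C := closure _ in cpsi sV cl out.
have HP := nP psi tpsi psi0; have HQ := nQ psi tpsi psi0.
rewrite (first_order_support vol FP cl sV (Cpsi 1%N) out) in HP.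
rewrite (first_order_support vol FQ cl sV (Cpsi 1%N) out) in HQ.
rewrite (@integral_eq_support _ _ vol V C) => [|//|x Vx nCx]; last first.
  have n0 := near_notin cl out nCx.
  by rewrite (first_order_near0 FP Vx (Cpsi 1%N) n0) (first_order_near0 FQ Vx (Cpsi 1%N) n0) addr0.
have mC : measurable (C : set (@borel M)) := measurable_compact S cpsi.
have iP : vol.-integrable C (EFin \o P psi).
  apply: (integrable_compact gpos gC volg oV sV cpsi) => x Vx.
  exact: (first_order_continuous FP Vx (Cpsi 1%N) oV).
have iQ : vol.-integrable C (EFin \o Q psi).
  apply: (integrable_compact gpos gC volg oV sV cpsi) => x Vx.
  exact: (first_order_continuous FQ Vx (Cpsi 1%N) oV).
under eq_integral do rewrite EFinD.
by rewrite (integralD mC iP iQ) adde_ge0.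
Qed.

Hypotheses (A1 : assumption_A1 A) (A2 : assumption_A2 A).
Hypotheses (TC : Ck_tensor_field S 0 T) (XC : Ck_vector_field S 0 X).

(** Replaces the extended-real density eps / q, possibly infinite, by a continuous real function c
    below it; the difference of the two sides is then the integral of a single first-order
    operator. *)
Lemma weak_subsolution_strict U V (u q c : M -> R) (eps : R) :
  open V -> V `<=` U -> CkM S 1 V u -> (forall x, V x -> {for x, continuous c}) ->
  (forall x, V x -> 0 <= c x) -> (forall x, V x -> ((c x)%:E <= eps%:E / (q x)%:E)%E) ->
  (forall psi, test_function S U psi -> (forall x, 0 <= psi x) ->
    (\int[vol]_(x in U) (eps%:E / (q x)%:E * (psi x)%:E) <=
     - \int[vol]_(x in U) (weak_L S g A T X u psi x)%:E)%E) ->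
  weakly_nonneg S vol V (fun psi x => - (weak_L S g A T X u psi x + c x * psi x)).
Proof.
move=> oV VU Cu cC c0 cq H psi tpsi psi0.
have tU := test_function_sub VU tpsi; have {H} := H psi tU psi0.
have [Cpsi cpsi sV] := tpsi; have out x := test_function_out (x := x) tpsi.
have cl : closed (closure [set x | psi x != 0]) := @closed_closure _ _.
set C := closure _ in cpsi sV cl out.
have mC : measurable (C : set (@borel M)) := measurable_compact S cpsi.
have CU := subset_trans sV VU.
pose P := weak_L S g A T X u.
have FP : first_order S V P := first_order_weak_L gpos gC A1 A2 TC XC oV Cu.
have FQ : first_order S V (fun psi x => - (weak_L S g A T X u psi x + c x * psi x)).
  by apply: first_orderN; exact: first_orderD0.
have wL0 x : ~ C x -> weak_L S g A T X u psi x = 0.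
  move=> nCx; have n0 := near_notin cl out nCx.
  have gz : gradient S g psi x = 0.
    rewrite (@gradient_near _ _ _ S g psi (fun=> 0)) //.
    rewrite /gradient; suff -> : differential S (fun=> 0) x = 0 by rewrite mul0mx.
    apply: dch_near0; first exact: dom_chart_at.
    by apply: nearW.
  by rewrite /weak_L gz (out _ nCx) bil0r !mulr0 addr0.
rewrite (@integral_eq_support _ _ vol U C) => [|//|x _ nCx]; last first.
  by rewrite (out _ nCx) mule0.
rewrite (@integral_eq_support _ _ vol U C _ CU) => [|x _ nCx]; last by rewrite wL0.
rewrite (first_order_support vol FQ cl sV (Cpsi 1%N) out).
have Ccpsi x : V x -> {for x, continuous (fun x => c x * psi x)}.
  move=> Vx; apply: continuousM (cC _ Vx) _.
  exact: (CkM_continuous (U := setT) I (Cpsi 1%N)).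
have iP : vol.-integrable C (EFin \o P psi).
  apply: (integrable_compact gpos gC volg oV sV cpsi) => x Vx.
  exact: (first_order_continuous FP Vx (Cpsi 1%N) oV).
have iQ : vol.-integrable C (EFin \o (fun x => c x * psi x)).
  exact: (integrable_compact gpos gC volg oV sV cpsi).
have le1 : (\int[vol]_(x in C) (c x * psi x)%:E <=
    \int[vol]_(x in C) (eps%:E / (q x)%:E * (psi x)%:E))%E.
  apply: integral_mono => x /sV Vx; first by rewrite lee_fin mulr_ge0// c0.
  by rewrite EFinM lee_wpmul2r ?lee_fin// cq.
move=> /(le_trans le1) H.
have -> : (\int[vol]_(x in C) (- (weak_L S g A T X u psi x + c x * psi x))%:E =
    - (\int[vol]_(x in C) (P psi x)%:E + \int[vol]_(x in C) (c x * psi x)%:E))%E.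
  rewrite -(integralD mC iP iQ) -integralN.
    by apply: eq_integral => x _; rewrite EFinN EFinD.
  have iS : vol.-integrable C (fun x => (P psi x)%:E + (c x * psi x)%:E)%E.
    exact: (integrableD mC iP iQ).
  exact: integrable_add_def iS.
move: H; rewrite -/P.
have := integrable_fin_num mC iP; have := integrable_fin_num mC iQ.
rewrite /comp; case: (integral vol C (fun x => (c x * psi x)%:E)) => // a _.
case: (integral vol C (fun x => (P psi x)%:E)) => // b _.
by rewrite -EFinN -EFinD -EFinN !lee_fin; lra.
Qed.

End WeakSubsolution.

(** * The attained and the unattained supremum *)

Theorem theoremA (R : realType) (m : nat) (M : ptopologicalType)
    (S : manifold R m M) (g : M -> 'M[R]_m)
    (vol : {measure set (@borel M) -> \bar R})
    (A : R -> R) (T : M -> 'M[R]_m) (X : M -> 'rV[R]_m)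
    (q : M -> R) (K : set M) (u : M -> R) (eta : R) :
  (2 <= m)%N ->
  connected [set: M] ->
  riemannian_metric S g ->
  riemannian_volume S g vol ->
  assumption_A1 A -> assumption_A2 A -> assumption_A3 A ->
  assumption_T1 S T -> assumption_T2 g A T ->
  Ck_vector_field S 0 X ->
  continuous q -> (forall x, 0 <= q x) ->
  compact K -> (forall x, ~ K x -> 0 < q x) ->
  locally_integrable_inv vol q ->
  qSK S g vol A T X q K ->
  CkM S 1 [set: M] u ->
  has_ubound (range u) ->
  0 < eta ->
  inf_qL_le0 S g vol A T X q [set x | sup (range u) - eta < u x] u.
Proof.
move=> _ _ [gpos gCk] volg A1 A2 A3 [TC Tpos] T2 XC cq q0 _ qK _ SK Cu ubu eta0.
have gC := gCk 0%N; set s := sup (range u); set U := [set x | _].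
have cu x : {for x, continuous u} := CkM_continuous (U := setT) I Cu.
have us x : u x <= s by apply: ub_le_sup => //; exists x.
have oU : open U.
  by rewrite openE => x Ux; exact: (cu x _ (open_near (@open_gt _ (s - eta)) Ux)).
move=> eps0 eps00; apply: contrapT => nH.
have H psi : test_function S U psi -> (forall x, 0 <= psi x) ->
    (\int[vol]_(x in U) (eps0%:E / (q x)%:E * (psi x)%:E) <=
     - \int[vol]_(x in U) (weak_L S g A T X u psi x)%:E)%E.
  by move=> tpsi psi0; rewrite leNgt; apply/negP => lt; apply: nH; exists psi.
have [[x0 ux0]|nattained] := pselect (exists x0, u x0 = s).
  (* On the neighbourhood V of x0 where q < Q, the constant eps0 / Q is a positive lower bound of
     eps0 / q. *)
  pose Q := q x0 + 1; have Q0 : 0 < Q by rewrite ltr_wpDl.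
  pose V := U `&` [set x | q x < Q].
  have oV : open V.
    by apply: openI => //; rewrite openE => x qx; exact: (cq x _ (open_near (@open_lt _ Q) qx)).
  have Vx0 : V x0 by split; rewrite /U /V /= /Q ?ux0 ?ltrDl// ltrBlDr ltrDl.
  have c0 : 0 < eps0 / Q by rewrite divr_gt0.
  have umax z : V z -> u z <= u x0 by rewrite ux0.
  apply: (no_interior_max gpos gC volg A1 A2 A3 TC Tpos XC oV Vx0 Cu c0 umax).
  apply: (weak_subsolution_strict gpos gC volg A1 A2 TC XC oV (@subIsetl _ U _)
    (CkM_sub (@subsetT _ V) Cu) _ _ _ H) => [x _|x _|x [_ qx]].
  - exact: cst_continuous.
  - exact: ltW.
  (* Where q vanishes, eps0 / q is +oo in the extended reals and the bound is immediate. *)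
  - have [qx0|qx0] := eqVneq (q x) 0.
      by rewrite qx0 inve0 gt0_muley ?lte_fin// leey.
    rewrite inver (negPf qx0) -EFinM lee_fin ler_pM2l//.
    by rewrite lef_pV2 ?posrE// ?ltW// lt_neqAle eq_sym qx0 q0.
have lts x : u x < s.
  by rewrite lt_neqAle us andbT; apply/eqP => E; apply: nattained; exists x.
have [Sig [oSig Sigcov KSig Sigsub HSig]] := SK.
have Sigmono j k : (j <= k)%N -> Sig j `<=` Sig k.
  move=> /subnK <-; elim: (k - j)%N => [//|n IH] x /IH Sx.
  exact/Sigsub/subset_closure.
have Sigex x : exists j, Sig j x.
  have [j _ Sx] : (\bigcup_j Sig j) x by rewrite Sigcov.
  by exists j.
have [_ [x1 _ <-] x1eta] : exists2 e, range u e & s - eta < e.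
  by apply: sup_adherent => //; split => //; exists (u point), point.
have [j1 Sx1] := Sigex x1.
pose D := closure (Sig j1); have [oS1 cD] := oSig j1.
have Dx1 : D x1 by exact: subset_closure.
have cuD : {within D, continuous u} by apply: continuous_in_subspaceT => x _; exact: cu.
have [y1 _ y1max0] := @compact_EVT_max _ _ u D (ex_intro _ _ Dx1) cD cuD.
have y1max x : D x -> u x <= u y1 by move=> Dx; apply: y1max0; rewrite inE.
have uy1 : s - eta < u y1 by apply: lt_le_trans x1eta (y1max _ Dx1).
(* Here it matters that the supremum is not attained: u y1 < s, so u takes values above its maximum
   over D. *)
have [_ [x2 _ <-] x2lt] : exists2 e, range u e & s - (s - u y1) < e.
  apply: sup_adherent; first by rewrite subr_gt0.
  by split => //; exists (u point), point.
rewrite subKr in x2lt.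
have nDx2 : ~ D x2 by move=> /y1max; rewrite leNgt x2lt.
have [k Skx2] := Sigex x2; pose j2 := maxn k j1.+1.
have Sx2 : Sig j2 x2 by apply: Sigmono Skx2; exact: leq_maxl.
have j12 : (j1 < j2)%N by exact: leq_maxr.
(* Below eps0, to leave the positive gap (eps0 - eps) / q, and at most half of u x2 - u y1, so that
   subtracting gamma at x2 keeps half of the excess. *)
pose eps := Num.min eps0 (u x2 - u y1) / 2.
have d0 : 0 < u x2 - u y1 by rewrite subr_gt0.
have m0 : 0 < Num.min eps0 (u x2 - u y1) by rewrite lt_min eps00.
have m1 : Num.min eps0 (u x2 - u y1) <= eps0 by rewrite ge_min lexx.
have m2 : Num.min eps0 (u x2 - u y1) <= u x2 - u y1 by rewrite ge_min lexx orbT.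
have eps_gt0 : 0 < eps by rewrite divr_gt0.
have eps_lt : eps < eps0 by rewrite /eps; lra.
have eps_le : eps <= (u x2 - u y1) / 2 by rewrite ler_pM2r.
have [gam [[gamc Cgam] [gam0 gampos gameps gaminf gamL]]] := HSig j1 j2 j12 eps eps_gt0.
pose V := U `&` ~` D.
have oD : open (~` D) by apply: closed_openC; exact: closed_closure.
have oV : open V by exact: openI.
have VU : V `<=` U by exact: subIsetl.
have VD : V `<=` ~` D by exact: subIsetr.
(* Strictly between u y1, which bounds f on the boundary of Sigma_j1, and u y1 + (u x2 - u y1) / 2,
   which is at most f x2. *)
pose tau0 := u y1 + (u x2 - u y1) / 4.
(* Taken in the complement of the open set Sigma_j1, where gamma is continuous up to the boundary,
   so that C is closed; [CV] then shows that C misses the boundary as well. *)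
pose C := [set x | ~ Sig j1 x /\ tau0 <= u x - gam x].
have clC : closed C.
  move=> x clx.
  have nSx : ~ Sig j1 x.
    by move=> Sx; have [z [[nz _] Sz]] := clx _ (open_near oS1 Sx).
  split => //; rewrite leNgt; apply/negP => lt.
  have gx := (subspace_continuousP _ _).1 gamc x nSx.
  have fx : u z - gam z @[z --> within (~` Sig j1) (nbhs x)] --> u x - gam x.
    by apply: cvgB gx; apply: cvg_within_filter; exact: cu.
  have := fx _ (open_near (@open_lt _ tau0) lt) => /clx[z [[nz tz]] /(_ nz)] /=.
  by rewrite ltNge tz.
have CV : C `<=` V.
  move=> x [nSx tx].
  have nDx : ~ D x.
    move=> Dx; have gx : gam x = 0 by apply: gam0; split => // /interior_subset.
    by have := y1max _ Dx; move: tx; rewrite gx /tau0; lra.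
  split => //; have := gampos x nDx; rewrite /U /=.
  by move: tx uy1; rewrite /tau0; lra.
have cC : compact C.
  (* Where gamma > s - tau0, the bound u <= s forces f < tau0. *)
  have [C0 cC0 C0P] := gaminf (s - tau0).
  apply: (subclosed_compact clC cC0) => x [nSx tx]; apply: contrapT => nC0.
  by have := C0P x nSx nC0; have := us x; move: tx; lra.
have Vx2 : V x2 by split => //; rewrite /U /=; lra.
have nSD x : ~ D x -> ~ Sig j1 x by move=> nDx Sx; apply: nDx; exact: subset_closure.
have qpos x : ~ D x -> 0 < q x.
  move=> /nSD nSx; apply: qK => /KSig S0x; apply: nSx; exact: (Sigmono _ _ (leq0n _) _ S0x).
have fx2 : tau0 < u x2 - gam x2.
  by have := gameps x2 (conj Sx2 (nSD _ nDx2)); rewrite /tau0; lra.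
have outC x : V x -> ~ C x -> u x - gam x <= tau0.
  move=> [_ /nSD nSx] nC; rewrite leNgt; apply/negP => /ltW t; exact: nC.
have qinvC (c : R) x : ~ D x -> {for x, continuous (fun x => c / q x)}.
  move=> /qpos qx; apply: continuousM; first exact: cst_continuous.
  by apply: continuousV; [exact: lt0r_neq0|exact: cq].
have CuV : CkM S 1 V u := CkM_sub (@subsetT _ V) Cu.
have CgamV : CkM S 1 V gam := CkM_sub VD Cgam.
have qV x : V x -> ~ D x by case.
pose Pu psi x := - (weak_L S g A T X u psi x + eps0 / q x * psi x).
pose Pg psi x := weak_L S g A T X gam psi x + eps / q x * psi x.
have FPu : first_order S V Pu.
  apply: first_orderN; apply: first_orderD0 => [|x /qV]; last exact: qinvC.
  exact: (first_order_weak_L gpos gC A1 A2 TC XC oV CuV).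
have FPg : first_order S (~` D) Pg.
  apply: first_orderD0 => [|x]; last exact: qinvC.
  exact: (first_order_weak_L gpos gC A1 A2 TC XC oD Cgam).
have FPgV : first_order S V Pg.
  apply: first_orderD0 => [|x /qV]; last exact: qinvC.
  exact: (first_order_weak_L gpos gC A1 A2 TC XC oV CgamV).
have divE (c : R) x : ~ D x -> (c%:E / (q x)%:E = (c / q x)%:E)%E.
  by move=> /qpos qx; rewrite inver gt_eqF.
have nPu : weakly_nonneg S vol V Pu.
  apply: (weak_subsolution_strict gpos gC volg A1 A2 TC XC oV VU CuV _ _ _ H) => x /qV nDx.
  - exact: qinvC.
  - by rewrite divr_ge0// ltW.
  - by rewrite divE.
(* The supersolution inequality holds off D; restricting it to V puts both inequalities on one open
   set, where they can be added. *)
have nPg : weakly_nonneg S vol V Pg.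
  apply: (weakly_nonneg_sub VD FPg) => psi tpsi psi0.
  have := gamL psi tpsi psi0; congr (0 <= _)%E.
  apply: eq_integral => x; rewrite inE => nDx.
  by rewrite (divE _ _ nDx) -EFinM -EFinD.
have nP := weakly_nonnegD gpos gC volg oV FPu FPgV nPu nPg.
apply: (comparison_principle gpos gC volg A1 A2 T2 TC Tpos XC oV cC CV CuV CgamV
  (b := fun x => (eps0 - eps) / q x) _ _ outC Vx2 fx2) => [x /qV|x /qV nDx|].
- exact: qinvC.
- by rewrite divr_gt0 ?subr_gt0// qpos.
- move=> psi tpsi psi0; have := nP psi tpsi psi0; congr (0 <= _)%E.
  by apply: eq_integral => x _; congr EFin; rewrite /Pu /Pg mulrBl; ring.
Qed.
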